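(* Let $\Phi$ be an (LB)-space. (i) $\mathbb S(\Phi)$ is a subgroup of $\mathbb M(\Phi)$. $\mathbb A(\Phi)$ is an abelian normal subgroup of $\mathbb S(\Phi)$, $\mathbb B(\Phi)$ is a subgroup of $\mathbb S(\Phi)$, and $\mathbb S(\Phi)$ is the semidirect product of $\mathbb A(\Phi)$ and $\mathbb B(\Phi)$, i.e., $\mathbb S(\Phi)=\mathbb A(\Phi)\rtimes\mathbb B(\Phi)$. (ii) The following maps are group isomorphisms: $$\mathcal I:\mathcal S(\Phi)\to\mathbb S(\Phi),\qquad \mathcal I\restriction_{\mathcal F_0(\Phi)}:\mathcal F_0(\Phi)\to\mathbb A(\Phi),\qquad \mathcal I\restriction_{\mathcal F_1(\Phi)}:\mathcal F_1(\Phi)\to\mathbb B(\Phi).$$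
   Context: **Spaces.** All vector spaces are complex; $\mathbb N=\{1,2,\dots\}$, $\mathbb N_0=\mathbb N\cup\{0\}$. An (LB)-space $\Phi=\bigcup_n\Phi_n$: each $\Phi_n$ is a Banach space, $\Phi_n$ is a subspace of $\Phi_{n+1}$ on which the two norms coincide, and $\Phi$ has the locally convex inductive limit topology; $\Phi'$ is its continuous dual. For a Banach space $B$, $B^{\hat\otimes k}$ is the $k$-fold completed injective tensor power, $\operatorname{Sym}_k$ the symmetrization projection on it, $B^{\hat\odot k}:=\operatorname{Sym}_k(B^{\hat\otimes k})$. Set $\Phi^{\hat\odot k}:=\operatorname{ind\,lim}_n\Phi_n^{\hat\odot k}$, $\Phi^{\hat\odot 0}:=\mathbb C$. $\mathcal L(E,F)$ is the space of continuous linear operators from $E$ to $F$; $(\Phi^{\hat\odot k})'=\mathcal L(\Phi^{\hat\odot k},\mathbb C)$. For $A_m\in\mathcal L(\Phi^{\hat\odot i_m},\Phi^{\hat\odot j_m})$ ($m=1,2$), $A_1\odot A_2\in\mathcal L(\Phi^{\hat\odot(i_1+i_2)},\Phi^{\hat\odot(j_1+j_2)})$ is $\operatorname{Sym}_{j_1+j_2}(A_1\otimes A_2)$ restricted to $\Phi^{\hat\odot(i_1+i_2)}$ (multiplication by scalars if a factor is a scalar). $\mathbf 1_k$ is the identity of $\Phi^{\hat\odot k}$. **Formal tensor power series.** A formal series $C(\xi)=\sum_{k\ge i}C_k\xi^{\otimes k}$ of $\xi\in\Phi$ with values in $\Phi^{\hat\odot i}$ is a sequence of coefficients $C_k\in\mathcal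 L(\Phi^{\hat\odot k},\Phi^{\hat\odot i})$. $\mathcal F_0(\Phi)$: scalar-valued series $1+\sum_{k\ge1}A_k\xi^{\otimes k}$, a group under the product with coefficients $\sum_{l=0}^kA^{(1)}_l\odot A^{(2)}_{k-l}$. $\mathcal F_1(\Phi)$: $\Phi$-valued series $\xi+\sum_{k\ge2}B_k\xi^{\otimes k}$ (so $B_1=\mathbf 1_1$), a group under composition, where $C(B(\xi))$ has $k$th coefficient $\sum_{l=1}^kC_l\sum_{i_1+\dots+i_l=k,\,i_j\ge1}B_{i_1}\odot\cdots\odot B_{i_l}$ for $k\ge1$, and $0$th coefficient $C_0$ (if $C$ is scalar-valued). $\mathcal S(\Phi):=\mathcal F_0(\Phi)\times\mathcal F_1(\Phi)$ is a group for $(A^{(1)},B^{(1)})\ast(A^{(2)},B^{(2)})=(A^{(1)}(B^{(2)}(\xi))A^{(2)}(\xi),\,B^{(1)}(B^{(2)}(\xi)))$; $\mathcal F_0(\Phi)$ and $\mathcal F_1(\Phi)$ are regarded as subgroups of $\mathcal S(\Phi)$ by identifying $A(\xi)$ with $(A(\xi),\xi)$ and $B(\xi)$ with $(1,B(\xi))$. For a scalar-valued series $C(\xi)$ without constant term, $\exp[C(\xi)]=1+\sum_{n\ge1}C(\xi)^n/n!$. **Operators.** A polynomial on $\Phi'$ is a function $p(\omega)=\sum_{k=0}^K\langle\omega^{\otimes k},f^{(k)}\rangle$, $f^{(k)}\in\Phi^{\hat\odot k}$ (dual pairing; $\langle\omega^{\otimes0},f^{(0)}\rangle=f^{(0)}$);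 the $f^{(k)}$ are determined by $p$, and $\mathcal P(\Phi')$, the space of polynomials, has the topology of the locally convex direct sum of the $\Phi^{\hat\odot k}$. $\mathbb M(\Phi)$ is the set of continuous linear operators $P$ on $\mathcal P(\Phi')$ with $(P\langle\cdot^{\otimes k},f^{(k)}\rangle)(\omega)=P^{(k)}(\omega,f^{(k)}):=\sum_{i=0}^k\langle\omega^{\otimes i},P_{ik}f^{(k)}\rangle$ for $k\in\mathbb N_0$, where $P_{ik}\in\mathcal L(\Phi^{\hat\odot k},\Phi^{\hat\odot i})$ and $P_{kk}=\mathbf 1_k$; it is a group under composition of operators. The generating function of $P\in\mathbb M(\Phi)$ is $G(\omega,\xi)=\sum_{k\ge0}\frac1{k!}P^{(k)}(\omega,\xi^{\otimes k})$, for each $\omega\in\Phi'$ an element of $\mathcal F_0(\Phi)$. $P$ is a Sheffer operator if $G(\omega,\xi)=\exp[\langle\omega,B(\xi)\rangle]A(\xi)$ for all $\omega\in\Phi'$, for some $(A,B)\in\mathcal S(\Phi)$, where $\langle\omega,B(\xi)\rangle=\sum_{k\ge1}\langle\omega,B_k\xi^{\otimes k}\rangle$; an Appell operator if this holds with $B(\xi)=\xi$; an umbral operator if this holds with $A(\xi)=1$. The sets of Sheffer, Appell and umbral operators are $\mathbb S(\Phi),\mathbb A(\Phi),\mathbb B(\Phi)$. The map $\mathcal I:\mathcal S(\Phi)\to\mathbb S(\Phi)$ sends $(A(\xi),B(\xi))$ to the operator with generating function $\exp[\langle\omega,B(\xi)\rangle]A(\xi)$. *)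

(* Defs.v *)
From HB Require Import structures.
From mathcomp Require Import all_boot all_order all_algebra perm.
From mathcomp Require Import boolp classical_sets functions reals topology.
From mathcomp Require Import normedtype.

Set Implicit Arguments.
Unset Strict Implicit.
Unset Printing Implicit Defensive.

Import Order.TTheory GRing.Theory Num.Theory numFieldNormedType.Exports.

Local Open Scope classical_set_scope.
Local Open Scope ring_scope.

Section Groups.
Variables (T : Type) (op : T -> T -> T) (e : T).

Definition is_group (G : set T) : Prop :=
  [/\ G e,
      forall x y, G x -> G y -> G (op x y),
      forall x y z, G x -> G y -> G z -> op x (op y z) = op (op x y) z,
      forall x, G x -> op e x = x /\ op x e = x &
      forall x, G x -> exists y, [/\ G y, op x y = e & op y x = e]].

Definition subgroup_of (G H : set T) : Prop :=
  [/\ is_group G, is_group H & H `<=` G].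

Definition abelian_set (H : set T) : Prop :=
  forall x y, H x -> H y -> op x y = op y x.

Definition normal_subgroup_of (G N : set T) : Prop :=
  subgroup_of G N /\
  forall g g' h, G g -> G g' -> op g g' = e -> N h -> N (op (op g h) g').

Definition semidirect_product (G N H : set T) : Prop :=
  [/\ normal_subgroup_of G N, subgroup_of G H, N `&` H = [set e] &
      G = [set op n h | n in N & h in H]].
End Groups.

Definition group_isomorphism (S T : Type)
    (opS : S -> S -> S) (eS : S) (opT : T -> T -> T) (eT : T)
    (G : set S) (H : set T) (phi : S -> T) : Prop :=
  [/\ is_group opS eS G, is_group opT eT H, set_bij G H phi &
      forall x y, G x -> G y -> phi (opS x y) = opT (phi x) (phi y)].

Section Topology.
Variable K : numFieldType.

Definition abs_convex (E : lmodType K) (V : set E) : Prop :=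
  forall (a b : K) x y, V x -> V y -> `|a| + `|b| <= 1 -> V (a *: x + b *: y).

(* When N i is the image, under a linear map F_i -> E, of the neighbourhoods of
   0 in F_i, these are the neighbourhoods of 0 for the finest locally convex
   topology on E making all the maps F_i -> E continuous. *)
Definition inductive_nbhs0 (E : lmodType K) (I : Type)
    (N : I -> set_system E) : set_system E :=
  [set U | exists V : set E, [/\ abs_convex V, V `<=` U & forall i, N i V]].

Definition translated_nbhs (E : zmodType) (N0 : set_system E) (x : E) :
  set_system E := [set U | N0 [set y | U (x + y)]].

Definition lin_cont (E F : NbhsLmodule.type K) : set (E -> F) :=
  [set T | linear T /\ continuous T].

Record cdual (E : NbhsLmodule.type K) := Cdual {
  cdual_fun :> E -> K^o;
  cdual_lin_cont : lin_cont cdual_fun }.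
End Topology.

(* A k-linear form on D is a plain function ('I_k -> D) -> K^o. *)
Section Forms.
Variables (K : numFieldType) (D : Type).

Definition tensor_form (k l : nat)
    (u : ('I_k -> D) -> K^o) (v : ('I_l -> D) -> K^o) :
    ('I_(k + l) -> D) -> K^o :=
  fun f => u (fun j => f (lshift l j)) * v (fun j => f (rshift k j)).

Definition sym_form (k : nat) (u : ('I_k -> D) -> K^o) :
    ('I_k -> D) -> K^o :=
  fun f => (k`!%:R)^-1 * \sum_(s : 'S_k) u (fun j => f (s j)).
End Forms.

Section FormTheory.
Variables (K : numFieldType) (D : Type).

Lemma sym_formP k (a : K) (u v : ('I_k -> D) -> K^o) :
  sym_form (a *: u + v) = a *: sym_form u + sym_form v.
Proof.
apply/funext => f; rewrite /sym_form !fctE /=.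
rewrite [X in _ = X + _]mulrCA -mulrDr; congr (_ * _).
by rewrite mulr_sumr -big_split.
Qed.

Lemma sym_form0 k : sym_form (0 : ('I_k -> D) -> K^o) = 0.
Proof. by apply/funext => f; rewrite /sym_form big1 ?mulr0. Qed.
End FormTheory.

(* The completed injective tensor power of a Banach space B is realized as the
   closure, among the bounded k-linear forms on the dual of B, of the span of
   the elementary tensors. *)
Section InjectiveTensorPower.
Variables (K : numFieldType) (B : completeNormedModType K).

Definition elem_tensor (k : nat) (x : 'I_k -> B) : ('I_k -> cdual B) -> K^o :=
  fun f => \prod_j f j (x j).

Definition tensor_span (k : nat) : set (('I_k -> cdual B) -> K^o) :=
  [set v | exists (m : nat) (a : 'I_m -> K) (x : 'I_m -> 'I_k -> B),
     v = \sum_(j < m) a j *: elem_tensor (x j)].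

(* e bounds the injective norm of u, i.e. its norm as a k-linear form. *)
Definition inj_norm_le (k : nat) (u : ('I_k -> cdual B) -> K^o) (e : K) : Prop :=
  forall (f : 'I_k -> cdual B) (c : 'I_k -> K),
    (forall j, 0 <= c j) -> (forall j x, `|f j x| <= c j * `|x|) ->
    `|u f| <= (\prod_j c j) * e.

Definition inj_tensor_power (k : nat) : set (('I_k -> cdual B) -> K^o) :=
  [set u | forall e : K, 0 < e ->
     exists2 v, @tensor_span k v & inj_norm_le (u - v) e].

Definition sym_tensor_power (k : nat) : set (('I_k -> cdual B) -> K^o) :=
  @sym_form K (cdual B) k @` @inj_tensor_power k.

Lemma tensor_span0 k : @tensor_span k 0.
Proof.
by exists 0, (fun=> 0), (fun _ _ => 0); rewrite big_ord0.
Qed.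

Lemma tensor_spanP k a u v : @tensor_span k u -> @tensor_span k v ->
  @tensor_span k (a *: u + v).
Proof.
move=> [m1 [a1 [x1 ->]]] [m2 [a2 [x2 ->]]].
exists (m1 + m2)%N, (fun j => match fintype.split j with inl i => a * a1 i | inr i => a2 i end),
  (fun j => match fintype.split j with inl i => x1 i | inr i => x2 i end).
rewrite big_split_ord scaler_sumr; congr (_ + _); apply: eq_bigr => j _.
  by rewrite (unsplitK (inl j)) scalerA.
by rewrite (unsplitK (inr j)).
Qed.

Lemma tensor_span_sum k (I : Type) (r : seq I) (F : I -> ('I_k -> cdual B) -> K^o) :
  (forall i, @tensor_span k (F i)) -> @tensor_span k (\sum_(i <- r) F i).
Proof.
move=> h; elim/big_ind: _ => // [|u v hu hv]; first exact: tensor_span0.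
by rewrite -[u]scale1r; exact: tensor_spanP.
Qed.

Lemma tensor_spanZ k a u : @tensor_span k u -> @tensor_span k (a *: u).
Proof.
by move=> h; rewrite -[_ *: _]addr0; apply: tensor_spanP => //; exact: tensor_span0.
Qed.

Lemma tensor_span_elem k x : @tensor_span k (elem_tensor x).
Proof. by exists 1, (fun=> 1), (fun=> x); rewrite big_ord1 scale1r. Qed.

Lemma inj_norm_leP k a (u v : ('I_k -> cdual B) -> K^o) d e :
  inj_norm_le u d -> inj_norm_le v e -> inj_norm_le (a *: u + v) (`|a| * d + e).
Proof.
move=> hu hv f c c0 hf; rewrite !fctE /= mulrDr.
apply: (le_trans (ler_normD _ _)); apply: lerD; last exact: hv.
by rewrite normrM mulrCA ler_wpM2l // hu.
Qed.

Lemma inj_norm_le0 k e : 0 <= e -> inj_norm_le (0 : ('I_k -> cdual B) -> K^o) e.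
Proof.
move=> e0 f c c0 _; rewrite normr0 mulr_ge0 //.
by apply: prodr_ge0 => j _.
Qed.

Lemma inj_tensor_power0 k : @inj_tensor_power k 0.
Proof.
move=> e e0; exists 0; first exact: tensor_span0.
by rewrite subr0; apply: inj_norm_le0; exact: ltW.
Qed.

Lemma inj_tensor_powerP k a u v : @inj_tensor_power k u ->
  @inj_tensor_power k v -> @inj_tensor_power k (a *: u + v).
Proof.
move=> hu hv e e0.
have a0 : 0 < `|a| + 1 by rewrite ltr_wpDl.
have [u' su hu'] := hu (e / 2 / (`|a| + 1)) ltac:(by rewrite !divr_gt0).
have [v' sv hv'] := hv (e / 2) ltac:(by rewrite divr_gt0).
exists (a *: u' + v'); first exact: tensor_spanP.
have -> : a *: u + v - (a *: u' + v') = a *: (u - u') + (v - v').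
  by rewrite scalerBr opprD addrACA.
move=> f c c0 hf; apply: le_trans (inj_norm_leP a hu' hv' c0 hf) _.
rewrite ler_wpM2l ?prodr_ge0 //.
rewrite [leRHS](splitr e) lerD2r mulrCA ler_piMr ?divr_ge0 ?(ltW e0) //.
by rewrite ler_pdivrMr // mul1r lerDl.
Qed.

Lemma sym_tensor_power0 k : @sym_tensor_power k 0.
Proof. by exists 0; [exact: inj_tensor_power0|exact: sym_form0]. Qed.

Lemma sym_tensor_powerP k a u v : @sym_tensor_power k u ->
  @sym_tensor_power k v -> @sym_tensor_power k (a *: u + v).
Proof.
move=> [u' hu <-] [v' hv <-]; exists (a *: u' + v'); last exact: sym_formP.
exact: inj_tensor_powerP.
Qed.

Lemma sym_elem_tensor k x : @tensor_span k (sym_form (elem_tensor x)).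
Proof.
have -> : sym_form (elem_tensor x) = (k`!%:R)^-1 *:
    (\sum_(s : 'S_k) elem_tensor (fun j => x ((s^-1)%g j))).
  apply/funext => f; rewrite /sym_form fct_sumE !fctE; congr (_ * _).
  apply: eq_bigr => s _; rewrite /elem_tensor [RHS](reindex_inj (@perm_inj _ s)).
  by apply: eq_bigr => j _; rewrite permK.
by apply: tensor_spanZ; apply: tensor_span_sum => s; exact: tensor_span_elem.
Qed.

Lemma sym_tensor_span k v : @tensor_span k v -> @tensor_span k (sym_form v).
Proof.
move=> [m [a [x ->]]].
have -> : sym_form (\sum_(j < m) a j *: elem_tensor (x j)) =
    \sum_(j < m) a j *: sym_form (elem_tensor (x j)).
  elim/big_ind2: _ => // [|u u' w w' <- <-|i _]; first exact: sym_form0.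
    by rewrite -[X in sym_form (X + _)]scale1r sym_formP scale1r.
  by rewrite -[X in sym_form X]addr0 sym_formP sym_form0 addr0.
by apply: tensor_span_sum => j; apply/tensor_spanZ/sym_elem_tensor.
Qed.

Lemma sym_norm_le k (u : ('I_k -> cdual B) -> K^o) e :
  inj_norm_le u e -> inj_norm_le (sym_form u) e.
Proof.
move=> hu f c c0 hf; rewrite /sym_form normrM.
have k0 : (0 : K) < k`!%:R by rewrite ltr0n fact_gt0.
rewrite gtr0_norm ?invr_gt0 // mulrC ler_pdivrMr //.
apply: (le_trans (ler_norm_sum _ _ _)).
have -> : (\prod_j c j) * e * k`!%:R = \sum_(s : 'S_k) ((\prod_j c j) * e).
  by rewrite sumr_const card_Sn mulr_natr.
apply: ler_sum => s _.
rewrite [X in X * _](reindex_inj (@perm_inj _ s)).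
by apply: hu => // j x; exact: hf.
Qed.

Lemma sym_inj_tensor_power k u : @inj_tensor_power k u ->
  @inj_tensor_power k (sym_form u).
Proof.
move=> hu e e0; have [v sv hv] := hu e e0.
exists (sym_form v); first exact: sym_tensor_span.
have -> : sym_form u - sym_form v = sym_form (u - v).
  by rewrite addrC -scaleN1r -sym_formP scaleN1r addrC.
exact: sym_norm_le.
Qed.

Lemma inj_tensor_power_bounded k u : @inj_tensor_power k u ->
  exists2 M, 0 <= M & inj_norm_le u M.
Proof.
have elemb x : inj_norm_le (@elem_tensor k x) (\prod_j `|x j|).
  move=> f c c0 hf; rewrite /elem_tensor normr_prod -big_split.
  by apply: ler_prod => j _; rewrite normr_ge0 hf.
have spanb v : @tensor_span k v -> exists2 M, 0 <= M & inj_norm_le v M.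
  move=> [m [a [x ->]]]; elim/big_ind: _.
  - by exists 0 => //; exact: inj_norm_le0.
  - move=> v1 v2 [M1 M10 h1] [M2 M20 h2]; exists (`|1| * M1 + M2).
      by rewrite normr1 mul1r addr_ge0.
    by rewrite -[v1]scale1r; exact: inj_norm_leP.
  - move=> j _; exists (`|a j| * (\prod_i `|x j i|) + 0).
      by rewrite addr0 mulr_ge0 // prodr_ge0.
    by rewrite -[_ *: _]addr0; apply: inj_norm_leP => //; exact: inj_norm_le0.
move=> /(_ 1 ltr01) [v sv hv]; have [M M0 hM] := spanb v sv.
exists (`|1| * 1 + M); first by rewrite normr1 mul1r addr_ge0.
by rewrite -[u](subrK v) -[u - v]scale1r; exact: inj_norm_leP.
Qed.

Lemma tensor_span_form k l u v : @tensor_span k u -> @tensor_span l v ->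
  @tensor_span (k + l) (tensor_form u v).
Proof.
move=> [m [a [x ->]]] [n [b [y ->]]].
have -> : tensor_form (\sum_(j < m) a j *: elem_tensor (x j))
    (\sum_(j < n) b j *: elem_tensor (y j)) =
    \sum_(i < m) \sum_(j < n) (a i * b j) *: elem_tensor
      (fun p => match fintype.split p with inl q => x i q | inr q => y j q end).
  apply/funext => f; rewrite /tensor_form !fct_sumE mulr_suml.
  apply: eq_bigr => i _; rewrite fct_sumE mulr_sumr; apply: eq_bigr => j _.
  rewrite !fctE /= mulrACA; congr (_ * _).
  rewrite /elem_tensor big_split_ord; congr (_ * _); apply: eq_bigr => p _.
    by rewrite (unsplitK (inl p)).
  by rewrite (unsplitK (inr p)).
by do 2!apply: tensor_span_sum => ?; exact/tensor_spanZ/tensor_span_elem.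
Qed.

Lemma tensor_norm_le k l (u : ('I_k -> cdual B) -> K^o)
    (v : ('I_l -> cdual B) -> K^o) d e : inj_norm_le u d -> inj_norm_le v e ->
  inj_norm_le (tensor_form u v) (d * e).
Proof.
move=> hu hv f c c0 hf; rewrite /tensor_form normrM big_split_ord mulrACA.
by apply: ler_pM => //; [apply: hu|apply: hv].
Qed.

Lemma inj_tensor_power_form k l u v :
  @inj_tensor_power k u -> @inj_tensor_power l v ->
  @inj_tensor_power (k + l) (tensor_form u v).
Proof.
move=> hu hv e e0.
have [N N0 hN] := inj_tensor_power_bounded hv.
have N1 : 0 < N + 1 by rewrite ltr_wpDl.
have [u' su hu'] := hu (e / 2 / (N + 1)) ltac:(by rewrite !divr_gt0).
have iu' : inj_tensor_power u'.
  move=> d d0; exists u' => //; rewrite subrr; apply: inj_norm_le0; exact: ltW.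
have [M M0 hM] := inj_tensor_power_bounded iu'.
have M1 : 0 < M + 1 by rewrite ltr_wpDl.
have [v' sv hv'] := hv (e / 2 / (M + 1)) ltac:(by rewrite !divr_gt0).
exists (tensor_form u' v'); first exact: tensor_span_form.
have -> : tensor_form u v - tensor_form u' v' =
    1 *: tensor_form (u - u') v + tensor_form u' (v - v').
  apply/funext => f; rewrite scale1r /tensor_form !fctE.
  by rewrite mulrBl mulrBr addrA subrK.
move=> f c c0 hf.
apply: le_trans (inj_norm_leP 1 (tensor_norm_le hu' hN) (tensor_norm_le hM hv') c0 hf) _.
rewrite ler_wpM2l ?prodr_ge0 // normr1 mul1r [leRHS](splitr e).
have e20 : 0 <= e / 2 by rewrite divr_ge0 ?(ltW e0).
apply: lerD.
  by rewrite -mulrA ler_piMr // mulrC ler_pdivrMr // mul1r lerDl.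
by rewrite mulrCA ler_piMr // ler_pdivrMr // mul1r lerDl.
Qed.
End InjectiveTensorPower.

Arguments inj_tensor_power {K} B k.
Arguments sym_tensor_power {K} B k.

(* Banach spaces lb_step n isometrically embedded in each other, and their union
   lb_space; its topology is put on the alias lb_type. *)
Record LBspace (K : numFieldType) := {
  lb_step : nat -> completeNormedModType K;
  lb_space : lmodType K;
  lb_emb n : {linear lb_step n -> lb_step n.+1};
  lb_incl n : {linear lb_step n -> lb_space};
  lb_emb_norm n x : `|lb_emb n x| = `|x|;
  lb_incl_inj n : injective (lb_incl n);
  lb_incl_emb n x : lb_incl n.+1 (lb_emb n x) = lb_incl n x;
  lb_incl_union x : exists n y, lb_incl n y = x }.

Arguments lb_emb {K} l n.
Arguments lb_incl {K} l n.

Definition lb_type (K : numFieldType) (Phi : LBspace K) : Type := lb_space Phi.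

Section LB.
Variables (K : numFieldType) (Phi : LBspace K).
Local Notation step := (@lb_step K Phi).

HB.instance Definition _ := GRing.Lmodule.copy (lb_type Phi) (lb_space Phi).

Definition lb_in (n : nat) : step n -> lb_type Phi := lb_incl Phi n.

HB.instance Definition _ := hasNbhs.Build (lb_type Phi)
  (translated_nbhs (inductive_nbhs0 (fun n => @lb_in n @ (0 : step n)))).

Local Notation Phi' := (cdual (lb_type Phi)).

Fact cdual_restrict_subproof (w : Phi') n :
  lin_cont ((w \o @lb_in n) : step n -> K^o).
Proof.
case: w => w [wl wc]; split => [a x y|x U].
  by rewrite /= /lb_in linearP wl.
move=> /wc -[V [_ VU Vn]]; apply/nbhs0P.
have Vn0 : nbhs (0 : step n) (@lb_in n @^-1` V) := Vn n.
apply: filterS Vn0 => y /VU /=.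
by rewrite /lb_in linearD.
Qed.

Definition cdual_restrict n (w : Phi') : cdual (step n) :=
  Cdual (cdual_restrict_subproof w n).

(* The inductive limits of the tensor powers of the step spaces are realized as
   unions of sets of k-linear forms on the dual of Phi. By Hahn-Banach the
   restriction of functionals from Phi to a step space is onto, so form_push is
   injective on the tensor power of that step space. *)
Definition form_push k n (u : ('I_k -> cdual (step n)) -> K^o) :
    ('I_k -> Phi') -> K^o :=
  fun f => u (fun j => cdual_restrict n (f j)).

Definition tensor_pred k : {pred ('I_k -> Phi') -> K^o} :=
  mem (\bigcup_n (@form_push k n @` inj_tensor_power (step n) k)).

Definition sym_tensor_pred k : {pred ('I_k -> Phi') -> K^o} :=
  mem (\bigcup_n (@form_push k n @` sym_tensor_power (step n) k)).

Lemma form_pushP k n a u v :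
  @form_push k n (a *: u + v) = a *: form_push u + form_push v.
Proof. by []. Qed.

Fact cdual_step_subproof n (w : cdual (step n.+1)) :
  lin_cont ((w \o lb_emb Phi n) : step n -> K^o).
Proof.
case: w => w [wl wc]; split => [a x y|x U].
  by rewrite /= linearP wl.
move=> /wc /nbhs0P h; apply/nbhs0P.
move: h => /nbhs_ballP[e e0 he]; apply/nbhs_ballP; exists e => // y.
rewrite -!ball_normE /= !sub0r !normrN => hy.
by rewrite linearD; apply: he; rewrite -ball_normE /= sub0r normrN lb_emb_norm.
Qed.

Definition cdual_step n (w : cdual (step n.+1)) : cdual (step n) :=
  Cdual (cdual_step_subproof w).

Definition form_step k n (u : ('I_k -> cdual (step n)) -> K^o) :
    ('I_k -> cdual (step n.+1)) -> K^o :=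
  fun f => u (fun j => cdual_step (f j)).

Lemma cdual_ext (E : NbhsLmodule.type K) (v w : cdual E) : v =1 w -> v = w.
Proof.
case: v w => [v hv] [w hw] /= /funext vw; rewrite -vw in hw *.
by rewrite (Prop_irrelevance hv hw).
Qed.

Lemma form_push_step k n u : @form_push k n u = form_push (form_step u).
Proof.
apply/funext => f; congr u; apply/funext => j; apply: cdual_ext => x /=.
by rewrite /lb_in lb_incl_emb.
Qed.

Lemma inj_tensor_power_step k n u : inj_tensor_power (step n) k u ->
  inj_tensor_power (step n.+1) k (form_step u).
Proof.
move=> hu e /hu [v [m [a [x ->]]] hv].
exists (\sum_(j < m) a j *: elem_tensor (fun i => lb_emb Phi n (x j i))).
  by exists m, a, (fun j i => lb_emb Phi n (x j i)).
have -> : form_step u - \sum_(j < m) a j *: elem_tensor (fun i => lb_emb Phi n (x j i))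
    = form_step (u - \sum_(j < m) a j *: elem_tensor (x j)).
  by apply/funext => f; rewrite /form_step !fctE /= !fct_sumE.
move=> f c c0 hf; apply: hv => // j y.
by rewrite /= -lb_emb_norm; exact: hf.
Qed.

Lemma sym_tensor_power_step k n u : sym_tensor_power (step n) k u ->
  sym_tensor_power (step n.+1) k (form_step u).
Proof.
by move=> [v hv <-]; exists (form_step v) => //; exact: inj_tensor_power_step.
Qed.

Section Union.
Variables (k : nat) (X : forall n, set (('I_k -> cdual (step n)) -> K^o)).
Hypothesis X0 : forall n, @X n 0.
Hypothesis XP : forall n a u v, @X n u -> @X n v -> @X n (a *: u + v).
Hypothesis XS : forall n u, @X n u -> @X n.+1 (form_step u).

Lemma push_widen n m u : @X n u ->
  exists2 v, @X (n + m)%N v & form_push u = form_push v.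
Proof.
move=> hu; elim: m => [|m [v hv ->]].
  by rewrite addn0; exists u.
by rewrite addnS; exists (form_step v); [exact: XS|exact: form_push_step].
Qed.

Lemma push_union_common u v : (\bigcup_n (@form_push k n @` @X n)) u ->
  (\bigcup_n (@form_push k n @` @X n)) v ->
  exists n u' v', [/\ @X n u', @X n v', form_push u' = u & form_push v' = v].
Proof.
move=> [n _ [u' hu <-]] [m _ [v' hv <-]].
have [u1 hu1 ->] := push_widen m hu.
have := push_widen n hv; rewrite addnC => -[v1 hv1 ->].
by exists (n + m)%N, u1, v1.
Qed.

Lemma push_union_submod : submod_closed (mem (\bigcup_n (@form_push k n @` @X n))).
Proof.
split => [|a u v].
  by apply/mem_set; exists 0 => //; exists 0.
move=> /set_mem hu /set_mem hv; apply/mem_set.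
have [n [u' [v' [hu' hv' <- <-]]]] := push_union_common hu hv.
by exists n => //; exists (a *: u' + v'); [exact: XP|].
Qed.
End Union.

Fact tensor_pred_submod k : submod_closed (@tensor_pred k).
Proof.
apply: push_union_submod.
- by move=> n; exact: inj_tensor_power0.
- by move=> n a u v; exact: inj_tensor_powerP.
- by move=> n u; exact: inj_tensor_power_step.
Qed.

Fact sym_tensor_pred_submod k : submod_closed (@sym_tensor_pred k).
Proof.
apply: push_union_submod.
- by move=> n; exact: sym_tensor_power0.
- by move=> n a u v; exact: sym_tensor_powerP.
- by move=> n u; exact: sym_tensor_power_step.
Qed.

HB.instance Definition _ k := GRing.isSubmodClosed.Build K
  (('I_k -> Phi') -> K^o) (@tensor_pred k) (@tensor_pred_submod k).
HB.instance Definition _ k := GRing.isSubmodClosed.Build K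
  (('I_k -> Phi') -> K^o) (@sym_tensor_pred k) (@sym_tensor_pred_submod k).

Record tensor (k : nat) := Tensor {
  tensor_val :> ('I_k -> Phi') -> K^o; _ : tensor_val \in @tensor_pred k }.

HB.instance Definition _ k := [isSub for @tensor_val k].
HB.instance Definition _ k := [Choice of tensor k by <:].
HB.instance Definition _ k := [SubChoice_isSubLmodule of tensor k by <:].

Record sym_tensor (k : nat) := SymTensor {
  sym_tensor_val :> ('I_k -> Phi') -> K^o;
  _ : sym_tensor_val \in @sym_tensor_pred k }.

HB.instance Definition _ k := [isSub for @sym_tensor_val k].
HB.instance Definition _ k := [Choice of sym_tensor k by <:].
HB.instance Definition _ k := [SubChoice_isSubLmodule of sym_tensor k by <:].

HB.instance Definition _ k := hasNbhs.Build (tensor k)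
  (translated_nbhs (inductive_nbhs0 (fun (n : nat) (V : set (tensor k)) =>
    exists2 e : K, 0 < e & forall (w : tensor k) u,
      inj_tensor_power (step n) k u -> inj_norm_le u e ->
      tensor_val w = form_push u -> V w))).

HB.instance Definition _ k := hasNbhs.Build (sym_tensor k)
  (translated_nbhs (inductive_nbhs0 (fun (n : nat) (V : set (sym_tensor k)) =>
    exists2 e : K, 0 < e & forall (w : sym_tensor k) u,
      sym_tensor_power (step n) k u -> inj_norm_le u e ->
      sym_tensor_val w = form_push u -> V w))).

Fact tensor_mul_subproof k l (u : tensor k) (v : tensor l) :
  tensor_form u v \in @tensor_pred (k + l).
Proof.
case: u v => [u hu] [v hv] /=; apply/mem_set.
have [n [u' [v' [hu' hv' <- <-]]]] : exists n u' v',
    [/\ inj_tensor_power (step n) k u', inj_tensor_power (step n) l v',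
        form_push u' = u & form_push v' = v].
  move/set_mem: hu => [n _ [u' hu' <-]]; move/set_mem: hv => [m _ [v' hv' <-]].
  have [u1 hu1 ->] := push_widen (X := fun n => inj_tensor_power (step n) k)
    (@inj_tensor_power_step k) m hu'.
  have := push_widen (X := fun n => inj_tensor_power (step n) l)
    (@inj_tensor_power_step l) n hv'.
  by rewrite addnC => -[v1 hv1 ->]; exists (n + m)%N, u1, v1.
by exists n => //; exists (tensor_form u' v') => //; exact: inj_tensor_power_form.
Qed.

Definition tensor_mul k l (u : tensor k) (v : tensor l) : tensor (k + l) :=
  Tensor (tensor_mul_subproof u v).

Fact sym_subproof k (u : tensor k) : sym_form u \in @sym_tensor_pred k.
Proof.
case: u => u /= /set_mem [n _ [u' hu' <-]]; apply/mem_set.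
by exists n => //; exists (sym_form u') => //; exists u'.
Qed.

Definition symmetrize k (u : tensor k) : sym_tensor k :=
  SymTensor (sym_subproof u).

Fact sym_incl_subproof k (u : sym_tensor k) :
  sym_tensor_val u \in @tensor_pred k.
Proof.
case: u => u /= /set_mem [n _ [u' [v hv <-] <-]]; apply/mem_set.
by exists n => //; exists (sym_form v) => //; exact: sym_inj_tensor_power.
Qed.

Definition sym_incl k (u : sym_tensor k) : tensor k :=
  Tensor (sym_incl_subproof u).

Definition sym_cast k l (e : k = l) (u : sym_tensor k) : sym_tensor l :=
  ecast m (sym_tensor m) e u.

(* Phi^(0) is the line of functions of an empty family. *)
Fact scalar_tensor_subproof (a : K) : (fun=> a) \in @sym_tensor_pred 0.
Proof.
apply/mem_set; exists 0 => //; exists (fun=> a) => //.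
have hs : sym_form (fun=> a : K^o) = (fun=> a) :> (('I_0 -> cdual (step 0)) -> K^o).
  apply/funext => f; rewrite /sym_form sumr_const card_Sn fact0 invr1 mul1r.
  by rewrite mulr1n.
exists (fun=> a) => // e e0; exists (fun=> a).
  exists 1, (fun=> a), (fun _ _ => 0); apply/funext => f.
  rewrite big_ord1 fctE /elem_tensor big_ord0.
  by rewrite [RHS]mulr1.
by rewrite subrr; apply: inj_norm_le0; exact: ltW.
Qed.

Definition scalar_tensor (a : K) : sym_tensor 0 := SymTensor (scalar_tensor_subproof a).

Definition toperator k l := sym_tensor k -> sym_tensor l.

(* A1 (x) A2, the continuous linear operator extending A1 u (x) A2 v. This
   determines it on the tensors which are symmetric in the first i1 and in the
   last i2 arguments; its other values are irrelevant. *)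
Definition tensor_operator i1 j1 i2 j2 (A1 : toperator i1 j1)
    (A2 : toperator i2 j2) : tensor (i1 + i2) -> tensor (j1 + j2) :=
  xget (fun=> 0) [set T | @lin_cont K (tensor (i1 + i2)) (tensor (j1 + j2)) T /\
    forall u v, T (tensor_mul (sym_incl u) (sym_incl v)) =
      tensor_mul (sym_incl (A1 u)) (sym_incl (A2 v))].

Definition odot i1 j1 i2 j2 (A1 : toperator i1 j1) (A2 : toperator i2 j2) :
    toperator (i1 + i2) (j1 + j2) :=
  fun w => symmetrize (tensor_operator A1 A2 (sym_incl w)).

Definition toperator_cast k k' l l' (ek : k = k') (el : l = l')
    (A : toperator k l) : toperator k' l' :=
  fun w => sym_cast el (A (sym_cast (esym ek) w)).

Definition continuous_toperator k l : set (toperator k l) :=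
  @lin_cont K (sym_tensor k) (sym_tensor l).

(* A formal series with values in Phi^(i) is the sequence of its coefficients;
   a series without a term of some order has coefficient 0 there. *)
Definition tseries i := forall k, toperator k i.

Definition one_series : tseries 0 := fun k =>
  match k with 0 => idfun | _.+1 => fun=> 0 end.

Definition id_series : tseries 1 := fun k =>
  match k with 1 => idfun | _ => fun=> 0 end.

Definition F0 : set (tseries 0) :=
  [set A | (forall k, continuous_toperator (A k)) /\ A 0 = idfun].

Definition F1 : set (tseries 1) :=
  [set B | [/\ forall k, continuous_toperator (B k), B 0 = (fun=> 0) &
               B 1 = idfun]].

Definition series_mul (A1 A2 : tseries 0) : tseries 0 := fun k =>
  \sum_(l < k.+1)
    toperator_cast (subnKC (leq_ord l)) (erefl 0) (odot (A1 l) (A2 (k - l)%N)).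

(* s = [:: i_1; ...; i_l] lists the orders of the factors B_(i_1), ..., B_(i_l). *)
Fixpoint odot_seq (B : tseries 1) (s : seq nat) : toperator (sumn s) (size s) :=
  match s return toperator (sumn s) (size s) with
  | [::] => idfun
  | i :: s' => odot (B i) (@odot_seq B s')
  end.

Definition is_composition k l (s : l.-tuple 'I_k.+1) : bool :=
  all (fun i : 'I_k.+1 => 0 < i)%N s && (sumn (map val s) == k).

Fact composition_sum k l (s : {s : l.-tuple 'I_k.+1 | is_composition s}) :
  sumn (map val (val s)) = k.
Proof. by case: s => s /= /andP[_ /eqP]. Qed.

Fact composition_size k l (s : {s : l.-tuple 'I_k.+1 | is_composition s}) :
  size (map val (val s)) = l.
Proof. by rewrite size_map size_tuple. Qed.

Definition odot_compositions (B : tseries 1) k l : toperator k l :=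
  \sum_(s : {s : l.-tuple 'I_k.+1 | is_composition s})
    toperator_cast (composition_sum s) (composition_size s)
      (@odot_seq B (map val (val s))).

Definition series_comp i (C : tseries i) (B : tseries 1) : tseries i := fun k =>
  match k with
  | 0 => C 0
  | k'.+1 => \sum_(1 <= l < k'.+2) (C l \o @odot_compositions B k'.+1 l)
  end.

(* Meaningful when C has no constant term: C^n then has no term of order < n,
   which truncates the exponential series. *)
Definition series_exp (C : tseries 0) : tseries 0 := fun k =>
  @one_series k +
  \sum_(1 <= n < k.+1) (n`!%:R)^-1 *: iter n (series_mul C) one_series k.

Definition sheffer_mul (p q : tseries 0 * tseries 1) : tseries 0 * tseries 1 :=
  (series_mul (series_comp p.1 q.2) q.1, series_comp p.2 q.2).

Definition sheffer_one : tseries 0 * tseries 1 := (one_series, id_series).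

Definition sheffer_group : set (tseries 0 * tseries 1) := F0 `*` F1.

(* <w^(x)k, f> *)
Definition pairing k (w : Phi') (f : sym_tensor k) : K := f (fun=> w).

Definition pairing_series (w : Phi') (B : tseries 1) : tseries 0 :=
  fun k f => scalar_tensor (pairing w (B k f)).

Definition dual_poly_pred : {pred Phi' -> K^o} :=
  mem [set p | exists (d : nat) (f : forall k, sym_tensor k),
    p = fun w => \sum_(k < d.+1) pairing w (f k)].

Fact dual_poly_pred_submod : submod_closed dual_poly_pred.
Proof.
split => [|a p q /set_mem [d [f ->]] /set_mem [d' [g ->]]]; apply/mem_set.
  by exists 0, (fun k => 0); apply/funext => w; rewrite big_ord1.
pose cut n (h : forall k, sym_tensor k) k := if (k < n.+1)%N then h k else 0.
have cutE n m (h : forall k, sym_tensor k) w : (n <= m)%N ->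
    \sum_(k < n.+1) pairing w (h k) = \sum_(k < m.+1) pairing w (cut n h k).
  move=> nm; rewrite (big_ord_widen _ (fun k => pairing w (h k)) (_ : n.+1 <= m.+1)%N) //.
  by rewrite big_mkcond; apply: eq_bigr => k _; rewrite /cut; case: ifP.
exists (d + d')%N, (fun k => a *: cut d f k + cut d' g k); apply/funext => w.
rewrite !fctE (cutE _ _ _ _ (leq_addr d' d)) (cutE _ _ _ _ (leq_addl d d')).
by rewrite scaler_sumr -big_split.
Qed.

HB.instance Definition _ := GRing.isSubmodClosed.Build K (Phi' -> K^o)
  dual_poly_pred dual_poly_pred_submod.

Record dual_poly := DualPoly {
  dual_poly_val :> Phi' -> K^o; _ : dual_poly_val \in dual_poly_pred }.

HB.instance Definition _ := [isSub for dual_poly_val].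
HB.instance Definition _ := [Choice of dual_poly by <:].
HB.instance Definition _ := [SubChoice_isSubLmodule of dual_poly by <:].

Fact monomial_subproof k (f : sym_tensor k) : (fun w => pairing w f) \in dual_poly_pred.
Proof.
apply/mem_set; exists k, (dfwith (T := fun k => sym_tensor k) (fun=> 0) f); apply/funext => w.
rewrite (bigD1 ord_max) //= dfwith_in big1 ?addr0 // => i ik.
by rewrite dfwith_out // eq_sym; move: ik; rewrite -val_eqE.
Qed.

Definition monomial k (f : sym_tensor k) : dual_poly :=
  DualPoly (monomial_subproof f).

HB.instance Definition _ := hasNbhs.Build dual_poly
  (translated_nbhs (inductive_nbhs0
    (fun k => @monomial k @ (0 : sym_tensor k)))).

Definition triangular_operators : set (dual_poly -> dual_poly) :=
  [set P | @lin_cont K dual_poly dual_poly P /\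
    exists P_ : forall i k, toperator k i,
      [/\ forall i k, (i <= k)%N -> continuous_toperator (P_ i k),
          forall k, P_ k k = idfun &
          forall k f w, P (monomial f) w =
            \sum_(i < k.+1) pairing w (P_ i k f)]].

Definition generating_function (P : dual_poly -> dual_poly) (w : Phi') :
    tseries 0 :=
  fun k f => scalar_tensor ((k`!%:R)^-1 * P (monomial f) w).

Definition sheffer_series (p : tseries 0 * tseries 1) (w : Phi') : tseries 0 :=
  series_mul (series_exp (pairing_series w p.2)) p.1.

Definition sheffer_operators : set (dual_poly -> dual_poly) :=
  [set P | triangular_operators P /\ exists A B, [/\ F0 A, F1 B &
     generating_function P = sheffer_series (A, B)]].

Definition appell_operators : set (dual_poly -> dual_poly) :=
  [set P | triangular_operators P /\ exists A, F0 A /\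
     generating_function P = sheffer_series (A, id_series)].

Definition umbral_operators : set (dual_poly -> dual_poly) :=
  [set P | triangular_operators P /\ exists B, F1 B /\
     generating_function P = sheffer_series (one_series, B)].

Definition has_sheffer_series (p : tseries 0 * tseries 1) :
    set (dual_poly -> dual_poly) :=
  [set P | triangular_operators P /\ generating_function P = sheffer_series p].

Definition sheffer_map (p : tseries 0 * tseries 1) : dual_poly -> dual_poly :=
  xget (idfun : dual_poly -> dual_poly) (has_sheffer_series p).
End LB.

(* Main.v *)
Require Import Defs.
From HB Require Import structures.
From mathcomp Require Import all_boot all_order all_algebra.
From mathcomp Require Import complex ring lra fingroup perm.
From mathcomp Require Import boolp classical_sets functions reals topology.
From mathcomp Require Import normedtype.

(** A Sheffer operator [P] with series [(A, B)] maps the formal exponential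
    [exp <w, xi>] to [A(xi) exp <w, B(xi)>]. Hence, if [Q] has the series
    [(A', B')], the operator [P \o Q] maps it to
    [A'(xi) A(B'(xi)) exp <w, B(B'(xi))>]: composition of operators is the product
    [sheffer_mul] of pairs of series ([has_sheffer_mul]). A pair determines its
    operator, an operator determines its pair ([has_sheffer_inj]), and every pair
    occurs ([has_sheffer_exists]). The group laws for series are therefore inherited
    from the composition of maps ([group_isomorphism_transfer]), once left inverses
    are available; these are found by recursion on the order, all equations being
    triangular with identities on the diagonal ([F0_inverse], [series_comp_solve],
    [triangular_left_inverse]). The Appell operators are the kernel of the
    homomorphism [(A, B) |-> B], and [(A, B)] is the product of [(C, xi)] and [(1, B)]
    for the solution [C] of [C(B(xi)) = A(xi)].

    To compute with series, the operators [odot A1 A2] have to exist, which is a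
    matter of analysis: [tensor_operatorP]. The injective tensor product of an
    operator with the identity is obtained by applying the operator to slices of a
    form, provided that the operator maps each step of the inductive limit boundedly
    into a single step ([step_tensor_image], [step_tensor_bound]). This follows from
    the continuity of the operator because the tensor powers of the steps are closed
    in their union ([tensor_power_closed]), and that in turn because functionals on
    a step extend to the whole space without increase of the norm, by the
    Hahn-Banach theorem ([LB_extends_functionals]).

    The algebra is then reduced to scalars. By polarization in both variables, a
    continuous operator [A] on symmetric tensors is determined by the numbers
    [pairing w (A (tpow x k))] ([toperator_ext]). For fixed [w] and [x] a series
    becomes a sequence of scalars and products of series become Cauchy products.
    That substitution of a series [B] is compatible with products
    ([series_comp_mul]), hence with exponentials, is seen by evaluating operators on
    the powers of the polynomial curve [t |-> B(t x)] and comparing the coefficients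
    of the powers of [t]. *)

Set Implicit Arguments.
Unset Strict Implicit.
Unset Printing Implicit Defensive.

Import Order.TTheory GRing.Theory Num.Theory numFieldNormedType.Exports.

Local Open Scope classical_set_scope.
Local Open Scope ring_scope.

(** * Real Hahn-Banach theorem *)

Section RealHahnBanach.
Variables (R : realType) (V : lmodType R) (p : V -> R).
Hypothesis p_add : forall x y, p (x + y) <= p x + p y.
Hypothesis p_scale : forall (t : R) x, 0 <= t -> p (t *: x) = t * p x.

(** Partial functionals are encoded by their graphs: these are plain sets, to
    which Zorn's lemma for inclusion applies. Domination makes a linear graph
    single-valued. *)
Definition linear_graph (G : set (V * R)) : Prop :=
  forall t x y a b, G (x, a) -> G (y, b) -> G (t *: x + y, t * a + b).

Definition dominated_graph (G : set (V * R)) : Prop :=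
  forall x a, G (x, a) -> a <= p x.

Definition line_graph (G : set (V * R)) (x0 : V) (s : R) : set (V * R) :=
  [set z | exists x a t, G (x, a) /\ z = (x + t *: x0, a + t * s)].

Lemma line_graph_linear G x0 s : linear_graph G ->
  linear_graph (line_graph G x0 s).
Proof.
move=> linG t _ _ _ _ [x [a [u [Ga [-> ->]]]]] [y [b [v [Gb [-> ->]]]]].
exists (t *: x + y), (t * a + b), (t * u + v); split; first exact: linG.
rewrite scalerDl scalerDr scalerA addrACA; congr (_, _).
by rewrite mulrDr mulrDl mulrA addrACA.
Qed.

(** The value [s] at [x0] has to satisfy [a - p (x - x0) <= s <= p (y + x0) - b]
    for all [(x, a)] and [(y, b)] in the graph. Subadditivity of [p] makes every
    left-hand side at most every right-hand side, so a supremum works. *)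
Lemma dominated_line_graph G x0 : linear_graph G -> dominated_graph G ->
  G (0, 0) -> exists s, dominated_graph (line_graph G x0 s).
Proof.
move=> linG domG G0.
pose L := [set z | exists x a, G (x, a) /\ z = a - p (x - x0)].
have LU y b : G (y, b) -> ubound L (p (y + x0) - b).
  move=> Gb _ [x [a [Ga ->]]]; rewrite lerBlDr addrAC lerBrDr.
  have := domG _ _ (linG 1 _ _ _ _ Ga Gb); rewrite scale1r mul1r => /le_trans->//.
  rewrite [leRHS]addrC; have -> : x + y = (x - x0) + (y + x0).
    by rewrite [y + x0]addrC addrA subrK.
  exact: p_add.
have L0 : L !=set0 by exists (0 - p (0 - x0)), 0, 0.
exists (sup L) => _ _ [x [a [t [Ga [-> ->]]]]].
have Ls y b : G (y, b) -> b - p (y - x0) <= sup L.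
  move=> Gb; apply: ub_le_sup; first by exists (p (y + x0) - b); exact: LU.
  by exists y, b.
have sL y b : G (y, b) -> sup L <= p (y + x0) - b.
  by move=> Gb; apply: ge_sup => //; exact: LU.
have GZ u y b : G (y, b) -> G (u *: y, u * b).
  by move=> Gb; have := linG u _ _ _ _ Gb G0; rewrite !addr0.
have [t0|t0|->] := ltgtP t 0; last by rewrite scale0r mul0r !addr0; exact: domG.
- have t0' : t != 0 by rewrite lt_eqF.
  have := Ls _ _ (GZ (- t)^-1 _ _ Ga).
  rewrite -(ler_pM2l (_ : 0 < - t)) ?oppr_gt0 // mulrBr mulVKf ?oppr_eq0 //.
  rewrite -p_scale ?oppr_ge0 ?(ltW t0) // scalerBr scalerA mulfV ?oppr_eq0 // scale1r.
  rewrite scaleNr opprK mulNr; lra.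
- have t0' : t != 0 by rewrite gt_eqF.
  have := sL _ _ (GZ t^-1 _ _ Ga).
  rewrite -(ler_pM2l t0) mulrBr mulVKf // -p_scale ?(ltW t0) //.
  by rewrite scalerDr scalerA divff // scale1r lerBrDr addrC.
Qed.

(** A graph that is maximal among the dominated linear ones has full domain,
    because otherwise [dominated_line_graph] enlarges it. *)
Lemma hahn_banach (f : V -> R) (D : set V) :
  D 0 -> (forall t x y, D x -> D y -> D (t *: x + y)) ->
  (forall t x y, D x -> D y -> f (t *: x + y) = t * f x + f y) ->
  (forall x, D x -> f x <= p x) ->
  exists g : V -> R, [/\ forall t x y, g (t *: x + y) = t * g x + g y,
    forall x, D x -> g x = f x & forall x, g x <= p x].
Proof.
move=> D0 Dlin flin fp.
pose G0 := [set z | D z.1 /\ z.2 = f z.1].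
(* The empty graph is let in because it is the union of the empty chain. *)
pose P G := [/\ linear_graph G, dominated_graph G & G !=set0 -> G0 `<=` G].
have p0 : p 0 = 0 by rewrite -(scale0r 0) p_scale // mul0r.
have f0 : f 0 = 0.
  by have := flin (-1) 0 0 D0 D0; rewrite scaler0 addr0 mulN1r addNr.
have PG0 : P G0.
  split => [t x y a b [/= Dx ->] [/= Dy ->]|x a [/= Dx ->]|_ z //].
    by split => /=; [exact: Dlin|rewrite flin].
  exact: fp.
have [F FP Ftot|G [[linG domG sG] Gmax]] := @Zorn_bigcup _ P.
  split.
  - move=> t x y a b [X FX Xa] [Y FY Yb].
    have [XY|YX] := Ftot _ _ FX FY.
      by exists Y => //; have [linY _ _] := FP _ FY; apply: linY => //; apply: XY.
    by exists X => //; have [linX _ _] := FP _ FX; apply: linX => //; apply: YX.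
  - by move=> x a [X FX Xa]; have [_ domX _] := FP _ FX; exact: domX.
  - move=> [z [X FX Xz]] w wG; exists X => //.
    by have [_ _] := FP _ FX; apply => //; exists z.
have Gn0 : G !=set0.
  apply: contrapT => /nonemptyPn G_0; apply: (Gmax G0) => //.
  rewrite G_0; split => // /(_ (0, 0)); apply; by split.
have {}sG := sG Gn0.
have G00 : G (0, 0) by apply: sG; split.
have Gfun x a b : G (x, a) -> G (x, b) -> a = b.
  have Gle c d : G (x, c) -> G (x, d) -> c <= d.
    move=> Gc Gd; have := domG _ _ (linG (-1) _ _ _ _ Gd Gc).
    by rewrite scaleN1r addNr p0 mulN1r addrC subr_le0.
  by move=> Ga Gb; apply/le_anti; rewrite !Gle.
have Gtot x : exists a, G (x, a).
  apply: contrapT => nx.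
  have [s dom] := dominated_line_graph x linG domG G00.
  have Gl : G `<=` line_graph G x s.
    by move=> [y a] Ga; exists y, a, 0; split => //; rewrite scale0r mul0r !addr0.
  apply: (Gmax (line_graph G x s)); last first.
    by split => // [|_]; [exact: line_graph_linear|exact: subset_trans Gl].
  split => // /(_ (x, s)) lG; apply: nx; exists s; apply: lG.
  by exists 0, 0, 1; split => //; rewrite scale1r mul1r !add0r.
have [g gP] := choice Gtot.
exists g; split => [t x y|x Dx|x].
- by apply: Gfun (gP _) _; exact: linG.
- by apply: Gfun (gP _) _; exact: sG.
- exact: domG (gP x).
Qed.
End RealHahnBanach.

(** * Inductive topologies and the norm of an (LB)-space *)

Section LinearMaps.
Variables (K : numFieldType) (E F : lmodType K) (T : E -> F).
Hypothesis T_lin : linear T.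

Lemma lin0 : T 0 = 0.
Proof. by have := T_lin (-1) 0 0; rewrite scaler0 addr0 scaleN1r addNr. Qed.

Lemma linD x y : T (x + y) = T x + T y.
Proof. by have := T_lin 1 x y; rewrite !scale1r. Qed.

Lemma linZ a x : T (a *: x) = a *: T x.
Proof. by have := T_lin a x 0; rewrite !addr0 lin0 addr0. Qed.

Lemma linN x : T (- x) = - T x.
Proof. by rewrite -scaleN1r linZ scaleN1r. Qed.

Lemma linB x y : T (x - y) = T x - T y.
Proof. by rewrite linD linN. Qed.

Lemma lin_sum (I : Type) (r : seq I) (P : pred I) (G : I -> E) :
  T (\sum_(i <- r | P i) G i) = \sum_(i <- r | P i) T (G i).
Proof.
by elim/big_ind2: _ => [|x u y v <- <-|//]; [exact: lin0|exact: linD].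
Qed.

Lemma abs_convex_preimage (V : set F) : abs_convex V -> abs_convex (T @^-1` V).
Proof. by move=> cV a b x y Vx Vy ab; rewrite /= T_lin linZ; exact: cV. Qed.
End LinearMaps.

Lemma normB_le1 (K : numFieldType) (a b e : K) (x y : K) : 0 <= e ->
  `|x| <= e -> `|y| <= e -> `|a| + `|b| <= 1 -> `|a * x + b * y| <= e.
Proof.
move=> e0 xe ye ab; apply: (le_trans (ler_normD _ _)); rewrite !normrM.
apply: (@le_trans _ _ ((`|a| + `|b|) * e)); last by rewrite ler_piMl.
by rewrite mulrDl lerD // ler_wpM2l.
Qed.

Lemma nbhs0_scalar (K : numFieldType) (U : set K^o) :
  nbhs (0 : K^o) U -> exists2 e : K, 0 < e & forall z, `|z| <= e -> U z.
Proof.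
move=> /nbhs_ballP[e /= e0 eU]; exists (e / 2); first by rewrite divr_gt0.
move=> z ze; apply: eU; rewrite -ball_normE /= sub0r normrN.
by apply: le_lt_trans ze _; rewrite ltr_pdivrMr // ltr_pMr // ltr1n.
Qed.

Section InductiveTopology.
Variables (K : numFieldType) (E F : NbhsLmodule.type K) (I J : Type).
Variables (NE : I -> set_system E) (NF : J -> set_system F).
Hypothesis nbhsE : forall x : E, nbhs x = translated_nbhs (inductive_nbhs0 NE) x.
Hypothesis nbhsF : forall x : F, nbhs x = translated_nbhs (inductive_nbhs0 NF) x.
Hypothesis NE_up : forall i V W, V `<=` W -> NE i V -> NE i W.

(** Absolutely convex sets suffice because their preimages under linear maps
    are absolutely convex. *)
Lemma lin_cont_inductive (T : E -> F) :
  lin_cont T <->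
  linear T /\ forall V, abs_convex V -> (forall j, NF j V) ->
    forall i, NE i (T @^-1` V).
Proof.
split=> -[Tlin Tc]; split=> //; first move=> V cV NV i; last move=> x U.
  have T0 := lin0 Tlin.
  have : nbhs (T 0) V.
    rewrite nbhsF T0; exists V; split => // y Vy; by rewrite /= add0r.
  move/Tc; rewrite nbhs_simpl /= nbhsE => -[W [_ WV NW]].
  by apply: NE_up (NW i) => y /WV /=; rewrite add0r.
rewrite nbhsF => -[V [cV VU NV]]; rewrite nbhs_simpl /= nbhsE.
exists (T @^-1` V); split; [exact: abs_convex_preimage| |exact: Tc].
by move=> y /VU /=; rewrite (linD Tlin).
Qed.

Lemma lin_cont_scalar (T : E -> K^o) :
  lin_cont T <->
  linear T /\ forall (e : K), 0 < e -> forall i, NE i [set x | `|T x| <= e].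
Proof.
split=> -[Tlin Tc]; split=> //; first move=> e e0 i; last move=> x U.
  have T0 := lin0 Tlin.
  have : nbhs (T 0) [set z : K^o | `|z| <= e].
    rewrite T0; apply/nbhs_ballP; exists e => // z.
    by rewrite -ball_normE /= sub0r normrN => /ltW.
  move/Tc; rewrite nbhs_simpl /= nbhsE => -[W [_ WV NW]].
  by apply: NE_up (NW i) => y /WV /=; rewrite add0r.
move=> /nbhs0P /nbhs0_scalar[e e0 eU]; rewrite nbhs_simpl /= nbhsE.
exists [set x | `|T x| <= e]; split; last exact: Tc.
- move=> a b y z /= ye ze ab; rewrite Tlin (linZ Tlin).
  by apply: normB_le1 ye ze ab; exact: ltW.
- by move=> y /= /eU; rewrite (linD Tlin).
Qed.
End InductiveTopology.

Lemma cdual_bounded (K : numFieldType) (B : normedModType K) (f : cdual B) :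
  exists2 c : K, 0 <= c & forall x, `|f x| <= c * `|x|.
Proof.
case: f => f /= [flin fc].
have f0 := lin0 flin.
have : nbhs (f 0) [set z : K^o | `|z| <= 1].
  rewrite f0; apply/nbhs_ballP; exists 1 => //= z.
  by rewrite -ball_normE /= sub0r normrN => /ltW.
move/fc; rewrite nbhs_simpl /= => /nbhs_ballP[e /= e0 ef].
have e20 : 0 < e / 2 by rewrite divr_gt0.
exists (e / 2)^-1 => [|x]; first by rewrite invr_ge0 (ltW e20).
have [->|x0] := eqVneq x 0; first by rewrite f0 !normr0 mulr0.
have nx : 0 < `|x| by rewrite normr_gt0.
have a0 : 0 < e / 2 / `|x| by rewrite divr_gt0.
have : ball 0 e ((e / 2 / `|x|) *: x).
  rewrite -ball_normE /= sub0r normrN normrZ (gtr0_norm a0).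
  by rewrite divfK ?gt_eqF // ltr_pdivrMr // ltr_pMr // ltr1n.
move=> /ef /=; rewrite (linZ flin) normrM (gtr0_norm a0).
by rewrite -ler_pdivlMl // mulr1 invf_div mulrC.
Qed.

Lemma cdual_bounds (K : numFieldType) (B : normedModType K) (I : Type)
    (f : I -> cdual B) :
  exists2 c : I -> K, forall i, 0 <= c i & forall i x, `|f i x| <= c i * `|x|.
Proof.
have /choice [c fc] : forall i, exists c : K, 0 <= c /\ forall x, `|f i x| <= c * `|x|.
  by move=> i; have [c c0 fc] := cdual_bounded (f i); exists c.
by exists c => i; have [] := fc i.
Qed.

Section LBNorm.
Variables (K : numFieldType) (Phi : LBspace K).
Local Notation step := (@lb_step K Phi).
Local Notation Phi' := (cdual (lb_type Phi)).

Lemma lb_nbhs_up n (V W : set (lb_type Phi)) : V `<=` W ->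
  nbhs (@lb_in K Phi n @ (0 : step n)) V -> nbhs (@lb_in K Phi n @ (0 : step n)) W.
Proof. by move=> VW; apply: filterS => x; exact: VW. Qed.

Lemma lb_bounded_lin_cont (g : lb_type Phi -> K^o) : linear g ->
  (forall n, exists2 c, 0 <= c & forall x : step n, `|g (lb_in x)| <= c * `|x|) ->
  lin_cont g.
Proof.
move=> glin gb; apply/(@lin_cont_scalar _ _ _
  (fun n => nbhs (@lb_in K Phi n @ (0 : step n)))); first by [].
  exact: lb_nbhs_up.
split => // e e0 n; have [c c0 gc] := gb n; rewrite nbhs_simpl /=.
apply/nbhs_ballP; exists (e / (c + 1)) => /=; first by rewrite divr_gt0 // ltr_wpDl.
move=> x; rewrite -ball_normE /= sub0r normrN => xe.
apply: (le_trans (gc x)); apply: (@le_trans _ _ ((c + 1) * `|x|)).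
  by rewrite ler_wpM2r // lerDl.
by rewrite mulrC -ler_pdivlMr ?ltW // ltr_wpDl.
Qed.

Lemma lb_bounded_cdual (g : lb_type Phi -> K) :
  (forall t x y, g (t *: x + y) = t * g x + g y) ->
  (forall n, exists2 c, 0 <= c & forall x : step n, `|g (lb_in x)| <= c * `|x|) ->
  exists G : Phi', forall z, G z = g z.
Proof. by move=> glin gb; exists (Cdual (lb_bounded_lin_cont glin gb)). Qed.

Lemma lb_widen n m (x : step n) :
  exists2 y : step (n + m), lb_in y = lb_in x & `|y| = `|x|.
Proof.
elim: m => [|m [y yx ny]]; first by rewrite addn0; exists x.
rewrite addnS; exists (lb_emb Phi _ y); last by rewrite lb_emb_norm.
by rewrite -yx; exact: lb_incl_emb.
Qed.

Lemma lb_common n m (x : step n) (y : step m) :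
  exists k (x' y' : step k), [/\ lb_in x' = lb_in x, lb_in y' = lb_in y,
    `|x'| = `|x| & `|y'| = `|y|].
Proof.
have [x' xx nx] := lb_widen m x; have := lb_widen n y; rewrite addnC => -[y' yy ny].
by exists (n + m)%N, x', y'.
Qed.

Lemma lb_in_norm n m (x : step n) (y : step m) : lb_in x = lb_in y -> `|x| = `|y|.
Proof.
have [k [x' [y' [<- <- <- <-]]]] := lb_common x y.
by move=> /(@lb_incl_inj _ Phi k) ->.
Qed.

(** The steps are embedded isometrically, so their union is a normed space. The
    topology of this norm is coarser than the inductive limit topology: a
    continuous functional is bounded on each step, not necessarily uniformly. *)
Definition lb_norm (z : lb_type Phi) : K :=
  xget 0 [set r | exists n (x : step n), lb_in x = z /\ r = `|x|].

Lemma lb_normE n (x : step n) : lb_norm (lb_in x) = `|x|.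
Proof.
rewrite /lb_norm; case: xgetP => [r _ [m [y [yx ->]]]|/(_ `|x|)]; last first.
  by case; exists n, x.
exact: lb_in_norm.
Qed.

Lemma lb_inP n : linear (@lb_in K Phi n).
Proof. by move=> a x y; rewrite /lb_in linearP. Qed.

Lemma lb_unionP (z : lb_type Phi) : exists n (x : step n), lb_in x = z.
Proof. exact: lb_incl_union. Qed.

Lemma lb_norm_ge0 z : 0 <= lb_norm z.
Proof. by have [n [x <-]] := lb_unionP z; rewrite lb_normE. Qed.

Lemma lb_normD z w : lb_norm (z + w) <= lb_norm z + lb_norm w.
Proof.
have [n [x <-]] := lb_unionP z; have [m [y <-]] := lb_unionP w.
have [k [x' [y' [<- <- _ _]]]] := lb_common x y.
by rewrite -(linD (@lb_inP k)) !lb_normE ler_normD.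
Qed.

Lemma lb_normZ a z : lb_norm (a *: z) = `|a| * lb_norm z.
Proof.
have [n [x <-]] := lb_unionP z.
by rewrite -(linZ (@lb_inP n)) !lb_normE normrZ.
Qed.
End LBNorm.

(** * Extension of functionals from a step *)

Section Realification.
Variables (R : realType) (E : lmodType R[i]).
Local Open Scope complex_scope.

(** Restriction of scalars. *)
Definition realification : Type := E.
HB.instance Definition _ := GRing.Zmodule.copy realification E.

Definition real_scale (a : R) (x : realification) : realification :=
  (a%:C *: (x : E)).

Fact real_scaleA a b v : real_scale a (real_scale b v) = real_scale (a * b) v.
Proof. by rewrite /real_scale scalerA -rmorphM. Qed.
Fact real_scale1 : left_id 1 real_scale.
Proof. by move=> v; rewrite /real_scale scale1r. Qed.
Fact real_scaleDr : right_distributive real_scale +%R.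
Proof. by move=> a u v; rewrite /real_scale scalerDr. Qed.
Fact real_scaleDl v : {morph real_scale^~ v : a b / a + b}.
Proof. by move=> a b; rewrite /real_scale rmorphD scalerDl. Qed.

HB.instance Definition _ := GRing.Zmodule_isLmodule.Build R realification
  real_scaleA real_scale1 real_scaleDr real_scaleDl.

End Realification.

Section ComplexHahnBanach.
Variables (R : realType) (E : lmodType R[i]) (p : E -> R[i]).
Local Open Scope complex_scope.
Hypothesis p_ge0 : forall x, 0 <= p x.
Hypothesis p_add : forall x y, p (x + y) <= p x + p y.
Hypothesis p_scale : forall a x, p (a *: x) = `|a| * p x.

(** A complex functional [h] is recovered from its real part [g] by
    [h x = g x - i g (i x)]. Multiplying [x] by a number of modulus 1 that makes
    [h x] a nonnegative real number turns the bound on [g] into a bound on [h]. *)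
Lemma hahn_banach_complex (f : E -> R[i]) (D : set E) :
  D 0 -> (forall t x y, D x -> D y -> D (t *: x + y)) ->
  (forall t x y, D x -> D y -> f (t *: x + y) = t * f x + f y) ->
  (forall x, D x -> `|f x| <= p x) ->
  exists g : E -> R[i], [/\ forall t x y, g (t *: x + y) = t * g x + g y,
    forall x, D x -> g x = f x & forall x, `|g x| <= p x].
Proof.
move=> D0 Dlin flin fp.
have leRe (x y : R[i]) : x <= y -> complex.Re x <= complex.Re y.
  by rewrite lecE => /andP[].
have ReM (r : R) (z : R[i]) : complex.Re (r%:C * z) = r * complex.Re z.
  by case: z => a b /=; rewrite mul0r subr0.
have ReD (x y : R[i]) : complex.Re (x + y) = complex.Re x + complex.Re y.
  by case: x y => [a b] [c d].
have pE x : p x = (complex.Re (p x))%:C by rewrite RRe_real // ger0_real.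
have [|||||g [glin gf gp]] := @hahn_banach R (realification E)
  (fun x => complex.Re (p x)) _ _ (fun x => complex.Re (f x)) D D0.
- by move=> x y; rewrite -ReD; apply: leRe; exact: p_add.
- by move=> t x t0; rewrite p_scale ger0_norm ?ler0c // ReM.
- by move=> t x y; exact: Dlin.
- by move=> t x y Dx Dy; rewrite flin // ReD ReM.
- move=> x /fp fx; apply: le_trans (ler_norm _) _.
  by rewrite -lecR -pE; apply: le_trans (normc_ge_Re _) fx.
have gD x y : g ((x : E) + y) = g x + g y.
  by have := glin 1 x y; rewrite scale1r mul1r.
have gZ (t : R) x : g (t%:C *: (x : E)) = t * g x.
  have g0 : g 0 = 0 by have := gD 0 0; rewrite addr0 => /eqP; rewrite -subr_eq subrr => /eqP.
  by have := glin t x 0; rewrite g0 !addr0.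
pose h (x : E) : R[i] := (g x)%:C - 'i * (g ('i *: x : E))%:C.
have ii : 'i * 'i = -1 :> R[i] by simpc.
have hD x y : h (x + y) = h x + h y.
  rewrite /h scalerDr !gD !rmorphD /= mulrDr opprD addrACA //.
have hR (t : R) x : h (t%:C *: x) = t%:C * h x.
  rewrite /h scalerA [_ * t%:C]mulrC -scalerA !gZ !rmorphM /= mulrBr; congr (_ - _).
  by rewrite mulrCA.
have hi x : h ('i *: x) = 'i * h x.
  rewrite /h scalerA ii -[-1]/(- 1%:C) -rmorphN gZ mulN1r rmorphN mulrN opprK.
  by rewrite mulrBr mulrA ii mulN1r opprK addrC.
have hZ (t : R[i]) x : h (t *: x) = t * h x.
  by rewrite [t]complexE scalerDl hD hR -scalerA hi hR mulrDl -mulrA.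
have hE x : D x -> h x = f x.
  move=> Dx; have fi : f ('i *: x) = 'i * f x.
    have f0 : f 0 = 0.
      by have := flin (-1) 0 0 D0 D0; rewrite scaler0 addr0 mulN1r addNr.
    by have := flin 'i x 0 Dx D0; rewrite f0 !addr0.
  have Di : D ('i *: x) by have := Dlin 'i _ _ Dx D0; rewrite addr0.
  rewrite /h !gf // fi [RHS]complexE; congr (_ + _); rewrite -mulrN -rmorphN; congr (_ * _%:C).
  by case: (f x) => a b /=; simpc.
exists h; split => // [t x y|x]; first by rewrite hD hZ.
have [->|hx0] := eqVneq (h x) 0; first by rewrite normr0.
pose u := (h x)^-1 * `|h x|.
have uh : h (u *: x) = `|h x| by rewrite hZ /u mulrAC mulVf // mul1r.
have nu : `|u| = 1 by rewrite normrM normfV normr_id mulVf // normr_eq0.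
have huR : h (u *: x) = (g (u *: x))%:C.
  have hC y : h y = Complex (g y) (- g ('i *: y : E)) by rewrite /h; simpc.
  move: uh; rewrite hC normc_def => -[_ ->] //.
rewrite -[p x]mul1r -nu -p_scale pE -uh huR lecR; exact: gp.
Qed.

End ComplexHahnBanach.

(** A single extension serves all bounds [c], in particular the smallest one: it
    preserves the norm. *)
Definition extends_functionals (K : numFieldType) (Phi : LBspace K) : Prop :=
  forall n (f : cdual (lb_step Phi n)), exists2 g : cdual (lb_type Phi),
    cdual_restrict n g = f &
    forall c : K, 0 <= c -> (forall x, `|f x| <= c * `|x|) ->
      forall z, `|g z| <= c * lb_norm z.

Section Extension.
Variables (R : realType) (Phi : LBspace R[i]).
Local Open Scope complex_scope.

Lemma cdual_best_bound (B : normedModType R[i]) (f : cdual B) :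
  exists c : R[i], [/\ 0 <= c, forall x, `|f x| <= c * `|x| &
    forall d, 0 <= d -> (forall x, `|f x| <= d * `|x|) -> c <= d].
Proof.
pose S := [set r : R | 0 <= r /\ forall x, `|f x| <= r%:C * `|x|].
have SE d : 0 <= d -> (forall x, `|f x| <= d * `|x|) -> exists2 r, S r & d = r%:C.
  move=> d0 fd; have dE : d = (complex.Re d)%:C by rewrite RRe_real // ger0_real.
  by exists (complex.Re d) => //; split; rewrite -?dE // -ler0c -dE.
have lS : lbound S 0 by move=> r [].
have [d d0 fd] := cdual_bounded f; have [r Sr _] := SE _ d0 fd.
have S0 : S !=set0 by exists r.
exists (inf S)%:C; split; first by rewrite ler0c; apply: lb_le_inf.
- move=> x; have [->|x0] := eqVneq x 0.
    by have [flin _] := cdual_lin_cont f; rewrite (lin0 flin) !normr0 mulr0.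
  have nx : 0 < `|x| by rewrite normr_gt0.
  rewrite -ler_pdivrMr //.
  have qR : `|f x| / `|x| = (complex.Re (`|f x| / `|x|))%:C.
    by rewrite RRe_real // ger0_real // divr_ge0.
  rewrite qR lecR; apply: lb_le_inf => // s [_ fs].
  by rewrite -lecR -qR ler_pdivrMr.
- move=> e e0 fe; have [s Ss ->] := SE _ e0 fe; rewrite lecR.
  by apply: ge_inf => //; exists 0.
Qed.

Lemma LB_extends_functionals : extends_functionals Phi.
Proof.
move=> n f; have [c [c0 fc cmin]] := cdual_best_bound f.
have inK (x : lb_step Phi n) y : lb_in x = lb_in y -> x = y.
  exact: (@lb_incl_inj _ Phi n).
have [flin _] := cdual_lin_cont f.
pose D : set (lb_type Phi) := range (@lb_in _ Phi n).
pose f' (z : lb_type Phi) : R[i] := xget 0 [set a | exists2 x, lb_in x = z & f x = a].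
have f'E x : f' (lb_in x) = f x.
  rewrite /f'; case: xgetP => [a _ [y /inK -> //]|/(_ (f x))[]].
  by exists x.
have lbP := @lb_inP _ Phi n.
have [|||||||g [glin gf gb]] :=
  @hahn_banach_complex R (lb_type Phi) (fun z => c * lb_norm z) _ _ _ f' D.
- by move=> z; rewrite mulr_ge0 ?lb_norm_ge0.
- by move=> z w; rewrite -mulrDr ler_wpM2l // lb_normD.
- by move=> a z; rewrite lb_normZ mulrCA.
- by exists 0; rewrite ?(lin0 lbP).
- by move=> t _ _ [x _ <-] [y _ <-]; exists (t *: x + y); rewrite ?lbP.
- by move=> t _ _ [x _ <-] [y _ <-]; rewrite -lbP !f'E flin.
- by move=> _ [x _ <-]; rewrite f'E lb_normE.
have [G GE] : exists G : cdual (lb_type Phi), forall z, G z = g z.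
  apply: lb_bounded_cdual => // m; exists c => // x.
  by rewrite -lb_normE.
exists G => [|d d0 fd z].
  by apply: cdual_ext => x /=; rewrite GE gf; [exact: f'E|exists x].
by rewrite GE; apply: le_trans (gb z) _; apply: ler_wpM2r; [exact: lb_norm_ge0|exact: cmin].
Qed.

Lemma complex_archimedean (e : R[i]) : 0 < e -> exists m, 1 <= m.+1%:R * e.
Proof.
move=> e0; have eE : e = (complex.Re e)%:C by rewrite RRe_real // gtr0_real.
move: e0; rewrite eE -[0]/(0%:C) ltcR => e0; exists (Num.truncn (complex.Re e)^-1).
rewrite -(rmorph_nat (real_complex R)) -rmorphM -[1]/(1%:C) lecR -ler_pdivrMr //.
by rewrite mul1r; exact/ltW/truncnS_gt.
Qed.
End Extension.

(** * Topologies of the tensor powers *)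

Lemma le_all_pos (K : numFieldType) (x c : K) : 0 <= c ->
  (forall e, 0 < e -> `|x| <= c * e) -> x = 0.
Proof.
move=> c0 h; apply/eqP; rewrite -normr_le0; apply/contraT => nx.
have x0 : 0 < `|x| by rewrite normr_gt0; apply: contraNneq nx => ->; rewrite normr0.
have c1 : 0 < c + 1 by rewrite ltr_wpDl.
have h1 := h (`|x| / (c + 1) / 2) ltac:(by rewrite !divr_gt0).
have : `|x| <= `|x| / 2.
  apply: le_trans h1 _; rewrite mulrA ler_pM2r ?invr_gt0 // mulrCA ler_piMr //.
  by rewrite ler_pdivrMr // mul1r lerDl.
by rewrite ler_pdivlMr // ger_pMr // lern1.
Qed.

Lemma min_pos (K : numFieldType) (d : nat -> K) n : (forall m, 0 < d m) ->
  exists2 e, 0 < e & forall m, (m < n)%N -> e <= d m.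
Proof.
move=> d0; elim: n => [|n [e e0 ed]]; first by exists 1.
(* A positive lower bound of [x] and [y]. *)
have rd x y : 0 < x -> 0 < y -> exists2 z : K, 0 < z & z <= x /\ z <= y.
  move=> x0 y0; have xy0 : 0 < x + y by rewrite addr_gt0.
  exists (x * y / (x + y)); first by rewrite divr_gt0 ?mulr_gt0.
  rewrite !ler_pdivrMr //; split; first by rewrite ler_pM2l // lerDr ltW.
  by rewrite mulrC ler_pM2l // lerDl ltW.
have [z z0 [ze zd]] := rd _ _ e0 (d0 n).
exists z => // m; rewrite ltnS leq_eqVlt => /predU1P[-> //|mn].
exact: le_trans ze (ed m mn).
Qed.

Section NormComplements.
Variables (K : numFieldType) (B : completeNormedModType K) (k : nat).
Implicit Types u : ('I_k -> cdual B) -> K^o.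

Lemma inj_tensor_powerZ a u : inj_tensor_power B k u -> inj_tensor_power B k (a *: u).
Proof.
move=> Tu; rewrite -[_ *: _]addr0.
by apply: inj_tensor_powerP => //; exact: inj_tensor_power0.
Qed.

Lemma inj_norm_leZ a u d : inj_norm_le u d -> inj_norm_le (a *: u) (`|a| * d).
Proof.
move=> ud; have := inj_norm_leP a ud (inj_norm_le0 (@lexx _ _ 0)).
by rewrite !addr0.
Qed.

Lemma inj_norm_le_weak d e u : d <= e -> inj_norm_le u d -> inj_norm_le u e.
Proof.
move=> de ud f c c0 fc; apply: le_trans (ud f c c0 fc) _.
by rewrite ler_wpM2l // prodr_ge0.
Qed.

Lemma tensor_span_power u : tensor_span u -> inj_tensor_power B k u.
Proof.
move=> su e e0; exists u => //.
by rewrite subrr; apply: inj_norm_le0; exact: ltW.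
Qed.
End NormComplements.

Section JoinFamilies.
Variables (D : Type) (k l : nat).

Definition join_fam (f : 'I_k -> D) (g : 'I_l -> D) : 'I_(k + l) -> D :=
  fun p => match fintype.split p with inl q => f q | inr q => g q end.

Lemma join_faml f g q : join_fam f g (lshift l q) = f q.
Proof. by rewrite /join_fam (unsplitK (inl q)). Qed.

Lemma join_famr f g q : join_fam f g (rshift k q) = g q.
Proof. by rewrite /join_fam (unsplitK (inr q)). Qed.

Lemma prod_join (K : comPzRingType) (F : D -> 'I_(k + l) -> K) f g :
  \prod_p F (join_fam f g p) p =
  (\prod_q F (f q) (lshift l q)) * (\prod_q F (g q) (rshift k q)).
Proof.
rewrite big_split_ord; congr (_ * _); apply: eq_bigr => q _.
  by rewrite join_faml.
by rewrite join_famr.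
Qed.
End JoinFamilies.

Section TensorTopology.
Variables (K : numFieldType) (Phi : LBspace K).
Local Notation step := (@lb_step K Phi).
Local Notation Phi' := (cdual (lb_type Phi)).

(** The two systems entering the inductive topologies of the tensor powers, named
    in order to instantiate [lin_cont_inductive]. *)
Definition tensor_nbhs k (n : nat) (V : set (tensor Phi k)) : Prop :=
  exists2 e : K, 0 < e & forall (w : tensor Phi k) u,
      inj_tensor_power (step n) k u -> inj_norm_le u e ->
      tensor_val w = form_push u -> V w.

Definition sym_tensor_nbhs k (n : nat) (V : set (sym_tensor Phi k)) : Prop :=
  exists2 e : K, 0 < e & forall (w : sym_tensor Phi k) u,
      sym_tensor_power (step n) k u -> inj_norm_le u e ->
      sym_tensor_val w = form_push u -> V w.

Lemma tensor_nbhsE k (x : tensor Phi k) :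
  nbhs x = translated_nbhs (inductive_nbhs0 (@tensor_nbhs k)) x.
Proof. by []. Qed.

Lemma sym_tensor_nbhsE k (x : sym_tensor Phi k) :
  nbhs x = translated_nbhs (inductive_nbhs0 (@sym_tensor_nbhs k)) x.
Proof. by []. Qed.

Lemma tensor_nbhs_up k n (V W : set (tensor Phi k)) : V `<=` W ->
  tensor_nbhs n V -> tensor_nbhs n W.
Proof. by move=> VW [e e0 eV]; exists e => // w u Tu ue wu; apply/VW/(eV w u). Qed.

Lemma sym_tensor_nbhs_up k n (V W : set (sym_tensor Phi k)) : V `<=` W ->
  sym_tensor_nbhs n V -> sym_tensor_nbhs n W.
Proof. by move=> VW [e e0 eV]; exists e => // w u Tu ue wu; apply/VW/(eV w u). Qed.

Lemma sym_tensor_nbhsI k n (V W : set (sym_tensor Phi k)) :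
  sym_tensor_nbhs n V -> sym_tensor_nbhs n W -> sym_tensor_nbhs n (V `&` W).
Proof.
move=> [d d0 dV] [e e0 eW].
have [m m0 md] := min_pos (d := fun q => if q is 0 then d else e) 2%N
  (fun q => match q with 0 => d0 | _.+1 => e0 end).
have [md0 md1] := (md 0%N isT, md 1%N isT).
exists m => // w v Tv vm wv; split.
  by apply: (dV _ v) => //; exact: inj_norm_le_weak vm.
by apply: (eW _ v) => //; exact: inj_norm_le_weak vm.
Qed.

Lemma tensor_ext k (u v : tensor Phi k) : (forall f, u f = v f) -> u = v.
Proof. by move=> uv; apply: val_inj; apply/funext. Qed.

Lemma sym_tensor_ext k (u v : sym_tensor Phi k) : (forall f, u f = v f) -> u = v.
Proof. by move=> uv; apply: val_inj; apply/funext. Qed.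

Lemma tensor_valZ k a (u : tensor Phi k) : tensor_val (a *: u) = a *: tensor_val u.
Proof. by []. Qed.

Lemma tensorP k (w : tensor Phi k) :
  exists n u, inj_tensor_power (step n) k u /\ tensor_val w = form_push u.
Proof. by case: w => w /= /set_mem [n _ [u Tu <-]]; exists n, u. Qed.

Lemma sym_tensorP k (w : sym_tensor Phi k) :
  exists n u, sym_tensor_power (step n) k u /\ sym_tensor_val w = form_push u.
Proof. by case: w => w /= /set_mem [n _ [u Tu <-]]; exists n, u. Qed.

Lemma push_tensor k n u : inj_tensor_power (step n) k u ->
  exists w : tensor Phi k, tensor_val w = form_push u.
Proof.
move=> Tu; have wP : form_push u \in @tensor_pred K Phi k.
  by apply/mem_set; exists n => //; exists u.
by exists (Tensor wP).
Qed.

Lemma sym_tensor_inj_power k n u : sym_tensor_power (step n) k u ->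
  inj_tensor_power (step n) k u.
Proof. by case=> v Tv <-; exact: sym_inj_tensor_power. Qed.

Lemma lin_cont_comp (E F G : NbhsLmodule.type K) (S : F -> G) (T : E -> F) :
  lin_cont S -> lin_cont T -> lin_cont (S \o T).
Proof.
move=> [Sl Sc] [Tl Tc]; split => [a x y|x]; first by rewrite /= Tl Sl.
by move=> U /Sc; rewrite nbhs_simpl /= => /Tc.
Qed.

Lemma sym_incl_lin_cont k : @lin_cont K (sym_tensor Phi k) (tensor Phi k) (@sym_incl K Phi k).
Proof.
apply/(lin_cont_inductive (@sym_tensor_nbhsE k) (@tensor_nbhsE k) (@sym_tensor_nbhs_up k)).
split => [a x y|V cV NV n]; first exact: tensor_ext.
have [e e0 eV] := NV n; exists e => // w u Tu ue wu.
by apply: (eV _ u) => //; exact: sym_tensor_inj_power.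
Qed.

Lemma symmetrize_lin_cont k : @lin_cont K (tensor Phi k) (sym_tensor Phi k) (@symmetrize K Phi k).
Proof.
apply/(lin_cont_inductive (@tensor_nbhsE k) (@sym_tensor_nbhsE k) (@tensor_nbhs_up k)).
split => [a x y|V cV NV n].
  apply: sym_tensor_ext => f /=.
  by have /(congr1 (fun u => u f)) := sym_formP a (tensor_val x) (tensor_val y).
have [e e0 eV] := NV n; exists e => // w u Tu ue wu.
apply: (eV _ (sym_form u)); [by exists u|exact: sym_norm_le|].
by rewrite /= wu.
Qed.
End TensorTopology.

(** * Images of the steps under continuous operators *)

Lemma cdual_restrictE (K : numFieldType) (Phi : LBspace K) n
  (g : cdual (lb_type Phi)) (x : lb_step Phi n) : cdual_restrict n g x = g (lb_in x).
Proof. by []. Qed.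

Lemma restrict_le (K : numFieldType) (Phi : LBspace K) n m
  (g h : cdual (lb_type Phi)) : (n <= m)%N ->
  cdual_restrict m g = cdual_restrict m h -> cdual_restrict n g = cdual_restrict n h.
Proof.
move=> nm gh; apply: cdual_ext => x; rewrite !cdual_restrictE.
have [y <- _] := lb_widen (m - n) x; move: y; rewrite subnKC // => y.
by rewrite -!cdual_restrictE gh.
Qed.

Section Factorization.
Variables (K : numFieldType) (Phi : LBspace K).
Hypothesis extP : extends_functionals Phi.
Hypothesis archK : forall e : K, 0 < e -> exists m, 1 <= m.+1%:R * e.
Local Notation step := (@lb_step K Phi).
Local Notation Phi' := (cdual (lb_type Phi)).

Definition cdual_extend n (f : cdual (step n)) : Phi' := s2val (cid2 (extP f)).

Lemma cdual_extendK n (f : cdual (step n)) : cdual_restrict n (cdual_extend f) = f.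
Proof. exact: (s2valP (cid2 (extP f))). Qed.

Lemma cdual_extend_le n (f : cdual (step n)) (c : K) : 0 <= c ->
  (forall x, `|f x| <= c * `|x|) -> forall z, `|cdual_extend f z| <= c * lb_norm z.
Proof. exact: (s2valP' (cid2 (extP f))). Qed.

(** The injective norm of the union of the steps, tested on the functionals that
    are bounded for [lb_norm]. Extension of functionals makes it restrict to the
    injective norm of every step. *)
Definition lb_form_le k (y : ('I_k -> Phi') -> K^o) (e : K) : Prop :=
  forall (f : 'I_k -> Phi') (c : 'I_k -> K), (forall j, 0 <= c j) ->
    (forall j z, `|f j z| <= c j * lb_norm z) -> `|y f| <= (\prod_j c j) * e.

Lemma lb_form_le_push k n (u : ('I_k -> cdual (step n)) -> K^o) e :
  inj_norm_le u e -> lb_form_le (form_push u) e.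
Proof.
move=> ue f c c0 fc; apply: ue => // j x.
by rewrite cdual_restrictE -lb_normE.
Qed.

Lemma lb_form_leZ k a (y : ('I_k -> Phi') -> K^o) d :
  lb_form_le y d -> lb_form_le (a *: y) (`|a| * d).
Proof.
move=> yd f c c0 hf; rewrite !fctE normrM mulrCA.
by rewrite ler_wpM2l // yd.
Qed.

Lemma lb_form_le_convex k a b (y z : ('I_k -> Phi') -> K^o) e : 0 <= e ->
  lb_form_le y e -> lb_form_le z e -> `|a| + `|b| <= 1 ->
  lb_form_le (a *: y + b *: z) e.
Proof.
move=> e0 hy hz ab f c c0 hf; rewrite !fctE /=.
apply: normB_le1 ab; [|exact: hy|exact: hz].
by rewrite mulr_ge0 // prodr_ge0.
Qed.

Lemma lb_form_le_weak k (y : ('I_k -> Phi') -> K^o) d e : d <= e ->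
  lb_form_le y d -> lb_form_le y e.
Proof.
move=> de hy f c c0 hf; apply: le_trans (hy f c c0 hf) _.
by rewrite ler_wpM2l // prodr_ge0.
Qed.

Definition form_pull k n (y : ('I_k -> Phi') -> K^o) : ('I_k -> cdual (step n)) -> K^o :=
  fun f => y (fun j => cdual_extend (f j)).

Lemma form_pull_le k n (y : ('I_k -> Phi') -> K^o) e : lb_form_le y e ->
  inj_norm_le (form_pull (n := n) y) e.
Proof. by move=> ye f c c0 hf; apply: ye => // j; exact: cdual_extend_le. Qed.

Lemma form_pull_push k n (u : ('I_k -> cdual (step n)) -> K^o) :
  form_pull (form_push u) = u.
Proof.
by apply/funext => f; congr u; apply/funext => j; exact: cdual_extendK.
Qed.

(** Forms are evaluated at all continuous functionals, also at unbounded ones.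
    Under this condition a functional may be replaced by a bounded one with the
    same restriction to the step. *)
Definition depends_on_step k m (y : ('I_k -> Phi') -> K^o) : Prop :=
  forall f g, (forall j, cdual_restrict m (f j) = cdual_restrict m (g j)) -> y f = y g.

Lemma depends_push k n m (u : ('I_k -> cdual (step n)) -> K^o) : (n <= m)%N ->
  depends_on_step m (form_push u).
Proof.
move=> nm f g fg; congr u; apply/funext => j; exact: (restrict_le nm (fg j)).
Qed.

(** The completed tensor power of a step is closed in the union for the norm
    [lb_form_le]: evaluation at extended functionals transports [y] and its
    approximants back to the step, and [y] is recovered because a pushed form
    does not distinguish a functional from the extension of its restriction. *)
Lemma tensor_power_closed k n m (y : ('I_k -> Phi') -> K^o) :
  depends_on_step m y ->
  (forall e, 0 < e -> exists2 v, inj_tensor_power (step n) k v &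
     lb_form_le (y - form_push v) e) ->
  inj_tensor_power (step n) k (form_pull y) /\ form_push (form_pull (n := n) y) = y.
Proof.
move=> ym happ; split.
  move=> e e0; have e20 : 0 < e / 2 by rewrite divr_gt0.
  have [v Tv yv] := happ _ e20; have [s sp vs] := Tv _ e20.
  exists s => //; have -> : form_pull y - s = 1 *: (form_pull y - v) + (v - s).
    by rewrite scale1r addrA subrK.
  have pv : inj_norm_le (form_pull y - v) (e / 2).
    have -> : form_pull y - v = form_pull (n := n) (y - form_push v).
      by rewrite -{1}[v]form_pull_push.
    exact: form_pull_le.
  by have := inj_norm_leP 1 pv vs; rewrite normr1 mul1r -splitr.
(* Any family of functionals agrees, on a step large enough for [y] and for the
   approximants, with a family of bounded ones. *)
pose M := maxn n m.
have red g : exists (g' : 'I_k -> Phi') (c : 'I_k -> K), [/\ forall j, 0 <= c j,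
    forall j z, `|g' j z| <= c j * lb_norm z &
    forall j, cdual_restrict M (g' j) = cdual_restrict M (g j)].
  have [c c0 gc] := cdual_bounds (fun j => cdual_restrict M (g j)).
  exists (fun j => cdual_extend (cdual_restrict M (g j))), c; split => // j.
    by move=> z; exact: cdual_extend_le.
  exact: cdual_extendK.
have near g : exists2 c, 0 <= c & forall e v, lb_form_le (y - form_push v) e ->
    `|y g - form_push (n := n) v g| <= c * e.
  have [g' [c [c0 gc gg]]] := red g.
  exists (\prod_j c j) => [|e v yv]; first exact: prodr_ge0.
  have -> : y g = y g'.
    by apply: ym => j; apply: restrict_le (esym (gg j)); rewrite leq_maxr.
  have -> : form_push v g = form_push v g'.
    apply: (@depends_push _ n M) => [|j]; first by rewrite leq_maxl.
    by rewrite gg.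
  exact: yv.
apply/funext => g; pose h j := cdual_extend (cdual_restrict n (g j)).
have [c c0 gc] := near g; have [d d0 hd] := near h.
apply/eqP; rewrite eq_sym -subr_eq0; apply/eqP/(@le_all_pos _ _ (c + d)).
  by rewrite addr_ge0.
move=> e /happ[v Tv yv].
have -> : y g - form_push (form_pull (n := n) y) g =
    (y g - form_push v g) - (y h - form_push v h).
  have -> : form_push v h = form_push v g.
    by apply: (@depends_push _ n n) => // j; exact: cdual_extendK.
  by rewrite opprB addrA subrK.
by apply: (le_trans (ler_normB _ _)); rewrite mulrDl lerD ?gc ?hd.
Qed.

Variables (i j : nat) (a : tensor Phi i -> tensor Phi j).
Hypothesis a_lc : lin_cont a.

Let alin : linear a := a_lc.1.

Let a_nbhs V : abs_convex V -> (forall n, tensor_nbhs n V) ->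
  forall n, tensor_nbhs n (a @^-1` V).
Proof.
have [_] := (lin_cont_inductive (@tensor_nbhsE _ _ i) (@tensor_nbhsE _ _ j)
  (@tensor_nbhs_up _ _ i) a).1 a_lc.
exact.
Qed.

Definition step_tensor n k : set (tensor Phi k) :=
  [set w | exists2 u, inj_tensor_power (step n) k u & tensor_val w = form_push u].
Arguments step_tensor : clear implicits.

Lemma step_tensor_le n m k : (n <= m)%N -> step_tensor n k `<=` step_tensor m k.
Proof.
move=> nm w [u Tu wu].
have := push_widen (X := fun n => inj_tensor_power (step n) k)
  (@inj_tensor_power_step K Phi k) (m - n) Tu.
by rewrite subnKC // => -[v Tv uv]; exists v; rewrite // wu.
Qed.

Lemma step_tensorZ n k c (w : tensor Phi k) :
  step_tensor n k w -> step_tensor n k (c *: w).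
Proof.
move=> [u Tu wu]; exists (c *: u); first exact: inj_tensor_powerZ.
by rewrite tensor_valZ wu.
Qed.

Lemma step_tensor_closed m k (w : tensor Phi k) : ~ step_tensor m k w ->
  exists2 d : K, 0 < d & forall v, inj_tensor_power (step m) k v ->
    ~ lb_form_le (tensor_val w - form_push v) d.
Proof.
move=> nw; apply: contrapT => nd; apply: nw.
have [n [u [Tu wu]]] := tensorP w.
have [|e e0|Ty yE] := @tensor_power_closed k m n (tensor_val w).
- by rewrite wu; exact: depends_push.
- apply: contrapT => nv; apply: nd; exists e => // v Tv ve; apply: nv; by exists v.
- by exists (form_pull (n := m) (tensor_val w)).
Qed.

Lemma lb_form_nbhs k (e : K) : 0 < e -> forall n,
  tensor_nbhs n [set w : tensor Phi k | lb_form_le (tensor_val w) e].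
Proof.
move=> e0 n; exists e => // w u _ ue wu /=.
by rewrite wu; exact: lb_form_le_push.
Qed.

(** If the images of step [n] did not stay in any step, there would be tensors
    [w' m] of norm at most 1 in step [n] with [a (w' m)] at distance more than
    [d m > 0] from step [m]. The set [V] of the tensors at distance at most
    [d m / m.+1] from step [m] for every [m] is a neighbourhood of 0, since only
    the finitely many [m < p] matter on step [p]. Continuity then gives [e > 0]
    with [a (e *: w' m)] in [V] for all [m], which fails as soon as
    [m.+1 * e >= 1]. *)
Lemma step_tensor_image n : exists2 m, (n <= m)%N &
  a @` step_tensor n i `<=` step_tensor m j.
Proof.
have [m am] : exists m, a @` step_tensor n i `<=` step_tensor m j; last first.
  exists (maxn n m); first exact: leq_maxl.
  by apply: subset_trans am _; apply: step_tensor_le; exact: leq_maxr.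
apply: contrapT => na.
have /choice [w hw] : forall m, exists w, step_tensor n i w /\ ~ step_tensor m j (a w).
  move=> m; apply: contrapT => nw; apply: na; exists m => _ [w nw' <-].
  by apply: contrapT => naw; apply: nw; exists w.
have /choice [u hu] : forall m, exists u, [/\ inj_tensor_power (step n) i u,
    inj_norm_le u 1 & exists w', tensor_val w' = form_push u /\ ~ step_tensor m j (a w')].
  move=> m; have [[u Tu wu] naw] := hw m.
  have [M M0 uM] := inj_tensor_power_bounded Tu.
  have M1 : 0 < M + 1 by rewrite ltr_wpDl.
  (* [M + 1] instead of [M], which may be 0. *)
  exists ((M + 1)^-1 *: u); split.
  - exact: inj_tensor_powerZ.
  - have := inj_norm_leZ (M + 1)^-1 uM.
    apply: inj_norm_le_weak; rewrite gtr0_norm ?invr_gt0 // mulrC ler_pdivrMr //.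
    by rewrite mul1r lerDl.
  - exists ((M + 1)^-1 *: w m); split; first by rewrite tensor_valZ wu.
    rewrite (linZ alin) => /(step_tensorZ (M + 1)).
    by rewrite scalerA mulfV ?scale1r // gt_eqF.
have /choice [w' hw'] : forall m, exists w', tensor_val w' = form_push (u m) /\
    ~ step_tensor m j (a w') by move=> m; have [] := hu m.
have /choice [d hd] : forall m, exists d : K, 0 < d /\
    forall v, inj_tensor_power (step m) j v ->
    ~ lb_form_le (tensor_val (a (w' m)) - form_push v) d.
  by move=> m; have [d d0 dd] := step_tensor_closed (hw' m).2; exists d.
pose V := [set y : tensor Phi j | forall m, exists2 v, inj_tensor_power (step m) j v &
  lb_form_le (tensor_val y - form_push v) (d m / m.+1%:R)].
have dm m : 0 < d m / m.+1%:R by rewrite divr_gt0 ?ltr0n //; case: (hd m).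
have cV : abs_convex V.
  move=> b c x y Vx Vy bc m; have [v Tv xv] := Vx m; have [z Tz yz] := Vy m.
  exists (b *: v + c *: z).
    by apply: inj_tensor_powerP => //; exact: inj_tensor_powerZ.
  have -> : tensor_val (b *: x + c *: y) - form_push (b *: v + c *: z) =
      b *: (tensor_val x - form_push v) + c *: (tensor_val y - form_push z).
    by rewrite !scalerBr addrACA -opprD.
  by apply: lb_form_le_convex => //; exact: ltW.
have NV p : tensor_nbhs p V.
  have [e e0 ed] := min_pos p dm; exists e => // y v Tv ve yv m.
  have [mp|pm] := ltnP m p.
    exists 0; first exact: inj_tensor_power0.
    apply: lb_form_le_weak (ed m mp) _; rewrite yv.
    have -> : form_push (0 : ('I_j -> cdual (step m)) -> K^o) = 0 by [].
    rewrite subr0.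
    exact: lb_form_le_push.
  have [z Tz yz] : step_tensor m j y by apply: step_tensor_le pm _ _; exists v.
  exists z => //; rewrite yz subrr => f c c0 _.
  by rewrite normr0 mulr_ge0 ?prodr_ge0 // ltW.
have [e e0 eV] := a_nbhs cV NV n.
have [m me] := archK e0.
have [Tu u1 _] := hu m; have [wu _] := hw' m; have [d0 dP] := hd m.
have : V (a (e *: w' m)).
  apply: (eV _ (e *: u m)); first exact: inj_tensor_powerZ.
    by have := inj_norm_leZ e u1; rewrite mulr1 gtr0_norm.
  by rewrite tensor_valZ wu.
move=> /(_ m)[v Tv]; rewrite (linZ alin) tensor_valZ => av.
apply: (dP (e^-1 *: v)); first exact: inj_tensor_powerZ.
have -> : tensor_val (a (w' m)) - form_push (e^-1 *: v) =
    e^-1 *: (e *: tensor_val (a (w' m)) - form_push v).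
  by rewrite scalerBr scalerA mulVf ?scale1r // gt_eqF.
apply: lb_form_le_weak (lb_form_leZ _ av).
rewrite gtr0_norm ?invr_gt0 // mulrC ler_pdivrMr // ler_pdivrMr ?ltr0n //.
by rewrite -mulrA [e * _]mulrC ler_peMr ?(ltW d0).
Qed.

(** The value [e = 0] is included because the products of bounds to which this is
    applied may vanish. *)
Lemma step_tensor_bound n : exists2 M : K, 0 < M &
  forall (w : tensor Phi i) u e, inj_tensor_power (step n) i u ->
    tensor_val w = form_push u -> 0 <= e -> inj_norm_le u e ->
    lb_form_le (tensor_val (a w)) (M * e).
Proof.
have [||d d0 dV] := a_nbhs (V := [set w | lb_form_le (tensor_val w) 1]) _ _ n.
- by move=> b c x y Vx Vy bc; apply: lb_form_le_convex.
- exact: lb_form_nbhs.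
exists d^-1 => [|w u e Tu wu]; first by rewrite invr_gt0.
have bnd r : 0 < r -> inj_norm_le u r -> lb_form_le (tensor_val (a w)) (d^-1 * r).
  move=> r0 ur; have dr : 0 < d / r by rewrite divr_gt0.
  have : lb_form_le (tensor_val (a ((d / r) *: w))) 1.
    apply: (dV _ ((d / r) *: u)); first exact: inj_tensor_powerZ.
      by have := inj_norm_leZ (d / r) ur; rewrite gtr0_norm // divfK // gt_eqF.
    by rewrite tensor_valZ wu.
  move=> /(lb_form_leZ (d / r)^-1); rewrite (linZ alin) tensor_valZ scalerA.
  by rewrite mulVf ?gt_eqF // scale1r mulr1 gtr0_norm ?invr_gt0 // invf_div mulrC.
rewrite le_eqVlt => /predU1P[<- u0|]; last exact: bnd.
move=> f c c0 fc; rewrite !mulr0.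
have := @le_all_pos _ (tensor_val (a w) f) (\prod_l c l * d^-1).
rewrite mulr_ge0 ?invr_ge0 ?(ltW d0) ?prodr_ge0 // => -> //; first by rewrite normr0.
move=> r r0; rewrite -mulrA; apply: bnd => //.
by apply: inj_norm_le_weak u0; exact: ltW.
Qed.

End Factorization.
Arguments step_tensor {K} Phi n k.

(** * Tensor products of operators *)

Section Slices.
Variables (K : numFieldType) (B : completeNormedModType K) (k l : nat).
Implicit Types (u : ('I_(k + l) -> cdual B) -> K^o) (f : 'I_k -> cdual B).

(** Fixing the first arguments of a form. The injective norm of a slice is at most
    that of the form times the norms of the fixed functionals, which is what makes
    injective tensor products of operators bounded. *)
Definition slice (D : Type) (u : ('I_(k + l) -> D) -> K^o) (f : 'I_k -> D) :
  ('I_l -> D) -> K^o := fun g => u (join_fam f g).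

Lemma slice_span u f : tensor_span u -> tensor_span (slice u f).
Proof.
move=> [m [a [x ->]]].
have -> : slice (\sum_(p < m) a p *: elem_tensor (x p)) f =
    \sum_(p < m) (a p * \prod_q f q (x p (lshift l q))) *:
      elem_tensor (fun q => x p (rshift k q)).
  apply/funext => g; rewrite /slice !fct_sumE; apply: eq_bigr => p _.
  have E := prod_join (fun (h : cdual B) r => h (x p r) : K) f g.
  by apply: etrans (congr1 ( *%R (a p)) E) _; rewrite mulrA.
by apply: tensor_span_sum => p; exact/tensor_spanZ/tensor_span_elem.
Qed.

Lemma slice_norm u f (c : 'I_k -> K) e :
  (forall q, 0 <= c q) -> (forall q x, `|f q x| <= c q * `|x|) ->
  inj_norm_le u e -> inj_norm_le (slice u f) ((\prod_q c q) * e).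
Proof.
move=> c0 fc ue g d d0 gd; rewrite /slice mulrCA mulrA.
have -> : (\prod_q c q) * \prod_q d q = \prod_p join_fam c d p.
  by rewrite (prod_join (fun r _ => r)).
apply: ue => p; rewrite /join_fam; case: fintype.split => q //.
Qed.

Lemma slice_power u f : inj_tensor_power B (k + l) u ->
  inj_tensor_power B l (slice u f).
Proof.
move=> Tu e e0.
have [c c0 fc] := cdual_bounds f.
have P1 : 0 < \prod_q c q + 1 by rewrite ltr_wpDl // prodr_ge0.
have [v sv uv] := Tu (e / (\prod_q c q + 1)) ltac:(by rewrite divr_gt0).
exists (slice v f); first exact: slice_span.
have := slice_norm c0 fc uv; apply: inj_norm_le_weak.
by rewrite mulrCA ler_piMr ?(ltW e0) // ler_pdivrMr // mul1r lerDl.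
Qed.
End Slices.

Section TensorOperators.
Variables (K : numFieldType) (Phi : LBspace K).
Hypothesis extP : extends_functionals Phi.
Hypothesis archK : forall e : K, 0 < e -> exists m, 1 <= m.+1%:R * e.
Local Notation step := (@lb_step K Phi).
Local Notation Phi' := (cdual (lb_type Phi)).

Lemma slice_push k l n (u : ('I_(k + l) -> cdual (step n)) -> K^o) (f : 'I_k -> Phi') :
  slice (form_push u) f = form_push (slice u (fun q => cdual_restrict n (f q))).
Proof.
apply/funext => g; congr u; apply/funext => p.
by rewrite /join_fam; case: fintype.split.
Qed.

Fact tensor_slice_subproof k l (w : tensor Phi (k + l)) (f : 'I_k -> Phi') :
  slice w f \in @tensor_pred K Phi l.
Proof.
have [n [u [Tu ->]]] := tensorP w; rewrite slice_push; apply/mem_set; exists n => //.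
by exists (slice u (fun q => cdual_restrict n (f q))) => //; exact: slice_power.
Qed.

Definition tensor_slice k l (w : tensor Phi (k + l)) f : tensor Phi l :=
  Tensor (tensor_slice_subproof w f).

Section IdTensor.
Variables (k i j : nat) (a : tensor Phi i -> tensor Phi j).
Hypothesis a_lc : lin_cont a.

Let alin : linear a := a_lc.1.

(** The form of the image of [w] under the tensor product of the identity and [a]:
    [a] is applied to the slices of [w]. *)
Definition id_tensor_form (w : tensor Phi (k + i)) : ('I_(k + j) -> Phi') -> K^o :=
  fun F => a (tensor_slice w (fun q => F (lshift j q))) (fun q => F (rshift k q)).

Lemma id_tensor_formP b w w' :
  id_tensor_form (b *: w + w') = b *: id_tensor_form w + id_tensor_form w'.
Proof.
apply/funext => F; rewrite /id_tensor_form.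
have -> f : tensor_slice (b *: w + w') f = b *: tensor_slice w f + tensor_slice w' f.
  exact: tensor_ext.
by rewrite alin.
Qed.

Lemma id_tensor_form_bound n : exists2 M : K, 0 < M & forall w u e,
  inj_tensor_power (step n) (k + i) u -> tensor_val w = form_push u -> 0 <= e ->
  inj_norm_le u e -> lb_form_le (id_tensor_form w) (M * e).
Proof.
have [M M0 aM] := step_tensor_bound a_lc n.
exists M => // w u e Tu wu e0 ue F c c0 Fc.
pose f q := cdual_restrict n (F (lshift j q)).
have h : lb_form_le (tensor_val (a (tensor_slice w (fun q => F (lshift j q)))))
    (M * ((\prod_q c (lshift j q)) * e)).
  apply: (aM _ (slice u f)).
  - exact: slice_power.
  - by rewrite /= wu slice_push.
  - by rewrite mulr_ge0 // prodr_ge0.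
  - apply: slice_norm => // q x; rewrite /f cdual_restrictE -lb_normE; exact: Fc.
have := h (fun q => F (rshift k q)) (fun q => c (rshift k q)) (fun q => c0 _) (fun q => Fc _).
move=> /le_trans; apply; rewrite big_split_ord /=.
by rewrite le_eqVlt; apply/orP; left; apply/eqP; ring.
Qed.

(** On an elementary tensor all slices are multiples of one tensor, so only one
    value of [a] is involved. *)
Lemma id_tensor_form_elem n m : a @` step_tensor Phi n i `<=` step_tensor Phi m j ->
  (n <= m)%N -> forall w x, tensor_val w = form_push (@elem_tensor K (step n) (k + i) x) ->
  exists2 v, inj_tensor_power (step m) (k + j) v & id_tensor_form w = form_push v.
Proof.
move=> am nm w x wx.
pose x1 q := x (lshift i q); pose x2 q := x (rshift k q).
have T2 : inj_tensor_power (step n) i (elem_tensor x2).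
  exact/tensor_span_power/tensor_span_elem.
have [w2 w2E] := push_tensor T2.
have [v2 Tv2 v2E] : step_tensor Phi m j (a w2).
  by apply: am; exists w2 => //; exists (elem_tensor x2).
have /choice [y1 y1E] : forall q, exists y : step m, lb_in y = lb_in (x1 q).
  move=> q; have [y yE _] := lb_widen (m - n) (x1 q).
  by move: y yE; rewrite subnKC // => y yE; exists y.
exists (tensor_form (elem_tensor y1) v2).
  by apply: inj_tensor_power_form => //; exact/tensor_span_power/tensor_span_elem.
apply/funext => F; rewrite /id_tensor_form /form_push /tensor_form.
set f := fun q => F (lshift j q).
have -> : tensor_slice w f = (\prod_q f q (lb_in (x1 q))) *: w2.
  apply: tensor_ext => g; rewrite /= w2E wx.
  exact: (prod_join (fun (h : Phi') r => h (lb_in (x r)))).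
rewrite (linZ alin) tensor_valZ v2E; congr (_ * _).
by apply: eq_bigr => q _; rewrite cdual_restrictE y1E.
Qed.

(** Approximation by elementary tensors, combined with the closedness of the tensor
    powers of a step. *)
Lemma id_tensor_form_step n : exists2 m, (n <= m)%N & forall w,
  step_tensor Phi n (k + i) w ->
  inj_tensor_power (step m) (k + j) (form_pull extP (id_tensor_form w)) /\
  form_push (form_pull (n := m) extP (id_tensor_form w)) = id_tensor_form w.
Proof.
have [m nm am] := step_tensor_image extP archK a_lc n.
have [M M0 bM] := id_tensor_form_bound n.
exists m => // w [u Tu wu]; apply: (@tensor_power_closed _ _ _ _ _ m).
  move=> F G FG; rewrite /id_tensor_form.
  have -> : tensor_slice w (fun q => F (lshift j q)) =
      tensor_slice w (fun q => G (lshift j q)).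
    apply: tensor_ext => g; rewrite /= wu !slice_push; congr (slice u _ _).
    by apply/funext => q; apply: restrict_le (FG _).
  set s := tensor_slice _ _.
  have [v _ ->] : step_tensor Phi m j (a s).
    apply: am; exists s => //; exists (slice u (fun q => cdual_restrict n (G (lshift j q)))).
      exact: slice_power.
    by rewrite /= wu slice_push.
  by apply: (@depends_push _ _ _ m m) => // q.
move=> e e0.
have [s [r [b [x sE]]] us] := Tu (e / M) ltac:(by rewrite divr_gt0).
have /choice [wx wxE] : forall p, exists w', tensor_val w' = form_push (elem_tensor (x p)).
  by move=> p; exact/push_tensor/tensor_span_power/tensor_span_elem.
have /choice [vx vxE] : forall p, exists v, inj_tensor_power (step m) (k + j) v /\
    id_tensor_form (wx p) = form_push v.
  by move=> p; have [v Tv vE] := id_tensor_form_elem am nm (wxE p); exists v.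
exists (\sum_(p < r) b p *: vx p).
  elim/big_ind: _ => [|v v' Tv Tv'|p _]; first exact: inj_tensor_power0.
    by rewrite -[v]scale1r; exact: inj_tensor_powerP.
  by apply: inj_tensor_powerZ; have [] := vxE p.
have idlin : linear id_tensor_form by move=> ? ? ?; exact: id_tensor_formP.
have -> : id_tensor_form w - form_push (\sum_(p < r) b p *: vx p) =
    id_tensor_form (w - \sum_(p < r) b p *: wx p).
  rewrite (linB idlin) (lin_sum idlin); congr (_ - _).
  have pushlin : linear (fun v : ('I_(k + j) -> cdual (step m)) -> K^o => form_push v) by [].
  rewrite (lin_sum pushlin); apply: eq_bigr => p _.
  by rewrite (linZ idlin) (vxE p).2.
have -> : e = M * (e / M) by rewrite mulrCA divff ?mulr1 // gt_eqF.
apply: bM us; rewrite ?divr_ge0 ?ltW //.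
- rewrite addrC -scaleN1r; apply: inj_tensor_powerP => //.
  by apply: tensor_span_power; exists r, b, x.
- have vallin : linear (@tensor_val K Phi (k + i)) by [].
  rewrite (linB vallin) (lin_sum vallin) wu sE.
  have pushlin : linear (fun v : ('I_(k + i) -> cdual (step n)) -> K^o => form_push v) by [].
  rewrite (linB pushlin) (lin_sum pushlin); congr (_ - _).
  by apply: eq_bigr => p _; rewrite tensor_valZ wxE.
Qed.

Lemma id_tensor_exists : exists T : tensor Phi (k + i) -> tensor Phi (k + j),
  lin_cont T /\ forall u v, T (tensor_mul u v) = tensor_mul u (a v).
Proof.
have /choice [T TE] : forall w, exists w', tensor_val w' = id_tensor_form w.
  move=> w; have [n [u [Tu wu]]] := tensorP w.
  have [m _ hm] := id_tensor_form_step n.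
  have [Tw <-] : inj_tensor_power (step m) (k + j) (form_pull extP (id_tensor_form w)) /\
    form_push (form_pull (n := m) extP (id_tensor_form w)) = id_tensor_form w.
    by apply: hm; exists u.
  exact: push_tensor.
exists T; split; last first.
  move=> u v; apply: tensor_ext => F; rewrite TE /id_tensor_form.
  have -> : tensor_slice (tensor_mul u v) (fun q => F (lshift j q)) =
      u (fun q => F (lshift j q)) *: v.
    apply: tensor_ext => g; rewrite tensor_valZ /= /slice /tensor_form.
    congr (u _ * v _); apply/funext => q; first by rewrite join_faml.
    by rewrite join_famr.
  by rewrite (linZ alin).
apply/(lin_cont_inductive (@tensor_nbhsE _ _ _) (@tensor_nbhsE _ _ _) (@tensor_nbhs_up _ _ _)).
split => [b w w'|V cV NV n].
  by apply: val_inj; rewrite /= !TE id_tensor_formP -!TE.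
have [m nm hm] := id_tensor_form_step n.
have [M M0 bM] := id_tensor_form_bound n.
have [e e0 eV] := NV m.
exists (e / M) => [|w u Tu ue wu]; first by rewrite divr_gt0.
have [Tw wE] : inj_tensor_power (step m) (k + j) (form_pull extP (id_tensor_form w)) /\
    form_push (form_pull (n := m) extP (id_tensor_form w)) = id_tensor_form w.
  by apply: hm; exists u.
apply: (eV _ (form_pull extP (id_tensor_form w))) => //; last by rewrite TE.
apply: form_pull_le; have -> : e = M * (e / M) by rewrite mulrCA divff ?mulr1 // gt_eqF.
by apply: bM Tu wu _ ue; rewrite divr_ge0 ?ltW.
Qed.
End IdTensor.
End TensorOperators.

Section Reindexing.
Variables (K : numFieldType) (B : completeNormedModType K) (k l : nat).
Variables (t : 'I_k -> 'I_l) (s : 'I_l -> 'I_k).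
Hypotheses (tK : cancel t s) (sK : cancel s t).

Definition reindex_form (D : Type) (u : ('I_k -> D) -> K^o) : ('I_l -> D) -> K^o :=
  fun f => u (f \o t).

Lemma prod_reindex (F : 'I_k -> 'I_l -> K) :
  \prod_p F p (t p) = \prod_q F (s q) q.
Proof.
rewrite (reindex s) /=; first by apply: eq_bigr => q _; rewrite sK.
by exists t => q _; [exact: sK|exact: tK].
Qed.

Lemma reindex_span (u : ('I_k -> cdual B) -> K^o) :
  tensor_span u -> tensor_span (reindex_form u).
Proof.
move=> [m [a [x ->]]].
have -> : reindex_form (\sum_(p < m) a p *: elem_tensor (x p)) =
    \sum_(p < m) a p *: elem_tensor (fun q => x p (s q)).
  apply/funext => g; rewrite /reindex_form !fct_sumE; apply: eq_bigr => p _.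
  by congr (_ * _); exact: (prod_reindex (fun r q => g q (x p r))).
by apply: tensor_span_sum => p; exact/tensor_spanZ/tensor_span_elem.
Qed.

Lemma reindex_norm (u : ('I_k -> cdual B) -> K^o) e :
  inj_norm_le u e -> inj_norm_le (reindex_form u) e.
Proof.
move=> ue f c c0 fc; rewrite -(prod_reindex (fun _ => c)).
by apply: ue => // p x; exact: fc.
Qed.

Lemma reindex_power (u : ('I_k -> cdual B) -> K^o) :
  inj_tensor_power B k u -> inj_tensor_power B l (reindex_form u).
Proof.
move=> Tu e e0; have [v sv uv] := Tu e e0.
exists (reindex_form v); first exact: reindex_span.
exact: reindex_norm uv.
Qed.
End Reindexing.

Section TensorReindexing.
Variables (K : numFieldType) (Phi : LBspace K) (k l : nat).
Variables (t : 'I_k -> 'I_l) (s : 'I_l -> 'I_k).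
Hypotheses (tK : cancel t s) (sK : cancel s t).

Lemma tensor_reindex_exists : exists T : tensor Phi k -> tensor Phi l,
  lin_cont T /\ forall w, tensor_val (T w) = reindex_form t (tensor_val w).
Proof.
have /choice [T TE] : forall w : tensor Phi k, exists w' : tensor Phi l,
    tensor_val w' = reindex_form t (tensor_val w).
  move=> w; have [n [u [Tu ->]]] := tensorP w.
  exact: push_tensor (reindex_power tK sK Tu).
exists T; split => //.
apply/(lin_cont_inductive (@tensor_nbhsE _ _ _) (@tensor_nbhsE _ _ _) (@tensor_nbhs_up _ _ _)).
split => [b w w'|V cV NV n].
  by apply: val_inj; rewrite /= !TE.
have [e e0 eV] := NV n; exists e => // w u Tu ue wu.
apply: (eV _ (reindex_form t u)); last by rewrite TE wu.
  exact: reindex_power.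
exact: reindex_norm ue.
Qed.
End TensorReindexing.

Section SymmetricForms.
Variables (K : numFieldType) (D : Type) (k : nat).

Lemma sym_form_diag (u : ('I_k -> D) -> K^o) f :
  (forall s : 'S_k, u (fun j => f (s j)) = u f) -> sym_form u f = u f.
Proof.
move=> us; rewrite /sym_form; under eq_bigr do rewrite us.
rewrite sumr_const card_Sn -[X in _ * X]mulr_natl mulKf //.
by rewrite pnatr_eq0 -lt0n fact_gt0.
Qed.

Lemma sym_form_id (u : ('I_k -> D) -> K^o) :
  (forall f (s : 'S_k), u (fun j => f (s j)) = u f) -> sym_form u = u.
Proof. by move=> us; apply/funext => f; exact: sym_form_diag. Qed.
End SymmetricForms.

Section TensorOperator.
Variables (K : numFieldType) (Phi : LBspace K).
Hypothesis extP : extends_functionals Phi.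
Hypothesis archK : forall e : K, 0 < e -> exists m, 1 <= m.+1%:R * e.

Definition swap_ord k l (p : 'I_(k + l)) : 'I_(l + k) :=
  match fintype.split p with inl q => rshift l q | inr q => lshift k q end.

Lemma swap_ordl k l (q : 'I_k) : swap_ord (lshift l q) = rshift l q.
Proof. by rewrite /swap_ord (unsplitK (inl q)). Qed.

Lemma swap_ordr k l (q : 'I_l) : swap_ord (rshift k q) = lshift k q.
Proof. by rewrite /swap_ord (unsplitK (inr q)). Qed.

Lemma swap_ordK k l : cancel (@swap_ord k l) (@swap_ord l k).
Proof.
move=> p; rewrite -[p]splitK; case: (fintype.split p) => q /=.
  by rewrite swap_ordl swap_ordr.
by rewrite swap_ordr swap_ordl.
Qed.

Lemma tensor_swap_exists k l : exists T : tensor Phi (k + l) -> tensor Phi (l + k),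
  lin_cont T /\ forall u v, T (tensor_mul u v) = tensor_mul v u.
Proof.
have [T [Tlc TE]] := tensor_reindex_exists Phi (@swap_ordK k l) (@swap_ordK l k).
exists T; split => // u v; apply: tensor_ext => f; rewrite TE /reindex_form /= /tensor_form mulrC.
by congr (v _ * u _); apply/funext => q; rewrite /= ?swap_ordl ?swap_ordr.
Qed.

(** The tensor product of [a1] and [a2] is a composition of two maps that are the
    identity on one factor; exchanging the factors reduces both to
    [id_tensor_exists]. *)
Lemma tensor_maps_exist i1 j1 i2 j2 (a1 : tensor Phi i1 -> tensor Phi j1)
    (a2 : tensor Phi i2 -> tensor Phi j2) : lin_cont a1 -> lin_cont a2 ->
  exists T : tensor Phi (i1 + i2) -> tensor Phi (j1 + j2),
  lin_cont T /\ forall u v, T (tensor_mul u v) = tensor_mul (a1 u) (a2 v).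
Proof.
move=> lc1 lc2.
have [T2 [T2lc T2E]] := id_tensor_exists extP archK i1 lc2.
have [S [Slc SE]] := tensor_swap_exists i1 j2.
have [T1 [T1lc T1E]] := id_tensor_exists extP archK j2 lc1.
have [S' [S'lc S'E]] := tensor_swap_exists j2 j1.
exists (S' \o (T1 \o (S \o T2))); split => [|u v]; last by rewrite /= T2E SE T1E S'E.
by do 3!apply: lin_cont_comp => //.
Qed.

Lemma sym_tensor_perm k (u : sym_tensor Phi k) f (s : 'S_k) : u (fun j => f (s j)) = u f.
Proof.
have [n [v [[v' _ <-] ->]]] := sym_tensorP u.
rewrite /form_push /sym_form; congr (_ * _).
rewrite [RHS](reindex_inj (mulIg s)) /=; apply: eq_bigr => p _.
by congr v'; apply/funext => j; rewrite permM.
Qed.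

Lemma symmetrizeK k (u : sym_tensor Phi k) : symmetrize (sym_incl u) = u.
Proof.
apply: val_inj; apply: sym_form_id => f s; exact: sym_tensor_perm.
Qed.

(** Symmetrization extends [A1] and [A2] from the symmetric tensors to all
    tensors. *)
Lemma tensor_operatorP i1 j1 i2 j2 (A1 : toperator Phi i1 j1) (A2 : toperator Phi i2 j2) :
  continuous_toperator A1 -> continuous_toperator A2 ->
  @lin_cont K (tensor Phi (i1 + i2)) (tensor Phi (j1 + j2)) (tensor_operator A1 A2) /\
  forall u v, tensor_operator A1 A2 (tensor_mul (sym_incl u) (sym_incl v)) =
      tensor_mul (sym_incl (A1 u)) (sym_incl (A2 v)).
Proof.
move=> A1c A2c; rewrite /tensor_operator.
have lift_lc k l (A : toperator Phi k l) : continuous_toperator A ->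
    lin_cont (@sym_incl K Phi l \o (A \o @symmetrize K Phi k)).
  move=> Ac; apply: lin_cont_comp; first exact: sym_incl_lin_cont.
  by apply: lin_cont_comp => //; exact: symmetrize_lin_cont.
have [T [Tlc TE]] := tensor_maps_exist (lift_lc _ _ _ A1c) (lift_lc _ _ _ A2c).
case: xgetP => [T' _ //|/(_ T)[]]; split => // u v.
by rewrite TE /= !symmetrizeK.
Qed.

Lemma odot_continuous i1 j1 i2 j2 (A1 : toperator Phi i1 j1) (A2 : toperator Phi i2 j2) :
  continuous_toperator A1 -> continuous_toperator A2 ->
  continuous_toperator (odot A1 A2).
Proof.
move=> A1c A2c; have [Tlc _] := tensor_operatorP A1c A2c.
have h := lin_cont_comp (@symmetrize_lin_cont _ Phi _)
  (lin_cont_comp Tlc (@sym_incl_lin_cont _ Phi _)).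
exact: h.
Qed.

(** Powers are taken of elements of the first tensor power instead of [Phi], since
    this is where the values of the series to be substituted lie. *)
Fact tensor_power_subproof (x : sym_tensor Phi 1) k :
  (fun f => \prod_j x (fun=> f j)) \in @sym_tensor_pred K Phi k.
Proof.
have [n [u [/sym_tensor_inj_power Tu xu]]] := sym_tensorP x.
pose v k : ('I_k -> cdual (lb_step Phi n)) -> K^o := fun f => \prod_j u (fun=> f j).
have Tv p : inj_tensor_power (lb_step Phi n) p (v p).
  elim: p => [|p IH].
    have -> : v 0 = elem_tensor (fun=> 0) by apply/funext => f; rewrite /v /elem_tensor !big_ord0.
    exact/tensor_span_power/tensor_span_elem.
  have -> : v p.+1 = tensor_form (k := 1) u (v p); last exact: (@inj_tensor_power_form _ _ 1 p).
  apply/funext => f; rewrite /v /tensor_form big_ord_recl; congr (u _ * _).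
    by apply/funext => j; congr f; apply: val_inj; rewrite /= [j]ord1.
  by apply: eq_bigr => j _; congr u; apply/funext => _; congr f; exact: val_inj.
apply/mem_set; exists n => //; exists (sym_form (v k)); first by exists (v k).
have -> : sym_form (v k) = v k.
  apply: sym_form_id => f s.
  by rewrite /v [RHS](reindex_inj (@perm_inj _ s)).
by apply/funext => f; rewrite /form_push /v xu.
Qed.

Definition tpow (x : sym_tensor Phi 1) k : sym_tensor Phi k :=
  SymTensor (tensor_power_subproof x k).

Lemma pairing_tpow w x k : pairing w (tpow x k) = pairing w x ^+ k.
Proof. by rewrite /pairing /= prodr_const card_ord. Qed.

Lemma tpowD x k l :
  sym_incl (tpow x (k + l)) = tensor_mul (sym_incl (tpow x k)) (sym_incl (tpow x l)).
Proof. by apply: tensor_ext => f; rewrite /= /tensor_form big_split_ord. Qed.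

Lemma pairing_odot i1 j1 i2 j2 (A1 : toperator Phi i1 j1) (A2 : toperator Phi i2 j2) w x :
  continuous_toperator A1 -> continuous_toperator A2 ->
  pairing w (odot A1 A2 (tpow x (i1 + i2))) =
  pairing w (A1 (tpow x i1)) * pairing w (A2 (tpow x i2)).
Proof.
move=> A1c A2c; have [_ TE] := tensor_operatorP A1c A2c.
by rewrite /odot tpowD TE /pairing /= sym_form_diag.
Qed.
End TensorOperator.

(** * Polarization, separation and density *)

Section Polarization.
Variables (K : comNzRingType) (k : nat).

Definition subset_sign (S : {set 'I_k}) : K := \prod_(j < k) (if j \in S then 1 else -1).

(** Expanding a product of factors [1 - 1] (for the [j] outside the image of [g])
    and [1] (for the others) over subsets: the product is 0 unless [g] is onto,
    that is injective. *)
Lemma subset_sign_sum (g : {ffun 'I_k -> 'I_k}) :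
  \sum_(S : {set 'I_k}) subset_sign S * \prod_i (g i \in S)%:R = (injectiveb g)%:R.
Proof.
pose b j : K := - (j \notin codom g)%:R.
transitivity (\sum_(S : {set 'I_k}) \prod_j (if j \in S then 1 else b j)).
  apply: eq_bigr => S _; have [gS|] := boolP [forall i, g i \in S].
    rewrite [X in _ * X]big1 ?mulr1 => [|i _]; last by rewrite (forallP gS).
    apply: eq_bigr => j _; case: ifPn => // jS; rewrite /b.
    suff -> : j \notin codom g by [].
    by apply: contra jS => /codomP[i ->]; exact: (forallP gS).
  rewrite negb_forall => /existsP[i giS].
  rewrite [X in _ * X](bigD1 i) //= (negPf giS) mul0r mulr0.
  by rewrite (bigD1 (g i)) //= (negPf giS) /b codom_f oppr0 mul0r.
rewrite -bigA_distr; have [ginj|] := boolP (injectiveb g).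
  rewrite big1 // => j _; have jg := injF_onto (elimT (injectiveP g) ginj) j.
  by rewrite /b jg oppr0; exact: addr0.
move=> ninj; have [j jg|gsurj] := pickP [pred j | j \notin codom g].
  have {}jg : j \notin codom g by [].
  by rewrite (bigD1 j) //= /b jg [X in X * _]subrr mul0r.
case/negP: ninj; apply/card_uniqP; rewrite size_codom; apply: eq_card => j.
by have /= := gsurj j; case: (j \in codom g).
Qed.

(** Ryser's formula for the permanent, for a function [M] of the index map. It gives
    polarization both for forms in their arguments and for elementary tensors in
    their vectors. *)
Lemma permanent_polarization (M : {ffun 'I_k -> 'I_k} -> K) :
  \sum_(s : 'S_k) M (pval s) =
  \sum_(S : {set 'I_k}) subset_sign S *
     \sum_(g : {ffun 'I_k -> 'I_k}) (\prod_i (g i \in S)%:R) * M g.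
Proof.
under [RHS]eq_bigr do rewrite mulr_sumr.
rewrite exchange_big /=.
under [RHS]eq_bigr => g _ do under eq_bigr do rewrite mulrA.
under [RHS]eq_bigr => g _ do rewrite -mulr_suml subset_sign_sum.
rewrite [RHS](bigID (fun g : {ffun 'I_k -> 'I_k} => injectiveb g)) /= addrC [X in _ = X + _]big1 ?add0r.
  rewrite [RHS](reindex (@pval _)) /=.
    by apply: eq_big => [s|s _]; rewrite (valP s) // mul1r.
  pose in_Sn := insubd (1%g : 'S_k).
  by exists in_Sn => /= f Uf; first apply: val_inj; apply: insubdK.
by move=> g /negPf ->; rewrite mul0r.
Qed.
End Polarization.

Section Separation.
Variables (K : numFieldType) (Phi : LBspace K).
Local Notation step := (@lb_step K Phi).
Local Notation Phi' := (cdual (lb_type Phi)).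

Lemma cdual_comb (I : finType) (a : I -> K) (f : I -> Phi') :
  exists w : Phi', forall z, w z = \sum_i a i * f i z.
Proof.
apply: (@lb_bounded_cdual _ _ (fun z => \sum_i a i * f i z)) => [t x y|n].
  rewrite mulr_sumr -big_split; apply: eq_bigr => i _ /=.
  by rewrite (cdual_lin_cont (f i)).1 mulrDr mulrCA.
have [c c0 fc] := cdual_bounds (fun i => cdual_restrict n (f i)).
exists (\sum_i `|a i| * c i) => [|x].
  by apply: sumr_ge0 => i _; rewrite mulr_ge0.
apply: (le_trans (ler_norm_sum _ _ _)); rewrite mulr_suml; apply: ler_sum => i _.
by rewrite normrM -mulrA ler_wpM2l //; exact: fc.
Qed.

(** Evaluation at fixed functionals is continuous for the injective norm, so linear
    relations between evaluations extend by density from elementary tensors. *)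
Lemma eval_comb_eq (B : completeNormedModType K) k (I J : finType)
    (a : I -> K) (F : I -> 'I_k -> cdual B) (b : J -> K) (G : J -> 'I_k -> cdual B) :
  (forall x, \sum_i a i * elem_tensor x (F i) = \sum_j b j * elem_tensor x (G j)) ->
  forall u, inj_tensor_power B k u -> \sum_i a i * u (F i) = \sum_j b j * u (G j).
Proof.
move=> elemE u Tu.
have spanE v : tensor_span v -> \sum_i a i * v (F i) = \sum_j b j * v (G j).
  move=> [m [c [x ->]]].
  have expand (L : finType) (d : L -> K) (H : L -> 'I_k -> cdual B) :
      \sum_i d i * (\sum_(p < m) c p *: elem_tensor (x p)) (H i) =
      \sum_(p < m) c p * \sum_i d i * elem_tensor (x p) (H i).
    under eq_bigr do rewrite fct_sumE mulr_sumr.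
    rewrite exchange_big; apply: eq_bigr => p _; rewrite mulr_sumr.
    by apply: eq_bigr => i _; rewrite mulrCA.
  by rewrite !expand; apply: eq_bigr => p _; rewrite elemE.
have bnd (L : finType) (d : L -> K) (H : L -> 'I_k -> cdual B) :
    exists2 C, 0 <= C & forall v e, inj_norm_le v e -> `|\sum_i d i * v (H i)| <= C * e.
  have [c c0 Hc] := cdual_bounds (fun z : L * 'I_k => H z.1 z.2).
  exists (\sum_i `|d i| * \prod_q c (i, q)) => [|v e ve].
    by apply: sumr_ge0 => i _; rewrite mulr_ge0 // prodr_ge0.
  apply: (le_trans (ler_norm_sum _ _ _)); rewrite mulr_suml; apply: ler_sum => i _.
  rewrite normrM -mulrA ler_wpM2l //; apply: ve => // q x.
  exact: (Hc (i, q)).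
have [C C0 hC] := bnd _ a F; have [D D0 hD] := bnd _ b G.
apply/eqP; rewrite -subr_eq0; apply/eqP/(@le_all_pos _ _ (C + D)).
  by rewrite addr_ge0.
move=> e e0; have [v sv uv] := Tu e e0.
have sub (L : finType) (d : L -> K) (H : L -> 'I_k -> cdual B) :
    \sum_i d i * u (H i) = \sum_i d i * (u - v) (H i) + \sum_i d i * v (H i).
  by rewrite -big_split; apply: eq_bigr => i _; rewrite /= -mulrDr !fctE subrK.
rewrite !sub (spanE v sv) opprD addrACA subrr addr0 mulrDl.
by apply: (le_trans (ler_normB _ _)); rewrite lerD ?hC ?hD.
Qed.

Lemma tensor_multilinear k (u : tensor Phi k) (a : 'I_k -> K) (f : 'I_k -> Phi') (w : Phi') :
  (forall z, w z = \sum_i a i * f i z) ->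
  u (fun=> w) = \sum_(g : {ffun 'I_k -> 'I_k}) (\prod_i a (g i)) * u (fun i => f (g i)).
Proof.
move=> wE; have [n [v [Tv ->]]] := tensorP u; rewrite /form_push.
have := @eval_comb_eq (step n) k 'I_1 {ffun 'I_k -> 'I_k} (fun=> 1)
  (fun _ _ => cdual_restrict n w) (fun g => \prod_i a (g i))
  (fun g i => cdual_restrict n (f (g i))) _ v Tv.
rewrite big_ord1 mul1r; apply => x; rewrite big_ord1 mul1r /elem_tensor.
under eq_bigr do rewrite cdual_restrictE wE.
rewrite bigA_distr_bigA; apply: eq_bigr => g _.
by rewrite big_split.
Qed.

(** Polarization, applied to the functionals [\sum_(i in S) f i]. *)
Lemma pairing_inj k (u v : sym_tensor Phi k) :
  (forall w, pairing w u = pairing w v) -> u = v.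
Proof.
move=> uv; apply/eqP; rewrite -subr_eq0; apply/eqP.
have d0 w : pairing w (u - v) = 0 by rewrite -[LHS]/(pairing w u - pairing w v) uv subrr.
set d := u - v in d0 *; apply: sym_tensor_ext => f.
have : \sum_(s : 'S_k) d (fun i => f (pval s i)) = 0.
  rewrite (permanent_polarization (fun g => d (fun i => f (g i)))).
  apply: big1 => S _.
  have [w wE] := cdual_comb (fun i => (i \in S)%:R) f.
  have := tensor_multilinear (sym_incl d) wE; rewrite -[LHS]/(pairing w d) d0 => <-.
  by rewrite mulr0.
under eq_bigr do rewrite pvalE sym_tensor_perm.
rewrite sumr_const card_Sn => /eqP; rewrite mulrn_eq0 -leqn0 leqNgt fact_gt0.
by move/eqP.
Qed.

Definition sym_scalar_continuous k (L : sym_tensor Phi k -> K) : Prop :=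
  forall n e, 0 < e -> sym_tensor_nbhs n [set w | `|L w| <= e].

Lemma vector_tensor (z : lb_type Phi) : exists x : sym_tensor Phi 1,
  forall f, x f = f ord0 z.
Proof.
have [n [y <-]] := lb_unionP z.
pose u : ('I_1 -> cdual (step n)) -> K^o := elem_tensor (fun=> y).
have Tu : sym_tensor_power (step n) 1 u.
  exists u; first exact/tensor_span_power/tensor_span_elem.
  by apply: sym_form_id => f s; rewrite /u /elem_tensor !big_ord1 [s ord0]ord1.
have uP : form_push u \in @sym_tensor_pred K Phi 1.
  by apply/mem_set; exists n => //; exists u.
by exists (SymTensor uP) => f; rewrite /= /form_push /u /elem_tensor big_ord1.
Qed.

(** Polarization, applied to the vectors [\sum_(i in S) x i], writes a symmetrized
    elementary tensor as a combination of powers. *)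
Lemma scalar_dense k (L : sym_tensor Phi k -> K) :
  (forall a x y, L (a *: x + y) = a * L x + L y) -> sym_scalar_continuous L ->
  (forall x, L (tpow x k) = 0) -> forall u, L u = 0.
Proof.
move=> Llin Lc Lpow u.
have Llin' : linear (L : sym_tensor Phi k -> K^o) by exact: Llin.
have [n [v [[v' Tv' <-] uE]]] := sym_tensorP u.
have pushS (s : ('I_k -> cdual (step n)) -> K^o) : inj_tensor_power (step n) k s ->
    exists w : sym_tensor Phi k, sym_tensor_val w = form_push (sym_form s).
  move=> Ts; have sP : form_push (sym_form s) \in @sym_tensor_pred K Phi k.
    by apply/mem_set; exists n => //; exists (sym_form s) => //; exists s.
  by exists (SymTensor sP).
have Lelem x w : sym_tensor_val w = form_push (sym_form (elem_tensor (x : 'I_k -> step n))) ->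
    L w = 0.
  move=> wE.
  have /choice [X XE] : forall S : {set 'I_k}, exists X : sym_tensor Phi 1,
      forall f, X f = f ord0 (lb_in (\sum_(i in S) x i)).
    by move=> S; exact: vector_tensor.
  have E : k`!%:R *: w = \sum_(S : {set 'I_k}) subset_sign K S *: tpow (X S) k.
    apply: sym_tensor_ext => f.
    have evlin : linear (fun y : sym_tensor Phi k => (y f : K^o)) by [].
    rewrite (lin_sum evlin) (linZ evlin) wE /form_push /sym_form.
    rewrite -[_ *: _]/(_ * (_ * _)) mulVKf ?pnatr_eq0 -?lt0n ?fact_gt0 //.
    transitivity (\sum_(s : 'S_k) \prod_j f j (lb_in (x (pval s j)))).
      rewrite (reindex_inj invg_inj) /=; apply: eq_bigr => s _.
      rewrite /elem_tensor (reindex_inj (@perm_inj _ s)); apply: eq_bigr => j _.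
      by rewrite permK cdual_restrictE pvalE.
    rewrite (permanent_polarization (fun g => \prod_j f j (lb_in (x (g j))))).
    apply: eq_bigr => S _; rewrite (linZ evlin); congr (_ * _).
    under eq_bigr do rewrite -big_split.
    rewrite -(bigA_distr_bigA (fun j i => (i \in S)%:R * f j (lb_in (x i)))).
    rewrite /tpow /=; apply: eq_bigr => j _; rewrite XE (lin_sum (@lb_inP _ _ _)).
    rewrite (lin_sum (cdual_lin_cont (f j)).1) [RHS]big_mkcond; apply: eq_bigr => i _.
    by case: (i \in S); rewrite ?mul1r ?mul0r.
  have : L (k`!%:R *: w) = 0.
    rewrite E (lin_sum Llin') big1 // => S _.
    by rewrite (linZ Llin') Lpow scaler0.
  rewrite (linZ Llin') => /eqP; rewrite scaler_eq0 pnatr_eq0 -leqn0 leqNgt fact_gt0.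
  by move/eqP.
apply: (@le_all_pos _ _ 1) => // e e0; rewrite mul1r.
have [d d0 dL] := Lc n e e0.
have [s ss vs] := Tv' d d0.
have symlin : linear (fun v : ('I_k -> cdual (step n)) -> K^o => form_push (sym_form v)).
  by move=> b y z; rewrite sym_formP.
have [ws wsE] := pushS s (tensor_span_power ss).
have Ls : L ws = 0.
  have [m [a [x sE]]] := ss.
  have /choice [W WE] : forall p, exists W : sym_tensor Phi k,
      sym_tensor_val W = form_push (sym_form (elem_tensor (x p))).
    by move=> p; apply/pushS/tensor_span_power/tensor_span_elem.
  have -> : ws = \sum_p a p *: W p.
    apply: val_inj => /=; rewrite wsE sE.
    have vallin : linear (@sym_tensor_val K Phi k) by [].
    rewrite (lin_sum vallin) (lin_sum symlin); apply: eq_bigr => p _.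
    by rewrite (linZ vallin) (linZ symlin) WE.
  by rewrite (lin_sum Llin') big1 // => p _; rewrite (linZ Llin') (Lelem _ _ (WE p)) scaler0.
have -> : L u = L (u - ws) by rewrite (linB Llin') Ls subr0.
have Tvs : inj_tensor_power (step n) k (v' - s).
  rewrite addrC -scaleN1r; apply: inj_tensor_powerP => //; exact: tensor_span_power.
apply: (dL _ (sym_form (v' - s))); first by exists (v' - s).
  exact: sym_norm_le.
have vallin : linear (@sym_tensor_val K Phi k) by [].
rewrite (linB vallin) uE wsE.
by rewrite -(linB symlin).
Qed.

Lemma toperator_eval_continuous k l (A : toperator Phi k l) h :
  continuous_toperator A -> sym_scalar_continuous (fun w => A w h).
Proof.
move=> Ac n e e0.
have [_ Anb] := (lin_cont_inductive (@sym_tensor_nbhsE _ _ k) (@sym_tensor_nbhsE _ _ l)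
  (@sym_tensor_nbhs_up _ _ k) A).1 Ac.
apply: (Anb [set y | `|y h| <= e]) => [a b x y /= xe ye ab|m].
  by apply: normB_le1 xe ye ab; exact: ltW.
have [c c0 hc] := cdual_bounds (fun q => cdual_restrict m (h q)).
have P0 : 0 <= \prod_q c q by exact: prodr_ge0.
have P1 : 0 < \prod_q c q + 1 by rewrite ltr_wpDl.
exists (e / (\prod_q c q + 1)) => [|w u _ ue wu /=]; first by rewrite divr_gt0.
rewrite wu; apply: (le_trans (ue _ _ c0 hc)).
by rewrite mulrCA ler_piMr ?(ltW e0) // ler_pdivrMr // mul1r lerDl.
Qed.

(** By this lemma identities between continuous operators reduce to identities between the
    scalars [pairing w (A (tpow x k))]. *)
Lemma toperator_ext k l (A A' : toperator Phi k l) :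
  continuous_toperator A -> continuous_toperator A' ->
  (forall w x, pairing w (A (tpow x k)) = pairing w (A' (tpow x k))) -> A = A'.
Proof.
move=> Ac A'c AA'; apply/funext => u; apply/eqP; rewrite -subr_eq0; apply/eqP.
apply: sym_tensor_ext => h.
apply: (@scalar_dense k (fun u => (A u - A' u) h)) => [a x y|n e e0|x].
- by rewrite Ac.1 A'c.1 /= !fctE /= mulrBr opprD addrACA.
- have e20 : 0 < e / 2 by rewrite divr_gt0.
  have NA := toperator_eval_continuous h Ac n e20.
  have NA' := toperator_eval_continuous h A'c n e20.
  apply: sym_tensor_nbhs_up (sym_tensor_nbhsI NA NA') => w [/= Aw A'w].
  by apply: (le_trans (ler_normB _ _)); rewrite [e]splitr; exact: lerD.
- have -> : A (tpow x k) = A' (tpow x k) by apply: pairing_inj => w; exact: AA'.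
  by rewrite subrr.
Qed.
End Separation.

(** * Continuity of combined operators *)

Section InductiveCombination.
Variables (K : numFieldType) (E F : NbhsLmodule.type K) (I J : Type).
Variables (NE : I -> set_system E) (NF : J -> set_system F).
Hypothesis nbhsE : forall x : E, nbhs x = translated_nbhs (inductive_nbhs0 NE) x.
Hypothesis nbhsF : forall x : F, nbhs x = translated_nbhs (inductive_nbhs0 NF) x.
Hypothesis NE_up : forall i V W, V `<=` W -> NE i V -> NE i W.
Hypothesis NE_I : forall i V W, NE i V -> NE i W -> NE i (V `&` W).
Hypothesis NE_T : forall i, NE i setT.
Hypothesis NF_scale : forall j (c : K) V, abs_convex V -> NF j V -> NF j [set y | V (c *: y)].

(** The combination is the midpoint of [(2 * a) *: S x] and [2 *: T x], so that
    absolutely convex neighbourhoods suffice. *)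
Lemma lin_cont_comb (a : K) (S T : E -> F) : lin_cont S -> lin_cont T ->
  lin_cont (fun x => a *: S x + T x).
Proof.
move=> Sc Tc.
have [Sl Sn] := (lin_cont_inductive nbhsE nbhsF NE_up S).1 Sc.
have [Tl Tn] := (lin_cont_inductive nbhsE nbhsF NE_up T).1 Tc.
apply/(lin_cont_inductive nbhsE nbhsF NE_up); split=> [b x y|V cV NV i].
  by rewrite Sl Tl !scalerDr !scalerA [a * b]mulrC addrACA.
have cVs c : abs_convex [set y | V (c *: y)].
  move=> b d x y /= Vx Vy bd; rewrite scalerDr !scalerA ![c * _]mulrC -!scalerA.
  exact: cV.
have NS := Sn _ (cVs (2 * a)) (fun j => NF_scale (2 * a) cV (NV j)) i.
have NT := Tn _ (cVs 2) (fun j => NF_scale 2 cV (NV j)) i.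
apply: NE_up (NE_I NS NT) => x [/= Sx Tx].
have h2 : (2 : K)^-1 * 2 = 1 by rewrite mulVf ?pnatr_eq0.
have -> : a *: S x + T x = 2^-1 *: ((2 * a) *: S x) + 2^-1 *: (2 *: T x).
  by rewrite !scalerA mulrA h2 mul1r scale1r.
apply: cV => //; rewrite gtr0_norm ?invr_gt0 //.
by have := splitr (1 : K); rewrite mul1r => <-.
Qed.

Lemma lin_cont_cst0 (j0 : J) : (forall j V, NF j V -> V 0) ->
  lin_cont (fun _ : E => 0 : F).
Proof.
move=> NF0; apply/(lin_cont_inductive nbhsE nbhsF NE_up); split=> [b x y|V cV NV i].
  by rewrite scaler0 addr0.
by apply: NE_up (NE_T i) => x _ /=; exact: NF0 (NV j0).
Qed.
End InductiveCombination.

Section ToperatorContinuity.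
Variables (K : numFieldType) (Phi : LBspace K).
Local Notation step := (@lb_step K Phi).

Lemma sym_tensor_nbhsT k n : sym_tensor_nbhs n [set: sym_tensor Phi k].
Proof. by exists 1. Qed.

Lemma sym_tensor_powerZ k n a u : sym_tensor_power (step n) k u ->
  sym_tensor_power (step n) k (a *: u).
Proof.
move=> Su; rewrite -[_ *: _]addr0; apply: sym_tensor_powerP => //.
exact: sym_tensor_power0.
Qed.

Lemma sym_tensor_nbhsZ k n c (V : set (sym_tensor Phi k)) :
  sym_tensor_nbhs n V -> sym_tensor_nbhs n [set y | V (c *: y)].
Proof.
move=> [d d0 dV]; have c1 : 0 < `|c| + 1 by rewrite ltr_wpDl.
exists (d / (`|c| + 1)) => [|w v Tv vm wv /=]; first by rewrite divr_gt0.
apply: (dV _ (c *: v)); first exact: sym_tensor_powerZ.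
  apply: inj_norm_le_weak (inj_norm_leZ c vm).
  by rewrite mulrCA ler_piMr ?(ltW d0) // ler_pdivrMr // mul1r lerDl.
by rewrite -[LHS]/(c *: sym_tensor_val w) wv.
Qed.

Lemma sym_tensor_nbhs0 k n (V : set (sym_tensor Phi k)) : sym_tensor_nbhs n V -> V 0.
Proof.
move=> [d d0 dV]; apply: (dV _ 0) => //; first exact: sym_tensor_power0.
by apply: inj_norm_le0; exact: ltW.
Qed.

Lemma toperator_comb_continuous k l a (A B : toperator Phi k l) :
  continuous_toperator A -> continuous_toperator B ->
  continuous_toperator (a *: A + B).
Proof.
apply: (lin_cont_comb (@sym_tensor_nbhsE _ _ k) (@sym_tensor_nbhsE _ _ l)).
- exact: sym_tensor_nbhs_up.
- exact: sym_tensor_nbhsI.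
- by move=> n c V _; exact: sym_tensor_nbhsZ.
Qed.

Lemma toperator0_continuous k l : continuous_toperator (0 : toperator Phi k l).
Proof.
apply: (lin_cont_cst0 (@sym_tensor_nbhsE _ _ k) (@sym_tensor_nbhsE _ _ l)) => //.
- exact: sym_tensor_nbhs_up.
- exact: sym_tensor_nbhsT.
- exact: sym_tensor_nbhs0.
Qed.

Lemma toperatorZ_continuous k l a (A : toperator Phi k l) :
  continuous_toperator A -> continuous_toperator (a *: A).
Proof.
move=> Ac; rewrite -[_ *: _]addr0; apply: toperator_comb_continuous => //.
exact: toperator0_continuous.
Qed.

Lemma toperatorD_continuous k l (A B : toperator Phi k l) :
  continuous_toperator A -> continuous_toperator B -> continuous_toperator (A + B).
Proof. by move=> Ac Bc; rewrite -[A]scale1r; exact: toperator_comb_continuous. Qed.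

Lemma toperator_sum_continuous k l (I : Type) (r : seq I) (P : pred I)
    (A : I -> toperator Phi k l) : (forall i, P i -> continuous_toperator (A i)) ->
  continuous_toperator (\sum_(i <- r | P i) A i).
Proof.
move=> Ac; elim/big_ind: _ => //; first exact: toperator0_continuous.
by move=> A1 A2; exact: toperatorD_continuous.
Qed.

Lemma toperator_id_continuous k : continuous_toperator (idfun : toperator Phi k k).
Proof. by split=> [a x y|x U]. Qed.

Lemma toperator_comp_continuous k l m (A : toperator Phi l m) (B : toperator Phi k l) :
  continuous_toperator A -> continuous_toperator B -> continuous_toperator (A \o B).
Proof. exact: lin_cont_comp. Qed.

Lemma toperator_cast_continuous k k' l l' (ek : k = k') (el : l = l')
    (A : toperator Phi k l) : continuous_toperator A ->
  continuous_toperator (toperator_cast ek el A).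
Proof. by case: k' / ek; case: l' / el. Qed.

Lemma toperator_sumE k l (I : Type) (r : seq I) (P : pred I)
    (A : I -> toperator Phi k l) u :
  (\sum_(i <- r | P i) A i) u = \sum_(i <- r | P i) A i u.
Proof. by elim/big_rec2: _ => // i y1 y2 _ <-. Qed.

Lemma pairing_lin k w : linear (fun u : sym_tensor Phi k => pairing w u : K^o).
Proof. by []. Qed.

Lemma pairing_cast k l (e : k = l) w (u : sym_tensor Phi k) :
  pairing w (sym_cast e u) = pairing w u.
Proof. by case: l / e. Qed.

Lemma sym_cast_tpow k l (e : k = l) x : sym_cast e (tpow x k) = tpow x l :> sym_tensor Phi l.
Proof. by case: l / e. Qed.

Lemma sym_tensor0_const (u : sym_tensor Phi 0) w f : u f = pairing w u.
Proof. by congr (sym_tensor_val u); apply/funext => -[]. Qed.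

Lemma pairing_scalar w a : pairing w (scalar_tensor Phi a) = a.
Proof. by []. Qed.

Lemma pairing_toperator_continuous k l (A : toperator Phi k l) w :
  continuous_toperator A ->
  continuous_toperator (fun f => scalar_tensor Phi (pairing w (A f)) : sym_tensor Phi 0).
Proof.
move=> Ac; apply/(lin_cont_inductive (@sym_tensor_nbhsE _ _ k) (@sym_tensor_nbhsE _ _ 0)
  (@sym_tensor_nbhs_up _ _ k)); split=> [a x y|V cV NV n].
  by apply: sym_tensor_ext => f; rewrite /= Ac.1.
have [d d0 dV] := NV n.
have [e e0 eA] := toperator_eval_continuous (fun=> w) Ac n d0.
exists e => // u v Tv ve uv /=.
have us := eA u v Tv ve uv.
pose c := pairing w (A u).
have Tc : tensor_span ((fun=> c) : ('I_0 -> cdual (step n)) -> K^o).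
  have -> : (fun=> c) = c *: elem_tensor (fun _ : 'I_0 => (0 : step n)).
    by apply/funext => f; rewrite /elem_tensor fctE big_ord0 [RHS]mulr1.
  exact/tensor_spanZ/tensor_span_elem.
apply: (dV _ (fun=> c)) => //.
  exists (fun=> c); last by apply: sym_form_id.
  exact: tensor_span_power.
by move=> f c' c0' _; rewrite big_ord0 mul1r.
Qed.
End ToperatorContinuity.

(** * Scalar sequences and truncated polynomials *)

Section Truncation.
Variable K : numFieldType.
Implicit Types (a b c : nat -> K) (p q : {poly K}).

(** Cauchy products of sequences are computed up to order [N] in [{poly K}], which
    provides the ring laws. *)
Definition trunc_poly (N : nat) a : {poly K} := \poly_(i < N.+1) a i.

Lemma coef_trunc N a i : (trunc_poly N a)`_i = if (i <= N)%N then a i else 0.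
Proof. by rewrite coef_poly ltnS. Qed.

Definition conv a b : nat -> K := fun k => \sum_(l < k.+1) a l * b (k - l)%N.

Lemma coefM_trunc N p q p' q' : (forall i, (i <= N)%N -> p`_i = p'`_i) ->
  (forall i, (i <= N)%N -> q`_i = q'`_i) ->
  forall i, (i <= N)%N -> (p * q)`_i = (p' * q')`_i.
Proof.
move=> pp qq i iN; rewrite !coefM; apply: eq_bigr => j _.
rewrite pp ?qq //; first by rewrite (leq_trans _ iN) // leq_subr.
by rewrite (leq_trans _ iN) // -ltnS.
Qed.

Lemma coefX_trunc N p p' n : (forall i, (i <= N)%N -> p`_i = p'`_i) ->
  forall i, (i <= N)%N -> (p ^+ n)`_i = (p' ^+ n)`_i.
Proof.
by move=> pp; elim: n => [|n IH] i iN //; rewrite !exprS; exact: (coefM_trunc pp IH).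
Qed.

Lemma conv_coef N a b k : (k <= N)%N ->
  conv a b k = (trunc_poly N a * trunc_poly N b)`_k.
Proof.
move=> kN; rewrite coefM; apply: eq_bigr => l _; rewrite !coef_trunc.
rewrite (leq_trans _ kN); last by rewrite -ltnS.
by rewrite (leq_trans (leq_subr _ _) kN).
Qed.

Lemma convC a b : conv a b = conv b a.
Proof. by apply/funext => k; rewrite !(@conv_coef k) // mulrC. Qed.

Lemma convA a b c : conv a (conv b c) = conv (conv a b) c.
Proof.
apply/funext => k; rewrite !(@conv_coef k) //.
have tE u v i : (i <= k)%N -> (trunc_poly k (conv u v))`_i =
    (trunc_poly k u * trunc_poly k v)`_i.
  by move=> ik; rewrite coef_trunc ik (conv_coef _ _ ik).
rewrite (coefM_trunc (N := k) (p' := trunc_poly k a) (q' := trunc_poly k b * trunc_poly k c)) //.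
  rewrite mulrA; apply: (coefM_trunc (N := k)) => // i ik; by rewrite tE.
by move=> i ik; rewrite tE.
Qed.

Definition delta0 : nat -> K := fun k => (k == 0)%:R.

Lemma trunc_delta0 N : trunc_poly N delta0 = 1.
Proof. by apply/polyP => i; rewrite coef_trunc coef1 /delta0; case: i => //= i; case: ifP. Qed.

Lemma conv1 a : conv a delta0 = a.
Proof.
apply/funext => k; rewrite (@conv_coef k) // trunc_delta0 mulr1 coef_trunc leqnn //.
Qed.

Lemma conv_cancel a b b' : a 0 = 1 -> conv b a = conv b' a -> b = b'.
Proof.
move=> a0 E; apply/funext => k; elim/ltn_ind: k => k IH.
move/(congr1 (fun f => f k)): E; rewrite /conv !big_ord_recr /= subnn a0 !mulr1.
by under eq_bigr => l _ do rewrite IH //; move/addrI.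
Qed.

Lemma coefX_low p n k : p`_0 = 0 -> (k < n)%N -> (p ^+ n)`_k = 0.
Proof.
move=> p0; elim: n k => // n IH k kn; rewrite exprS coefM big1 // => j _.
case: j => -[|j] /= jk; first by rewrite p0 mul0r.
rewrite IH ?mulr0 //; have {}jk : (j < k)%N := jk.
rewrite ltnS in kn; apply: leq_trans kn.
by rewrite ltn_subrL (leq_ltn_trans _ jk).
Qed.

(** Because [b 0 = 0], tuples with a zero entry contribute nothing, and the
    coefficient is a sum over the compositions of [k]. *)
Lemma coefX_composition b k l : b 0 = 0 ->
  (trunc_poly k b ^+ l)`_k =
  \sum_(s : l.-tuple 'I_k.+1 | is_composition s) \prod_(i <- s) b i.
Proof.
move=> b0; rewrite /trunc_poly poly_def -[l in LHS]card_ord -prodr_const.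
rewrite bigA_distr_bigA coef_sum.
rewrite (reindex (@finfun_of_tuple 'I_k.+1 l)) /=; last first.
  by exists (@tuple_of_finfun _ l) => x _; [exact: finfun_of_tupleK|exact: tuple_of_finfunK].
rewrite [RHS]big_mkcond; apply: eq_bigr => s _.
rewrite scaler_prod -expr_sum coefZ coefXn.
have -> : \prod_(i in 'I_l) b (finfun_of_tuple s i) = \prod_(i <- s) b i.
  by rewrite big_tuple; apply: eq_bigr => i _; rewrite ffunE.
have -> : (\sum_(i in 'I_l) finfun_of_tuple s i)%N = sumn (map val s).
  by rewrite sumnE big_map big_tuple; apply: eq_bigr => i _; rewrite ffunE.
rewrite /is_composition eq_sym; case: (allP) => [_ /=|nall /=].
  by case: eqP; rewrite ?mulr1 ?mulr0.
suff -> : \prod_(i <- s) b i = 0 by rewrite mul0r.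
apply/eqP; rewrite prodf_seq_eq0; apply: contraT => /hasPn h; exfalso.
apply: nall => i si; rewrite lt0n; apply/eqP => i0.
by have := h i si; rewrite /= i0 b0 eqxx.
Qed.

Lemma poly_ext p q : (forall t, p.[t] = q.[t]) -> p = q.
Proof.
move=> pq; apply/eqP; rewrite -subr_eq0; apply/contraT => d0.
set d := p - q in d0; pose r : seq K := map (fun n => n%:R) (iota 0 (size d)).
have := max_poly_roots d0 (rs := r); rewrite size_map size_iota ltnn; apply.
  by apply/allP => t _; rewrite /root /d hornerD hornerN pq subrr.
rewrite map_inj_uniq ?iota_uniq // => m n /eqP; rewrite eqr_nat => /eqP //.
Qed.
End Truncation.

(** * Series evaluated on powers *)

Section SeriesEvaluation.
Variables (K : numFieldType) (Phi : LBspace K).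
Hypothesis extP : extends_functionals Phi.
Hypothesis archK : forall e : K, 0 < e -> exists m, 1 <= m.+1%:R * e.
Local Notation Phi' := (cdual (lb_type Phi)).
Local Notation ocomp B k l := (@odot_compositions K Phi B k l).
Local Notation oneS := (@one_series K Phi).
Local Notation idS := (@id_series K Phi).
Local Notation odotc := (odot_continuous extP archK).
Implicit Types (w : Phi') (x : sym_tensor Phi 1).

Definition continuous_series i (C : tseries Phi i) : Prop :=
  forall k, continuous_toperator (C k).

Definition teval w x k l (A : toperator Phi k l) : K := pairing w (A (tpow x k)).

(** For fixed [w] and [x] a series becomes a sequence of scalars; these sequences
    determine a continuous series, by [series_ext]. *)
Definition seval i (C : tseries Phi i) w x : nat -> K := fun k => teval w x (C k).

Lemma teval_cast w x k k' l l' (ek : k = k') (el : l = l') (A : toperator Phi k l) :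
  teval w x (toperator_cast ek el A) = teval w x A.
Proof. by rewrite /teval /toperator_cast pairing_cast sym_cast_tpow. Qed.

Lemma teval_odot w x i1 j1 i2 j2 (A1 : toperator Phi i1 j1) (A2 : toperator Phi i2 j2) :
  continuous_toperator A1 -> continuous_toperator A2 ->
  teval w x (odot A1 A2) = teval w x A1 * teval w x A2.
Proof. exact: pairing_odot. Qed.

Lemma teval_sum w x k l (I : Type) (r : seq I) (P : pred I) (A : I -> toperator Phi k l) :
  teval w x (\sum_(i <- r | P i) A i) = \sum_(i <- r | P i) teval w x (A i).
Proof. by rewrite /teval toperator_sumE (lin_sum (@pairing_lin _ _ _ w)). Qed.

Lemma tevalZ w x k l a (A : toperator Phi k l) :
  teval w x (a *: A) = a * teval w x A.
Proof. by []. Qed.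

Lemma series_ext i (C D : tseries Phi i) :
  continuous_series C -> continuous_series D ->
  (forall w x, seval C w x = seval D w x) -> C = D.
Proof.
move=> Cc Dc CD; apply: functional_extensionality_dep => k.
by apply: toperator_ext => // w x; have /(congr1 (fun f => f k)) := CD w x.
Qed.

Lemma one_series_continuous : continuous_series oneS.
Proof.
by case=> [|k]; [exact: toperator_id_continuous|exact: toperator0_continuous].
Qed.

Lemma id_series_continuous : continuous_series idS.
Proof.
by case=> [|[|k]]; [exact: toperator0_continuous|exact: toperator_id_continuous|
  exact: toperator0_continuous].
Qed.

Lemma series_mul_continuous (C D : tseries Phi 0) :
  continuous_series C -> continuous_series D -> continuous_series (series_mul C D).
Proof.
move=> Cc Dc k; apply: toperator_sum_continuous => l _.
by apply: toperator_cast_continuous; exact: (odotc (Cc _) (Dc _)).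
Qed.

Lemma seval_mul (C D : tseries Phi 0) w x :
  continuous_series C -> continuous_series D ->
  seval (series_mul C D) w x = conv (seval C w x) (seval D w x).
Proof.
move=> Cc Dc; apply/funext => k; rewrite /seval /series_mul teval_sum.
apply: eq_bigr => l _; rewrite teval_cast; exact: (teval_odot _ _ (Cc _) (Dc _)).
Qed.

Lemma seval_one w x : seval oneS w x = @delta0 K.
Proof.
apply/funext => -[|k]; last by [].
exact: (pairing_tpow w x 0).
Qed.

Lemma seval_id w x : seval idS w x = fun k => (k == 1)%:R * pairing w x.
Proof.
apply/funext => -[|[|k]]; rewrite ?mul0r // mul1r.
exact: (pairing_tpow w x 1).
Qed.

Lemma series_mulA (C D E : tseries Phi 0) :
  continuous_series C -> continuous_series D -> continuous_series E ->
  series_mul C (series_mul D E) = series_mul (series_mul C D) E.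
Proof.
move=> Cc Dc Ec; apply: series_ext => [||w x]; try by do !apply: series_mul_continuous.
rewrite !seval_mul ?convA //; exact: series_mul_continuous.
Qed.

Lemma series_mulC (C D : tseries Phi 0) :
  continuous_series C -> continuous_series D -> series_mul C D = series_mul D C.
Proof.
move=> Cc Dc; apply: series_ext => [||w x]; try exact: series_mul_continuous.
by rewrite !seval_mul // convC.
Qed.

Lemma series_mulr1 (C : tseries Phi 0) : continuous_series C ->
  series_mul C oneS = C.
Proof.
move=> Cc; apply: series_ext => // [|w x].
  by apply: series_mul_continuous => //; exact: one_series_continuous.
by rewrite seval_mul ?seval_one ?conv1 //; exact: one_series_continuous.
Qed.

Lemma odot_seq_continuous (B : tseries Phi 1) s : continuous_series B ->
  continuous_toperator (@odot_seq _ _ B s).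
Proof.
move=> Bc; elim: s => [|i s IH] /=; first exact: toperator_id_continuous.
exact: (odotc (Bc i) IH).
Qed.

Lemma teval_odot_seq (B : tseries Phi 1) s w x : continuous_series B ->
  teval w x (@odot_seq _ _ B s) = \prod_(i <- s) seval B w x i.
Proof.
move=> Bc; elim: s => [|i s IH].
  by rewrite big_nil; exact: (pairing_tpow w x 0).
rewrite big_cons -IH.
exact: (teval_odot _ _ (Bc i) (@odot_seq_continuous B s Bc)).
Qed.

Lemma odot_compositions_continuous (B : tseries Phi 1) k l : continuous_series B ->
  continuous_toperator (ocomp B k l).
Proof.
move=> Bc; apply: toperator_sum_continuous => s _.
by apply: toperator_cast_continuous; exact: odot_seq_continuous.
Qed.

Lemma teval_odot_compositions (B : tseries Phi 1) k l w x : continuous_series B ->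
  B 0 = (fun=> 0) ->
  teval w x (ocomp B k l) = (trunc_poly k (seval B w x) ^+ l)`_k.
Proof.
move=> Bc B0; rewrite coefX_composition; last by rewrite /seval B0.
rewrite /odot_compositions teval_sum.
rewrite [RHS](reindex_omap (val : {s : l.-tuple 'I_k.+1 | is_composition s} -> _) insub) /=.
  apply: eq_big => [[s sc]|[s sc] _] /=; first by rewrite sc insubT eqxx.
  by rewrite teval_cast teval_odot_seq // big_map.
by move=> s sc; rewrite insubT.
Qed.

(** Cutting [B] off above [N] leaves the compositions of order at most [N] unchanged
    and makes the expansion in [tpow_curve] finite. *)
Definition bound_series (N : nat) (B : tseries Phi 1) : tseries Phi 1 :=
  fun k => if (k <= N)%N then B k else fun=> 0.

Lemma bound_series_continuous N B : continuous_series B -> continuous_series (bound_series N B).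
Proof.
by move=> Bc k; rewrite /bound_series; case: ifP => // _; exact: toperator0_continuous.
Qed.

Lemma seval_bound N B w x k :
  seval (bound_series N B) w x k = if (k <= N)%N then seval B w x k else 0.
Proof. by rewrite /seval /bound_series; case: ifP. Qed.

Lemma teval_bound_compositions (B : tseries Phi 1) N k l w x : continuous_series B ->
  B 0 = (fun=> 0) ->
  teval w x (ocomp (bound_series N B) k l) =
  (trunc_poly N (seval B w x) ^+ l)`_k.
Proof.
move=> Bc B0; rewrite teval_odot_compositions; first last.
- by rewrite /bound_series leq0n.
- exact: bound_series_continuous.
apply: (coefX_trunc (N := k)) => // i ik.
by rewrite !coef_trunc ik seval_bound.
Qed.

Lemma bound_compositions (B : tseries Phi 1) N k l : continuous_series B ->
  B 0 = (fun=> 0) -> (k <= N)%N ->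
  ocomp (bound_series N B) k l = ocomp B k l.
Proof.
move=> Bc B0 kN; apply: toperator_ext => [||w x].
- exact/odot_compositions_continuous/bound_series_continuous.
- exact: odot_compositions_continuous.
rewrite -/(teval w x _) -/(teval w x (ocomp B k l)).
rewrite teval_bound_compositions // teval_odot_compositions //.
apply: (coefX_trunc (N := k)) => // i ik.
by rewrite !coef_trunc ik (leq_trans ik kN).
Qed.

Lemma compositions_eq0 (B : tseries Phi 1) k l : continuous_series B ->
  B 0 = (fun=> 0) -> (k < l)%N -> ocomp B k l = 0.
Proof.
move=> Bc B0 kl; apply: toperator_ext => [||w x].
- exact: odot_compositions_continuous.
- exact: toperator0_continuous.
rewrite -/(teval w x _) teval_odot_compositions // coefX_low //.
by rewrite coef_trunc leq0n /seval B0.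
Qed.

(** The polynomial curve [t |-> B(t x)], cut off above order [N]. *)
Definition series_curve (N : nat) (B : tseries Phi 1) x (t : K) : sym_tensor Phi 1 :=
  \sum_(i < N.+1) t ^+ i *: B i (tpow x i).

Lemma pairing_curve N B x t w :
  pairing w (series_curve N B x t) = (trunc_poly N (seval B w x)).[t].
Proof.
rewrite /series_curve (lin_sum (@pairing_lin _ _ _ w)) horner_poly.
by apply: eq_bigr => i _; rewrite (linZ (@pairing_lin _ _ _ w)) -[LHS]/(_ * _) mulrC.
Qed.

Lemma tpow_curve (B : tseries Phi 1) N l x t : continuous_series B -> B 0 = (fun=> 0) ->
  tpow (series_curve N B x t) l = \sum_(k < (N * l).+1)
    t ^+ k *: ocomp (bound_series N B) k l (tpow x k).
Proof.
move=> Bc B0; apply: pairing_inj => w; rewrite pairing_tpow pairing_curve -horner_exp.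
rewrite (horner_coef_wide (n := (N * l).+1)); last first.
  apply: leq_trans (size_poly_exp_leq _ _) _; rewrite ltnS leq_mul2r orbC.
  by rewrite -subn1 leq_subLR add1n size_poly.
rewrite (lin_sum (@pairing_lin _ _ _ w)); apply: eq_bigr => k _.
rewrite (linZ (@pairing_lin _ _ _ w)) -[RHS]/(_ * _) mulrC.
by rewrite -/(teval w x _) teval_bound_compositions.
Qed.

(** The polynomial [t |-> c(y(t)^l)], where [y] is the curve [series_curve]. Its
    coefficients of order at most [N] are the values of [c] that occur in the
    substitution of [B]. *)
Definition curve_poly (N : nat) (B : tseries Phi 1) x l (c : sym_tensor Phi l -> K) : {poly K} :=
  \poly_(k < (N * l).+1) c (ocomp (bound_series N B) k l (tpow x k)).

Lemma horner_curve_poly N B x l (c : sym_tensor Phi l -> K) t :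
  continuous_series B -> B 0 = (fun=> 0) -> linear (c : _ -> K^o) ->
  (curve_poly N B x c).[t] = c (tpow (series_curve N B x t) l).
Proof.
move=> Bc B0 cl; rewrite tpow_curve // (lin_sum cl) horner_poly.
by apply: eq_bigr => k _; rewrite (linZ cl) -[RHS]/(_ * _) mulrC.
Qed.

Lemma coef_curve_poly N B x l (c : sym_tensor Phi l -> K) k :
  continuous_series B -> B 0 = (fun=> 0) -> linear (c : _ -> K^o) -> (k <= N)%N ->
  (curve_poly N B x c)`_k = c (ocomp B k l (tpow x k)).
Proof.
move=> Bc B0 cl kN; rewrite coef_poly bound_compositions //.
case: ltnP => // klN; case: l c cl klN => [|l] c cl klN.
  rewrite muln0 in klN.
  suff -> : ocomp B k 0 (tpow x k) = 0 by rewrite (lin0 cl).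
  apply: pairing_inj => w; rewrite -/(teval w x _) teval_odot_compositions // expr0.
  by rewrite coef1 gtn_eqF // (lin0 (@pairing_lin _ _ _ w)).
by have := leq_trans klN kN; rewrite mulnS -ltn_subRL subnn.
Qed.
End SeriesEvaluation.

(** * Substitution of series *)

(* The order of a coefficient of a series is written explicitly. *)
Arguments series_mul [K Phi] A1 A2 k _ : rename.
Arguments series_comp [K Phi i] C B k _ : rename.
Arguments series_exp [K Phi] C k _ : rename.
Arguments pairing_series [K Phi] w B k _ : rename.
Arguments sheffer_series [K Phi] p w k _ : rename.
Arguments generating_function [K Phi] P w k _ : rename.
Arguments one_series {K Phi} k _ : rename.
Arguments id_series {K Phi} k _ : rename.

(** Recursion for dependent families: since [step k] only reads the values below
    [k], the iterates of [step] are stationary at [k] from the round [k.+1] on. *)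
Lemma strong_recursion (T : nat -> Type) (y0 : forall k, T k)
    (step : forall k, (forall l, T l) -> T k) :
  (forall k f g, (forall l, (l < k)%N -> f l = g l) -> step k f = step k g) ->
  exists y, forall k, y k = step k y.
Proof.
move=> stepE; pose Y n : forall k, T k := iter n (fun f k => step k f) y0.
have YE n : forall m k, (k < n)%N -> (k < m)%N -> Y n k = Y m k.
  elim: n => // n IH [//|m] k; rewrite !ltnS => kn km.
  by apply: stepE => l lk; apply: IH; exact: leq_trans lk _.
exists (fun k => Y k.+1 k) => k; apply: stepE => l lk.
exact: YE.
Qed.

Section SeriesComposition.
Variables (K : numFieldType) (Phi : LBspace K).
Hypothesis extP : extends_functionals Phi.
Hypothesis archK : forall e : K, 0 < e -> exists m, 1 <= m.+1%:R * e.
Local Notation Phi' := (cdual (lb_type Phi)).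
Local Notation ocomp B k l := (@odot_compositions K Phi B k l).
Local Notation oneS := (@one_series K Phi).
Local Notation idS := (@id_series K Phi).
Implicit Types (w : Phi') (x : sym_tensor Phi 1).

Variable B : tseries Phi 1.
Arguments B : clear implicits.
Hypotheses (Bc : continuous_series B) (B0 : B 0 = (fun=> 0)).

Let occ k l : continuous_toperator (ocomp B k l).
Proof. exact: odot_compositions_continuous. Qed.

Let ocE k l w x :
  teval w x (ocomp B k l) = (trunc_poly k (seval B w x) ^+ l)`_k.
Proof. exact: teval_odot_compositions. Qed.

Lemma compositions_k0 k : ocomp B k.+1 0 = 0.
Proof.
apply: toperator_ext => // [|w x]; first exact: toperator0_continuous.
by rewrite -/(teval w x _) ocE coef1.
Qed.

Lemma compositions_00 : ocomp B 0 0 = idfun.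
Proof.
apply: toperator_ext => // [|w x]; first exact: toperator_id_continuous.
by rewrite -/(teval w x _) ocE coef1 pairing_tpow.
Qed.

Lemma toperator_comp0 k l m (A : toperator Phi l m) :
  continuous_toperator A -> (A \o (0 : toperator Phi k l)) = 0.
Proof. by move=> Ac; apply/funext => u; exact: (lin0 Ac.1). Qed.

(** One formula for all orders [k <= N]: the terms added to the defining sum
    vanish. *)
Lemma series_compE i (C : tseries Phi i) N k : continuous_series C -> (k <= N)%N ->
  series_comp C B k = \sum_(l < N.+1) (C l \o ocomp B k l).
Proof.
move=> Cc; case: k => [_|k kN].
  rewrite big_ord_recl [X in _ + X]big1 => [|l _]; first by rewrite compositions_00 addr0.
  by rewrite (compositions_eq0 extP archK) // toperator_comp0.
rewrite -(big_mkord xpredT (fun l => C l \o ocomp B k.+1 l)) /=.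
rewrite [RHS](@big_cat_nat _ _ _ k.+2) //= [X in _ + X]big1_seq => [|l].
  by rewrite addr0 [RHS]big_ltn // compositions_k0 toperator_comp0 // add0r.
rewrite /= mem_index_iota => /andP[kl _].
by rewrite (compositions_eq0 extP archK) // toperator_comp0.
Qed.

Lemma series_comp_continuous i (C : tseries Phi i) : continuous_series C ->
  continuous_series (series_comp C B).
Proof.
move=> Cc k; rewrite (@series_compE _ _ k) //.
apply: toperator_sum_continuous => l _; exact: toperator_comp_continuous.
Qed.

Lemma seval_comp i (C : tseries Phi i) N k w x : continuous_series C -> (k <= N)%N ->
  seval (series_comp C B) w x k =
  \sum_(l < N.+1) pairing w (C l (ocomp B k l (tpow x k))).
Proof.
by move=> Cc kN; rewrite /seval (series_compE Cc kN) teval_sum.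
Qed.

Section Multiplicativity.
Variables (C D : tseries Phi 0) (w : Phi') (x : sym_tensor Phi 1).
Arguments C : clear implicits.
Arguments D : clear implicits.
Hypotheses (Cc : continuous_series C) (Dc : continuous_series D).

Let coefs (N : nat) (C : tseries Phi 0) l : {poly K} :=
  curve_poly N B x (fun u => pairing w (C l u)).

Let coefs_lin (E : tseries Phi 0) l : continuous_series E ->
  linear ((fun u => pairing w (E l u)) : sym_tensor Phi l -> K^o).
Proof. by move=> Ec a u v; rewrite (Ec l).1. Qed.

Let coefs_low N E l k : continuous_series E -> (k <= N)%N -> (k < l)%N ->
  (coefs N E l)`_k = 0.
Proof.
move=> Ec kN kl; rewrite (coef_curve_poly extP archK) //; last exact: coefs_lin.
by rewrite (compositions_eq0 extP archK) // (lin0 (@coefs_lin E l Ec)).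
Qed.

Let coefs_mul N l : coefs N (series_mul C D) l =
  \sum_(a < l.+1) coefs N C a * coefs N D (l - a)%N.
Proof.
have CDc := series_mul_continuous extP archK Cc Dc.
apply: poly_ext => t; rewrite (horner_curve_poly extP archK) //; last exact: coefs_lin.
rewrite -/(teval w _ _) -/(seval _ w _ l) (seval_mul extP archK) // /conv.
rewrite horner_sum; apply: eq_bigr => a _; rewrite hornerM.
by rewrite !(horner_curve_poly extP archK) //; exact: coefs_lin.
Qed.

(** On powers of the curve [y(t)] the product of [C_a] and [D_b] takes the value
    [C_a(y(t)^a) D_b(y(t)^b)], which is [coefs_mul] as an identity of polynomials in
    [t]. The double sum over [a, b <= N] is ordered by [a + b] by reading it as a
    product in [{poly {poly K}}] evaluated at 1; the terms with [a + b > N] have no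
    coefficient of order [N]. *)
Lemma seval_comp_mul :
  seval (series_comp (series_mul C D) B) w x =
  conv (seval (series_comp C B) w x) (seval (series_comp D B) w x).
Proof.
have CDc := series_mul_continuous extP archK Cc Dc.
apply/funext => N.
have compE E k : continuous_series E -> (k <= N)%N ->
    seval (series_comp E B) w x k = (\sum_(l < N.+1) coefs N E l)`_k.
  move=> Ec kN; rewrite (seval_comp _ _ Ec kN) coef_sum; apply: eq_bigr => l _.
  by rewrite (coef_curve_poly extP archK) //; exact: coefs_lin.
rewrite compE //.
transitivity ((\sum_(l < N.+1) coefs N C l) * (\sum_(l < N.+1) coefs N D l))`_N; last first.
  rewrite coefM; apply: eq_bigr => j _; rewrite -!compE ?leq_subr //.
  by rewrite -ltnS.
(* An auxiliary variable keeps track of the index [l] of the terms. *)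
pose P (E : tseries Phi 0) : {poly {poly K}} := \poly_(l < N.+1) coefs N E l.
have P1 E : \sum_(l < N.+1) coefs N E l = (P E).[1].
  by rewrite horner_poly; apply: eq_bigr => l _; rewrite expr1n mulr1.
have PM l : (P C * P D)`_l = \sum_(a < l.+1) (P C)`_a * (P D)`_(l - a) by rewrite coefM.
rewrite !P1 -hornerM (@horner_coef_wide _ (N.+1 + N.+1) (P C * P D)); last first.
  apply: leq_trans (size_polyMleq _ _) _; rewrite -subn1 leq_subLR.
  by rewrite (leq_trans (leq_add (size_poly _ _) (size_poly _ _))) // leq_addl.
rewrite big_split_ord /= coefD [X in _ + X]coef_sum [X in _ + X]big1 ?addr0 => [|l _].
  rewrite horner_poly !coef_sum; apply: eq_bigr => l _; rewrite !expr1n !mulr1.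
  rewrite coefs_mul PM; apply: (congr1 (fun q : {poly K} => q`_N)); apply: eq_bigr => a _.
  rewrite !coef_poly (leq_ltn_trans _ (ltn_ord l)); last by rewrite -ltnS.
  by rewrite (leq_ltn_trans (leq_subr _ _) (ltn_ord l)).
(* A term of index [N.+1 + l] has coefficients of order above [N] only. *)
rewrite expr1n mulr1 PM coef_sum big1 // => a _.
rewrite coefM big1 // => j _; rewrite !coef_poly.
have jN : (j <= N)%N by rewrite -ltnS.
case: ltnP => [aN|_]; last by rewrite coef0 mul0r.
case: ltnP => [lN|_]; last by rewrite coef0 mulr0.
have [ja|aj] := ltnP j a; first by rewrite coefs_low ?mul0r.
rewrite [X in _ * X]coefs_low ?mulr0 ?leq_subr //.
rewrite ltn_subRL (@leq_ltn_trans N) //; last by rewrite addSn ltnS leq_addr.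
by apply: leq_trans (leq_add aj (leqnn _)) _; rewrite subnKC.
Qed.
End Multiplicativity.

Lemma series_comp_mul (C D : tseries Phi 0) :
  continuous_series C -> continuous_series D ->
  series_comp (series_mul C D) B = series_mul (series_comp C B) (series_comp D B).
Proof.
move=> Cc Dc.
have CDc := series_mul_continuous extP archK Cc Dc.
have [CBc DBc] := (series_comp_continuous Cc, series_comp_continuous Dc).
apply: series_ext => [||w x]; first exact: series_comp_continuous.
  exact: (series_mul_continuous extP archK).
by rewrite seval_comp_mul // (seval_mul extP archK).
Qed.

Lemma series_comp_one : series_comp oneS B = oneS.
Proof.
have oc := one_series_continuous Phi.
apply: series_ext => [||w x] //; first exact: series_comp_continuous.
apply/funext => k; rewrite (seval_comp _ _ oc (leqnn k)) big_ord_recl.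
rewrite [X in _ + X]big1 ?addr0 => [|l _]; last by [].
by rewrite -[LHS]/(teval w x (ocomp B k 0)) ocE coef1 seval_one.
Qed.

Definition series_pow (C : tseries Phi 0) n : tseries Phi 0 :=
  iter n (series_mul C) oneS.
Arguments series_pow : clear implicits.

Lemma series_pow_continuous (C : tseries Phi 0) n : continuous_series C ->
  continuous_series (series_pow C n).
Proof.
move=> Cc; elim: n => [|n IH]; first exact: one_series_continuous.
exact: (series_mul_continuous extP archK Cc IH).
Qed.

Lemma seval_pow (C : tseries Phi 0) n N k w x : continuous_series C -> (k <= N)%N ->
  seval (series_pow C n) w x k = (trunc_poly N (seval C w x) ^+ n)`_k.
Proof.
move=> Cc; elim: n k => [|n IH] k kN; first by rewrite seval_one coef1.
rewrite [series_pow _ _]/(series_mul C (series_pow C n)) (seval_mul extP archK) //.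
  rewrite (conv_coef _ _ kN) exprS; apply: (coefM_trunc (N := N)) => // i iN.
  by rewrite coef_trunc iN IH.
exact: series_pow_continuous.
Qed.

Lemma series_pow_eq0 (C : tseries Phi 0) n k : continuous_series C -> C 0%N = (fun=> 0) ->
  (k < n)%N -> series_pow C n k = 0.
Proof.
move=> Cc C0 kn; apply: toperator_ext => [||w x]; first exact: series_pow_continuous.
  exact: toperator0_continuous.
rewrite -[LHS]/(seval (series_pow C n) w x k) (seval_pow _ _ _ Cc (leqnn k)) coefX_low //.
by rewrite coef_trunc leq0n /seval C0.
Qed.

(** The powers with [n > k] vanish at order [k], so the cut-off may be chosen
    independently of [k]. *)
Lemma series_expE (C : tseries Phi 0) N k : continuous_series C -> C 0%N = (fun=> 0) ->
  (k <= N)%N ->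
  series_exp C k = \sum_(n < N.+1) (n`!%:R)^-1 *: series_pow C n k.
Proof.
move=> Cc C0 kN; rewrite /series_exp -(big_mkord xpredT (fun n => (n`!%:R)^-1 *: series_pow C n k)).
rewrite [RHS](@big_cat_nat _ _ _ k.+1) //= [X in _ = _ + X]big1_seq => [|n].
  by rewrite addr0 [RHS]big_ltn // fact0 invr1 scale1r.
rewrite /= mem_index_iota => /andP[kn _].
by rewrite series_pow_eq0 // scaler0.
Qed.

Lemma series_exp_continuous (C : tseries Phi 0) : continuous_series C ->
  C 0%N = (fun=> 0) -> continuous_series (series_exp C).
Proof.
move=> Cc C0 k; rewrite (series_expE Cc C0 (leqnn k)).
apply: toperator_sum_continuous => n _; apply: toperatorZ_continuous.
exact: series_pow_continuous.
Qed.

Lemma series_comp_pow (C : tseries Phi 0) n : continuous_series C ->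
  series_comp (series_pow C n) B = series_pow (series_comp C B) n.
Proof.
move=> Cc; elim: n => [|n IH]; first exact: series_comp_one.
rewrite [LHS](series_comp_mul Cc (series_pow_continuous n Cc)) IH //.
Qed.

Lemma series_comp_exp (C : tseries Phi 0) : continuous_series C -> C 0%N = (fun=> 0) ->
  series_comp (series_exp C) B = series_exp (series_comp C B).
Proof.
move=> Cc C0; apply: functional_extensionality_dep => k.
have expc := series_exp_continuous Cc C0.
rewrite (series_compE expc (leqnn k)) (series_expE _ _ (leqnn k)) //; last first.
  exact: series_comp_continuous.
under [RHS]eq_bigr => n _ do
  rewrite -(series_comp_pow n Cc) (series_compE (series_pow_continuous n Cc) (leqnn k)) scaler_sumr.
rewrite exchange_big; apply: eq_bigr => l _; rewrite (series_expE Cc C0 (_ : l <= k)%N) //.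
  by apply/funext => u; rewrite /= !toperator_sumE.
by rewrite -ltnS.
Qed.

Lemma pairing_series_continuous (D : tseries Phi 1) w : continuous_series D ->
  continuous_series (pairing_series w D).
Proof. by move=> Dc k; exact: pairing_toperator_continuous. Qed.

Lemma pairing_series_comp (D : tseries Phi 1) w : continuous_series D ->
  pairing_series w (series_comp D B) = series_comp (pairing_series w D) B.
Proof.
move=> Dc; have pDc := pairing_series_continuous w Dc.
apply: functional_extensionality_dep => k.
apply: toperator_ext => [||v x].
- exact/pairing_series_continuous/series_comp_continuous.
- exact: series_comp_continuous.
rewrite (series_compE pDc (leqnn k)) /pairing_series pairing_scalar.
rewrite (series_compE Dc (leqnn k)) !toperator_sumE.
by rewrite !(lin_sum (@pairing_lin _ _ _ _)).
Qed.
End SeriesComposition.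
Arguments series_pow [K Phi] C n k _.

(** * Equations between series *)

Section CoefficientExtraction.
Variable K : numFieldType.

Lemma coefX_diag (p : {poly K}) k : p`_0 = 0 -> (p ^+ k)`_k = p`_1 ^+ k.
Proof.
move=> p0; elim: k => [|k IH]; first by rewrite coef1.
rewrite exprS coefM !big_ord_recl /= p0 mul0r add0r subSS subn0 IH exprS.
rewrite big1 ?addr0 // => i _; rewrite /bump /= !add1n subSS coefX_low ?mulr0 //.
by rewrite ltn_subrL /= (leq_ltn_trans _ (ltn_ord i)).
Qed.

Lemma coefX_linear (c : K) l k : ((c *: 'X) ^+ l)`_k = c ^+ l * (k == l)%:R.
Proof. by rewrite exprZn coefZ coefXn. Qed.
End CoefficientExtraction.

Section SeriesGroups.
Variables (K : numFieldType) (Phi : LBspace K).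
Hypothesis extP : extends_functionals Phi.
Hypothesis archK : forall e : K, 0 < e -> exists m, 1 <= m.+1%:R * e.
Local Notation Phi' := (cdual (lb_type Phi)).
Local Notation ocomp B k l := (@odot_compositions K Phi B k l).
Local Notation oneS := (@one_series K Phi).
Local Notation idS := (@id_series K Phi).
Implicit Types (w : Phi') (x : sym_tensor Phi 1).

Lemma F0_continuous (A : tseries Phi 0) : F0 A -> continuous_series A.
Proof. by case. Qed.

Lemma F1_continuous (B : tseries Phi 1) : F1 B -> continuous_series B.
Proof. by case. Qed.

Lemma F1_0 (B : tseries Phi 1) : F1 B -> B 0%N = (fun=> 0).
Proof. by case. Qed.

Lemma F1_1 (B : tseries Phi 1) : F1 B -> B 1%N = idfun.
Proof. by case. Qed.

Lemma F0_seval0 (A : tseries Phi 0) w x : F0 A -> seval A w x 0 = 1.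
Proof. by case=> _ A0; rewrite /seval A0; exact: (pairing_tpow w x 0). Qed.

Lemma F0_one : F0 oneS.
Proof. by split => //; exact: one_series_continuous. Qed.

Lemma F1_id : F1 idS.
Proof. by split => //; exact: id_series_continuous. Qed.

Lemma F0_mul (A A' : tseries Phi 0) : F0 A -> F0 A' -> F0 (series_mul A A').
Proof.
move=> FA FA'; have [Ac A'c] := (F0_continuous FA, F0_continuous FA').
have AA'c := series_mul_continuous extP archK Ac A'c.
split => //; apply: toperator_ext => [||w x]; first exact: AA'c.
  exact: toperator_id_continuous.
rewrite -[LHS]/(seval (series_mul A A') w x 0) (seval_mul extP archK) // /conv.
rewrite big_ord1 subn0 !F0_seval0 // mulr1; exact/esym/(pairing_tpow w x 0).
Qed.

Lemma compositions_diag (B : tseries Phi 1) k : F1 B -> ocomp B k k = idfun.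
Proof.
move=> FB; have [Bc B0] := (F1_continuous FB, F1_0 FB).
apply: toperator_ext => [||w x].
- exact: (odot_compositions_continuous extP archK).
- exact: toperator_id_continuous.
rewrite -[LHS]/(teval w x (ocomp B k k)) (teval_odot_compositions extP archK) //.
rewrite coefX_diag; last by rewrite coef_trunc leq0n /seval B0.
rewrite pairing_tpow coef_trunc; case: k => // k.
by rewrite /= /seval (F1_1 FB) /teval (pairing_tpow w x 1).
Qed.

Lemma F0_comp (A : tseries Phi 0) B : F0 A -> F1 B -> F0 (series_comp A B).
Proof.
move=> FA FB; split; last by case: FA.
by apply: (series_comp_continuous extP archK (F1_continuous FB) (F1_0 FB)); case: FA.
Qed.

Lemma series_comp_coef1 (C B : tseries Phi 1) : F1 B -> series_comp C B 1 = C 1%N.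
Proof. by move=> FB; rewrite /series_comp /= big_nat1 compositions_diag. Qed.

Lemma F1_comp (C B : tseries Phi 1) : F1 C -> F1 B -> F1 (series_comp C B).
Proof.
move=> [Cc C0 C1] FB; split => //; last by rewrite series_comp_coef1.
exact: (series_comp_continuous extP archK (F1_continuous FB) (F1_0 FB)).
Qed.

Lemma series_comp_idr i (C : tseries Phi i) : continuous_series C -> series_comp C idS = C.
Proof.
move=> Cc; have [idc id0] := (F1_continuous F1_id, F1_0 F1_id).
apply: functional_extensionality_dep => k.
rewrite (series_compE extP archK idc id0 Cc (leqnn k)) (bigD1 ord_max) //=.
rewrite (compositions_diag _ F1_id) big1 ?addr0 // => l lk.
suff -> : ocomp idS k l = 0 by exact: (toperator_comp0 _ (Cc l)).
apply: toperator_ext => [||w x]; first exact: (odot_compositions_continuous extP archK).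
  exact: toperator0_continuous.
rewrite -[LHS]/(teval w x (ocomp idS k l)) (teval_odot_compositions extP archK) //.
rewrite (coefX_trunc (N := k) (p' := pairing w x *: 'X)) //.
  by rewrite coefX_linear; case: eqP => [kl|_]; rewrite ?mulr0 //; case/eqP: lk; exact: val_inj.
by move=> j jk; rewrite coef_trunc jk seval_id coefZ coefX mulrC.
Qed.

Lemma series_comp_idl (B : tseries Phi 1) : F1 B -> series_comp idS B = B.
Proof.
move=> FB; have [Bc B0] := (F1_continuous FB, F1_0 FB).
have idc := F1_continuous F1_id.
apply: functional_extensionality_dep => k.
rewrite (series_compE extP archK Bc B0 idc (leqnSn k)) !big_ord_recl /= big1 => [|l _].
  rewrite addr0 [X in X + _](_ : _ = 0) // add0r.
  apply: toperator_ext => [||w x] //.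
    exact: (odot_compositions_continuous extP archK).
  rewrite -[LHS]/(teval w x (ocomp B k 1)) (teval_odot_compositions extP archK) // expr1.
  by rewrite coef_trunc leqnn.
by [].
Qed.

(** The only composition of [k] into [k] parts contributes the identity, so the
    equation of order [k] expresses [Y k] through [X k] and the lower [Y l]. *)
Lemma series_comp_solve i (X : tseries Phi i) B : continuous_series X -> F1 B ->
  exists2 Y : tseries Phi i, continuous_series Y & series_comp Y B = X.
Proof.
move=> Xc FB; have [Bc B0] := (F1_continuous FB, F1_0 FB).
have occ k l := odot_compositions_continuous extP archK k l Bc.
have [|Y YE] := @strong_recursion (fun k => toperator Phi k i) X
  (fun k f => X k - \sum_(l < k) (f l \o ocomp B k l)).
  by move=> k f g fg; congr (_ - _); apply: eq_bigr => l _; rewrite fg.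
have Yc : continuous_series Y.
  move=> k; elim/ltn_ind: k => k IH; rewrite YE addrC -scaleN1r.
  apply: toperator_comb_continuous => //; apply: toperator_sum_continuous => l _.
  exact: toperator_comp_continuous (IH _ (ltn_ord l)) (occ _ _).
exists Y => //; apply: functional_extensionality_dep => k.
rewrite (series_compE extP archK Bc B0 Yc (leqnn k)) big_ord_recr /=.
by rewrite (compositions_diag _ FB) [X in _ + X]YE addrC subrK.
Qed.

(** As [A] has constant term 1, the equation of order [k] expresses the coefficient
    of order [k] of the inverse through the lower ones. *)
Lemma F0_inverse (A : tseries Phi 0) : F0 A ->
  exists2 A', F0 A' & series_mul A' A = oneS.
Proof.
move=> FA; have Ac := F0_continuous FA.
pose term k (f : forall l, toperator Phi l 0) (l : 'I_k) : toperator Phi k 0 :=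
  toperator_cast (subnKC (ltnW (ltn_ord l))) (erefl 0%N) (odot (f l) (A (k - l)%N)).
have [|Y YE] := @strong_recursion (fun k => toperator Phi k 0) (fun _ _ => 0)
  (fun k f => oneS k - \sum_(l < k) term k f l).
  by move=> k f g fg; congr (_ - _); apply: eq_bigr => l _; rewrite /term fg.
have termc k (l : 'I_k) : continuous_toperator (Y l) -> continuous_toperator (term k Y l).
  by move=> Yl; apply: toperator_cast_continuous; exact: (odot_continuous extP archK Yl (Ac _)).
have Yc : continuous_series Y.
  move=> k; elim/ltn_ind: k => k IH; rewrite YE addrC -scaleN1r.
  apply: toperator_comb_continuous; last exact: one_series_continuous.
  by apply: toperator_sum_continuous => l _; apply: termc; exact: IH.
exists Y; first by split => //; rewrite YE big_ord0 subr0.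
apply: series_ext => [||w x].
- exact: (series_mul_continuous extP archK).
- exact: one_series_continuous.
rewrite (seval_mul extP archK) //; apply/funext => k.
rewrite /conv big_ord_recr /= subnn (F0_seval0 _ _ FA) mulr1.
rewrite [X in _ + X](_ : _ = seval oneS w x k - \sum_(l < k) teval w x (term k Y l)).
  rewrite addrC (_ : \sum_(l < k) teval w x (term k Y l) =
    \sum_(l < k) seval Y w x l * seval A w x (k - l)%N) ?subrK //.
  apply: eq_bigr => l _; rewrite /term teval_cast.
  exact: (teval_odot extP archK w x (Yc l) (Ac _)).
by rewrite /seval YE -teval_sum.
Qed.
End SeriesGroups.

(** * Triangular operators on polynomials *)

Section Operators.
Variables (K : numFieldType) (Phi : LBspace K).
Local Notation Phi' := (cdual (lb_type Phi)).
Local Notation poly := (dual_poly Phi).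
Local Notation mono k := (@monomial K Phi k).
Implicit Types (w : Phi').

Lemma dual_poly_ext (p q : poly) : (forall w, p w = q w) -> p = q.
Proof. by move=> pq; apply: val_inj; apply/funext. Qed.

Lemma dual_eval_lin w : linear (fun p : poly => (p w : K^o)).
Proof. by []. Qed.

Lemma monomial_lin k : linear (mono k).
Proof. by move=> a x y; exact: dual_poly_ext. Qed.

Definition dual_nbhs k (V : set poly) : Prop := nbhs (mono k @ (0 : sym_tensor Phi k)) V.

Lemma dual_nbhsE (p : poly) : nbhs p = translated_nbhs (inductive_nbhs0 dual_nbhs) p.
Proof. by []. Qed.

Lemma sym_tensor_nbhs_0E k (U : set (sym_tensor Phi k)) : nbhs (0 : sym_tensor Phi k) U <->
  exists W, [/\ abs_convex W, W `<=` U & forall n, sym_tensor_nbhs n W].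
Proof.
rewrite sym_tensor_nbhsE; split=> -[W [cW WU NW]]; exists W; split => // y /WU /=;
  by rewrite add0r.
Qed.

Lemma dual_nbhsP k V : abs_convex V ->
  dual_nbhs k V <-> forall n, sym_tensor_nbhs n (mono k @^-1` V).
Proof.
move=> cV; rewrite /dual_nbhs nbhs_simpl /= sym_tensor_nbhs_0E; split.
  by move=> [W [_ WV NW]] n; exact: sym_tensor_nbhs_up (NW n).
by move=> NV; exists (mono k @^-1` V); split => //; exact: (abs_convex_preimage (@monomial_lin k)).
Qed.

Lemma dual_nbhs_up k V W : V `<=` W -> dual_nbhs k V -> dual_nbhs k W.
Proof.
move=> VW; rewrite /dual_nbhs !nbhs_simpl /= !sym_tensor_nbhs_0E => -[U [cU UV NU]].
by exists U; split => // y /UV /VW.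
Qed.

Lemma dual_nbhsZ k c V : abs_convex V -> dual_nbhs k V -> dual_nbhs k [set y | V (c *: y)].
Proof.
move=> cV /(dual_nbhsP _ cV) NV; apply/dual_nbhsP.
  move=> b d x y /= Vx Vy bd; rewrite scalerDr !scalerA ![c * _]mulrC -!scalerA.
  exact: cV.
move=> n; apply: sym_tensor_nbhs_up (sym_tensor_nbhsZ c (NV n)) => u /=.
by rewrite (linZ (@monomial_lin k)).
Qed.

Lemma monomial_lin_cont k : @lin_cont K (sym_tensor Phi k) poly (mono k).
Proof.
apply/(lin_cont_inductive (@sym_tensor_nbhsE _ _ k) dual_nbhsE (@sym_tensor_nbhs_up _ _ k)).
split=> [|V cV NV]; first exact: monomial_lin.
exact/dual_nbhsP.
Qed.

Lemma monomial_sum_lin_cont k n (A : forall i, toperator Phi k i) :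
  (forall i, (i < n)%N -> continuous_toperator (A i)) ->
  @lin_cont K (sym_tensor Phi k) poly (fun f => \sum_(i < n) mono i (A i f)).
Proof.
elim: n => [|n IH] Ac.
  have -> : (fun f => \sum_(i < 0) mono i (A i f)) = (fun _ => 0).
    by apply/funext => f; rewrite big_ord0.
  apply: (lin_cont_cst0 (@sym_tensor_nbhsE _ _ k) dual_nbhsE (@sym_tensor_nbhs_up _ _ k)
    (@sym_tensor_nbhsT _ _ k) 0%N).
  move=> j V; rewrite /dual_nbhs nbhs_simpl /= sym_tensor_nbhs_0E => -[W [_ WV NW]].
  by have := WV _ (sym_tensor_nbhs0 (NW 0%N)); rewrite /= (lin0 (@monomial_lin j)).
have -> : (fun f => \sum_(i < n.+1) mono i (A i f)) =
    (fun f => 1 *: (\sum_(i < n) mono i (A i f)) + mono n (A n f)).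
  by apply/funext => f; rewrite scale1r big_ord_recr.
apply: (lin_cont_comb (@sym_tensor_nbhsE _ _ k) dual_nbhsE (@sym_tensor_nbhs_up _ _ k)
  (@sym_tensor_nbhsI _ _ k) dual_nbhsZ); first by apply: IH => i ni; apply/Ac/ltnW.
apply: lin_cont_comp; first exact: monomial_lin_cont.
exact: Ac.
Qed.

Lemma dual_polyP (p : poly) : exists (d : nat) (f : forall k, sym_tensor Phi k),
  (forall k, (d <= k)%N -> f k = 0) /\ p = \sum_(k < d) mono k (f k).
Proof.
case: p => p /= pP; have /set_mem [d [f pE]] := pP.
exists d.+1, (fun k => if (k < d.+1)%N then f k else 0); split=> [k dk|].
  by rewrite ltnNge dk.
apply: dual_poly_ext => w; rewrite /= pE (lin_sum (@dual_eval_lin w)).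
by apply: eq_bigr => k _; rewrite ltn_ord.
Qed.

Lemma monomial_sum_widen d D (f : forall k, sym_tensor Phi k) : (d <= D)%N ->
  (forall k, (d <= k)%N -> f k = 0) ->
  \sum_(k < d) mono k (f k) = \sum_(k < D) mono k (f k).
Proof.
move=> dD f0; rewrite (big_ord_widen _ (fun k => mono k (f k)) dD) big_mkcond.
apply: eq_bigr => k _; case: ltnP => // dk.
by rewrite f0 // (lin0 (@monomial_lin k)).
Qed.

Lemma pairing_scale k (u : sym_tensor Phi k) t w w' : (forall z, w' z = t * w z) ->
  pairing w' u = t ^+ k * pairing w u.
Proof.
move=> ww'; have [n [v [/sym_tensor_inj_power Tv uv]]] := sym_tensorP u.
rewrite /pairing uv /form_push.
have := @eval_comb_eq _ (lb_step Phi n) k 'I_1 'I_1 (fun=> 1) (fun _ _ => cdual_restrict n w')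
  (fun=> t ^+ k) (fun _ _ => cdual_restrict n w) _ v Tv.
rewrite !big_ord1 mul1r; apply => x; rewrite !big_ord1 mul1r /elem_tensor.
under eq_bigr do rewrite cdual_restrictE ww'.
by rewrite big_split prodr_const card_ord.
Qed.

(** Replacing [w] by [t w] turns the sum into a polynomial in [t] whose coefficients
    are the homogeneous components. *)
Lemma monomial_sum_eq0 D (f : forall k, sym_tensor Phi k) :
  \sum_(k < D) mono k (f k) = 0 -> forall k, (k < D)%N -> f k = 0.
Proof.
move=> f0 k kD; apply: pairing_inj => w; rewrite (lin0 (@pairing_lin _ _ _ w)).
have : \poly_(j < D) pairing w (f j) = 0.
  apply: poly_ext => t; rewrite horner0 horner_poly.
  have [w' w'E] := cdual_comb (fun _ : 'I_1 => t) (fun=> w).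
  have {}w'E z : w' z = t * w z by rewrite w'E big_ord1.
  have := congr1 (fun p : poly => p w') f0; rewrite (lin_sum (@dual_eval_lin w')).
  move=> E; apply: etrans E; apply: eq_bigr => j _.
  by rewrite /= (pairing_scale _ w'E) mulrC.
by move/(congr1 (fun p : {poly K} => p`_k)); rewrite coef_poly kD coef0.
Qed.

Lemma monomial_sum_inj D (f g : forall k, sym_tensor Phi k) :
  \sum_(k < D) mono k (f k) = \sum_(k < D) mono k (g k) ->
  forall k, (k < D)%N -> f k = g k.
Proof.
move=> fg k kD; apply/eqP; rewrite -subr_eq0; apply/eqP.
apply: (@monomial_sum_eq0 D (fun k => f k - g k)) => //.
have -> : \sum_(k < D) mono k (f k - g k) =
    \sum_(k < D) mono k (f k) - \sum_(k < D) mono k (g k).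
  by rewrite -sumrB; apply: eq_bigr => j _; rewrite (linB (@monomial_lin j)).
by rewrite fg subrr.
Qed.

Lemma monomial_determines (P Q : poly -> poly) : linear P -> linear Q ->
  (forall k (f : sym_tensor Phi k), P (monomial f) = Q (monomial f)) -> P = Q.
Proof.
move=> Pl Ql PQ; apply/funext => p; have [d [f [_ ->]]] := dual_polyP p.
by rewrite (lin_sum Pl) (lin_sum Ql); apply: eq_bigr => k _; exact: PQ.
Qed.

(** The operator acts on the homogeneous components of a polynomial, which are
    unique by [monomial_sum_inj]; its continuity is tested on each of them. *)
Lemma matrix_operator (P_ : forall i k, toperator Phi k i) :
  (forall i k, (i <= k)%N -> continuous_toperator (P_ i k)) ->
  exists P : poly -> poly, @lin_cont K poly poly P /\
    forall k (f : sym_tensor Phi k), P (monomial f) = \sum_(i < k.+1) mono i (P_ i k f).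
Proof.
move=> Pc; pose Q k f : poly := \sum_(i < k.+1) mono i (P_ i k f).
have Qc k : @lin_cont K (sym_tensor Phi k) poly (Q k).
  by apply: (@monomial_sum_lin_cont k k.+1 (fun i => P_ i k)) => i; rewrite ltnS; exact: Pc.
have Q0 k : Q k 0 = 0 by exact: (lin0 (Qc k).1).
have /choice [c cP] : forall p : poly, exists c : (nat * (forall k, sym_tensor Phi k))%type,
    (forall k, (c.1 <= k)%N -> c.2 k = 0) /\ p = \sum_(k < c.1) mono k (c.2 k).
  by move=> p; have [d [f fP]] := dual_polyP p; exists (d, f).
pose P p := \sum_(k < (c p).1) Q k ((c p).2 k).
have PE p D (f : forall k, sym_tensor Phi k) :
    (forall k, (D <= k)%N -> f k = 0) -> p = \sum_(k < D) mono k (f k) ->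
    P p = \sum_(k < D) Q k (f k).
  move=> fD pf; have [cD pc] := cP p.
  pose N := maxn (c p).1 D.
  have fc k : (k < N)%N -> (c p).2 k = f k.
    apply: monomial_sum_inj; rewrite -(monomial_sum_widen _ cD) ?leq_maxl //.
    by rewrite -(monomial_sum_widen _ fD) ?leq_maxr // -pf.
  have wid d (g : forall k, sym_tensor Phi k) : (d <= N)%N -> (forall k, (d <= k)%N -> g k = 0) ->
      \sum_(k < d) Q k (g k) = \sum_(k < N) Q k (g k).
    move=> dN g0; rewrite (big_ord_widen _ (fun k => Q k (g k)) dN) big_mkcond.
    by apply: eq_bigr => k _; case: ltnP => // dk; rewrite g0.
  rewrite /P (wid _ _ (leq_maxl _ _) cD) (wid _ _ (leq_maxr _ _) fD).
  by apply: eq_bigr => k _; rewrite fc.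
have Pl : linear P.
  move=> a p q; have [cp pE] := cP p; have [cq qE] := cP q.
  pose N := maxn (c p).1 (c q).1.
  have pN := PE p N (c p).2; have qN := PE q N (c q).2.
  rewrite (PE (a *: p + q) N (fun k => a *: (c p).2 k + (c q).2 k)).
  - rewrite pN ?qN; first last.
    + by rewrite {1}pE; apply: monomial_sum_widen; rewrite ?leq_maxl.
    + by move=> k Nk; apply: cp; rewrite (leq_trans _ Nk) ?leq_maxl.
    + by rewrite {1}qE; apply: monomial_sum_widen; rewrite ?leq_maxr.
    + by move=> k Nk; apply: cq; rewrite (leq_trans _ Nk) ?leq_maxr.
    rewrite scaler_sumr -big_split; apply: eq_bigr => k _; exact: (Qc k).1.
  - move=> k; rewrite geq_max => /andP[pk qk]; by rewrite cp ?cq // scaler0 addr0.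
  - rewrite {1}pE {1}qE (monomial_sum_widen (leq_maxl _ (c q).1) cp).
    rewrite (monomial_sum_widen (leq_maxr (c p).1 _) cq) scaler_sumr -big_split.
    by apply: eq_bigr => k _; rewrite (@monomial_lin k).
have Pm k (f : sym_tensor Phi k) : P (monomial f) = Q k f.
  pose g := dfwith (T := fun k => sym_tensor Phi k) (fun=> 0) f.
  have g0 j : j != k -> g j = 0 by move=> jk; rewrite /g dfwith_out // eq_sym.
  have gk : g k = f by rewrite /g dfwith_in.
  rewrite (PE _ k.+1 g) => [|j kj|]; last 2 first.
  - by rewrite g0 // gtn_eqF.
  - rewrite big_ord_recr /= gk big1 ?add0r // => j _.
    by rewrite g0 ?(lin0 (@monomial_lin j)) // ltn_eqF.
  by rewrite big_ord_recr /= gk big1 ?add0r // => j _; rewrite g0 ?Q0 // ltn_eqF.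
exists P; split => //.
apply/(lin_cont_inductive dual_nbhsE dual_nbhsE dual_nbhs_up); split => // V cV NV k.
apply/dual_nbhsP => [|n]; first exact: (abs_convex_preimage Pl).
have [_ Qn] := (lin_cont_inductive (@sym_tensor_nbhsE _ _ k) dual_nbhsE
  (@sym_tensor_nbhs_up _ _ k) (Q k)).1 (Qc k).
by apply: sym_tensor_nbhs_up (Qn V cV NV n) => u /=; rewrite Pm.
Qed.

(** The entries with [i > k] are set to 0, so that columns can be summed up to any
    [N >= k]. *)
Definition matrix_of (P_ : forall i k, toperator Phi k i) (P : poly -> poly) : Prop :=
  [/\ forall i k, continuous_toperator (P_ i k), forall k, P_ k k = idfun,
      forall i k, (k < i)%N -> P_ i k = 0 &
      forall k N (f : sym_tensor Phi k), (k <= N)%N ->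
        P (monomial f) = \sum_(i < N.+1) mono i (P_ i k f)].

Lemma triangularP (P : poly -> poly) : @triangular_operators K Phi P <->
  @lin_cont K poly poly P /\ exists P_, matrix_of P_ P.
Proof.
split=> -[Pc [P_ PP]]; split => //; last first.
  case: PP => [Pcont P1 P0 PE]; exists P_; split => // k f w.
  by rewrite (PE k k) // (lin_sum (@dual_eval_lin w)).
case: PP => [Pcont P1 PE].
exists (fun i k => if (i <= k)%N then P_ i k else 0); split => [i k|k|i k ki|k N f kN].
- by case: ifPn => [|_]; [exact: Pcont|exact: toperator0_continuous].
- by rewrite leqnn.
- by rewrite leqNgt ki.
apply: dual_poly_ext => w; rewrite PE (lin_sum (@dual_eval_lin w)).
rewrite (big_ord_widen _ (fun i => pairing w (P_ i k f)) (_ : k.+1 <= N.+1)%N) // big_mkcond.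
apply: eq_bigr => i _; rewrite ltnS; by case: ifP.
Qed.

Lemma triangular_comp (P Q : poly -> poly) :
  @triangular_operators K Phi P -> @triangular_operators K Phi Q ->
  @triangular_operators K Phi (P \o Q).
Proof.
move=> /triangularP[Pc [P_ [Pcont P1 P0 PE]]] /triangularP[Qc [Q_ [Qcont Q1 Q0 QE]]].
apply/triangularP; split; first exact: lin_cont_comp.
exists (fun i k => \sum_(j < k.+1) (P_ i j \o Q_ j k)); split => [i k|k|i k ki|k N f kN].
- by apply: toperator_sum_continuous => j _; exact: toperator_comp_continuous.
- rewrite big_ord_recr /= P1 Q1 big1 ?add0r // => j _.
  by rewrite P0.
- apply: big1 => j _; rewrite P0 // (leq_ltn_trans _ ki) // -ltnS //.
rewrite /= (QE k k f) // (lin_sum Pc.1).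
transitivity (\sum_(j < k.+1) \sum_(i < N.+1) mono i (P_ i j (Q_ j k f))).
  apply: eq_bigr => j _; apply: PE; apply: leq_trans kN; by rewrite -ltnS.
rewrite exchange_big; apply: eq_bigr => i _.
by rewrite toperator_sumE (lin_sum (@monomial_lin i)).
Qed.

Lemma triangular_id : @triangular_operators K Phi idfun.
Proof.
split; first by split=> [a x y|x U].
exists (fun i k => if k =P i is ReflectT e then sym_cast e else 0); split.
- move=> i k _; case: (k =P i) => [e|_]; last exact: toperator0_continuous.
  by case: i / e; exact: toperator_id_continuous.
- by move=> k; case: (k =P k) => // e; rewrite (eq_axiomK e).
move=> k f w; rewrite big_ord_recr /= big1 ?add0r => [|i _].
  by case: (k =P k) => // e; rewrite (eq_axiomK e).
case: (k =P i) => [e|_]; last by rewrite (lin0 (@pairing_lin _ _ _ w)).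
by have := ltn_ord i; rewrite -[X in (X < _)%N]e ltnn.
Qed.

(** The entries [Q i k] of the inverse satisfy [Q i k + \sum_(j < k) Q i j P j k = D i k]
    with [D] the entries of the identity, which is a recursion on [k]. *)
Lemma triangular_left_inverse (P : poly -> poly) : @triangular_operators K Phi P ->
  exists2 Q, @triangular_operators K Phi Q & Q \o P = idfun.
Proof.
move=> /triangularP[Pc [P_ [Pcont P1 P0 PE]]].
have /triangularP[_ [D [Dcont D1 D0 DE]]] := triangular_id.
have Qex i : exists Q : forall k, toperator Phi k i,
    forall k, Q k = D i k - \sum_(j < k) (Q j \o P_ j k).
  have [|Q QE] := @strong_recursion (fun k => toperator Phi k i) (D i)
    (fun k f => D i k - \sum_(j < k) (f j \o P_ j k)); last by exists Q.
  by move=> k f g fg; congr (_ - _); apply: eq_bigr => l _; rewrite fg.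
pose Q_ i := projT1 (cid (Qex i)).
have QE i k : Q_ i k = D i k - \sum_(j < k) (Q_ i j \o P_ j k).
  exact: (projT2 (cid (Qex i))).
have Qcont i k : continuous_toperator (Q_ i k).
  elim/ltn_ind: k => k IH; rewrite QE addrC -scaleN1r.
  apply: toperator_comb_continuous => //; apply: toperator_sum_continuous => j _.
  by apply: toperator_comp_continuous; [exact: IH|exact: Pcont].
have Q0 i k : (k < i)%N -> Q_ i k = 0.
  elim/ltn_ind: k => k IH ki; rewrite QE D0 // big1 ?subr0 // => j _.
  by rewrite IH // (ltn_trans (ltn_ord j)).
have Q1 k : Q_ k k = idfun.
  rewrite QE D1 big1 ?subr0 // => j _; by rewrite Q0.
have [Q [Qc Qm]] := matrix_operator (fun i k _ => Qcont i k).
have Qtri : matrix_of Q_ Q.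
  split => // k N f kN; rewrite Qm.
  rewrite (big_ord_widen _ (fun i => mono i (Q_ i k f)) (_ : k.+1 <= N.+1)%N) // big_mkcond.
  apply: eq_bigr => i _; case: ltnP => // ki.
  by rewrite Q0 // (lin0 (@monomial_lin i)).
exists Q; first by apply/triangularP; split => //; exists Q_.
have [_ _ _ QE'] := Qtri.
apply: monomial_determines => [||k f].
- exact: (lin_cont_comp Qc Pc).1.
- by move=> a x y.
rewrite /= (PE k k) // (lin_sum Qc.1).
transitivity (\sum_(j < k.+1) \sum_(i < k.+1) mono i (Q_ i j (P_ j k f))).
  by apply: eq_bigr => j _; apply: QE'; rewrite -ltnS.
rewrite exchange_big [RHS](DE k k) //; apply: eq_bigr => i _.
rewrite -(lin_sum (@monomial_lin i)); congr (monomial _).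
rewrite big_ord_recr /= P1 [X in _ + X](congr1 (fun A => A f) (QE i k)).
rewrite -[X in _ + X]/(D i k f - (\sum_(j < k) (Q_ i j \o P_ j k)) f).
by rewrite toperator_sumE addrC subrK.
Qed.
End Operators.

(** * Sheffer operators *)

Section Sheffer.
Variables (K : numFieldType) (Phi : LBspace K).
Hypothesis extP : extends_functionals Phi.
Hypothesis archK : forall e : K, 0 < e -> exists m, 1 <= m.+1%:R * e.
Local Notation Phi' := (cdual (lb_type Phi)).
Local Notation poly := (dual_poly Phi).
Local Notation mono k := (@monomial K Phi k).
Local Notation ocomp B k l := (@odot_compositions K Phi B k l).
Local Notation oneS := (@one_series K Phi).
Local Notation idS := (@id_series K Phi).
Local Notation pair := (tseries Phi 0 * tseries Phi 1)%type.
Implicit Types (w : Phi') (x : sym_tensor Phi 1) (p q : pair).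

Lemma fact_neq0 n : n`!%:R != 0 :> K.
Proof. by rewrite pnatr_eq0 -lt0n fact_gt0. Qed.

(** Up to the factor [k!], the part of order [k] in [xi] and of degree [n] in [w] of
    [exp <w, B(xi)> A(xi)]. *)
Definition sheffer_matrix p n k : toperator Phi k n :=
  (k`!%:R / n`!%:R) *: \sum_(l < k.+1)
    toperator_cast (subnKC (leq_ord l)) (addn0 n)
      (odot (ocomp p.2 l n) (p.1 (k - l)%N)).
Arguments sheffer_matrix : clear implicits.

Lemma sheffer_matrix_continuous p n k : sheffer_group p ->
  continuous_toperator (sheffer_matrix p n k).
Proof.
case=> [FA FB]; apply: toperatorZ_continuous; apply: toperator_sum_continuous => l _.
apply: toperator_cast_continuous.
apply: (odot_continuous extP archK); last exact: (F0_continuous FA).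
exact: (odot_compositions_continuous extP archK _ _ (F1_continuous FB)).
Qed.

Lemma teval_sheffer_matrix p n k w x : sheffer_group p ->
  teval w x (sheffer_matrix p n k) = k`!%:R / n`!%:R *
    \sum_(l < k.+1) (trunc_poly k (seval p.2 w x) ^+ n)`_l * seval p.1 w x (k - l)%N.
Proof.
case=> [FA FB]; have [Bc B0] := (F1_continuous FB, F1_0 FB).
rewrite tevalZ teval_sum; congr (_ * _); apply: eq_bigr => l _.
rewrite teval_cast (teval_odot extP archK) //; last 2 first.
- exact: (odot_compositions_continuous extP archK).
- exact: (F0_continuous FA).
rewrite (teval_odot_compositions extP archK) //; congr (_ * _).
apply: (coefX_trunc (N := l)) => // i il.
by rewrite !coef_trunc il (leq_trans il) // -ltnS.
Qed.

Lemma seval_pairing w B v x : seval (pairing_series w B) v x = seval B w x.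
Proof. by []. Qed.

Lemma seval_scalar (A : tseries Phi 0) v w x : seval A v x = seval A w x.
Proof.
by apply/funext => k; rewrite /seval /teval -(sym_tensor0_const _ v (fun=> w)).
Qed.

Lemma F1_pairing0 w B : F1 B -> pairing_series w B 0%N = (fun=> 0).
Proof.
move=> FB; apply/funext => u; apply: sym_tensor_ext => f.
by rewrite /= /pairing_series (F1_0 FB).
Qed.

Lemma sheffer_series_continuous p w : sheffer_group p -> continuous_series (sheffer_series p w).
Proof.
case=> [FA FB]; apply: (series_mul_continuous extP archK); last exact: (F0_continuous FA).
apply: (series_exp_continuous extP archK); last exact: F1_pairing0.
exact: pairing_series_continuous (F1_continuous FB).
Qed.

Lemma sheffer_series_matrix p w k : sheffer_group p ->
  sheffer_series p w k = (k`!%:R)^-1 *: (\sum_(n < k.+1)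
    (fun f => scalar_tensor Phi (pairing w (sheffer_matrix p n k f)) : sym_tensor Phi 0)).
Proof.
move=> Gp; have [FA FB] := Gp.
have pc := pairing_series_continuous w (F1_continuous FB).
have p0 := F1_pairing0 w FB.
apply: toperator_ext => [||v x]; first exact: sheffer_series_continuous.
  apply: toperatorZ_continuous; apply: toperator_sum_continuous => n _.
  exact/pairing_toperator_continuous/sheffer_matrix_continuous.
rewrite -[LHS]/(seval (sheffer_series p w) v x k) -[RHS]/(teval v x _).
rewrite tevalZ teval_sum (seval_mul extP archK) //; last 2 first.
- exact: (series_exp_continuous extP archK).
- exact: (F0_continuous FA).
transitivity (k`!%:R^-1 * \sum_(n < k.+1) teval w x (sheffer_matrix p n k)); last first.
  by congr (_ * _); apply: eq_bigr => n _.
under eq_bigr do rewrite teval_sheffer_matrix //.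
rewrite mulr_sumr; under [RHS]eq_bigr do rewrite !mulrA mulVf ?fact_neq0 // mul1r mulr_sumr.
rewrite exchange_big /conv; apply: eq_bigr => l _.
have lk : (l <= k)%N by rewrite -ltnS.
rewrite [seval p.1 v x](seval_scalar _ _ w).
have -> : seval (series_exp (pairing_series w p.2)) v x l =
    \sum_(n < k.+1) (n`!%:R)^-1 * (trunc_poly k (seval p.2 w x) ^+ n)`_l.
  rewrite /seval (series_expE extP archK pc p0 lk) teval_sum.
  apply: eq_bigr => n _; rewrite tevalZ; congr (_ * _).
  exact: (seval_pow extP archK n v x pc lk).
by rewrite mulr_suml; apply: eq_bigr => n _; rewrite mulrA.
Qed.

Lemma sheffer_matrix_diag p k : sheffer_group p -> sheffer_matrix p k k = idfun.
Proof.
move=> Gp; have [FA FB] := Gp; apply: toperator_ext => [||w x].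
- exact: sheffer_matrix_continuous.
- exact: toperator_id_continuous.
rewrite -[LHS]/(teval w x (sheffer_matrix p k k)) teval_sheffer_matrix // divff ?fact_neq0 // mul1r.
have b0 : (trunc_poly k (seval p.2 w x))`_0 = 0 by rewrite coef_trunc leq0n /seval (F1_0 FB).
rewrite big_ord_recr /= big1 ?add0r => [|l _]; last by rewrite coefX_low ?mul0r.
rewrite subnn (F0_seval0 _ _ FA) mulr1 coefX_diag //.
rewrite -[RHS]/(pairing w (tpow x k)) pairing_tpow coef_trunc.
case: k {b0} => // k; congr (_ ^+ _).
by rewrite /= /seval (F1_1 FB) /teval (pairing_tpow w x 1).
Qed.

Lemma generating_functionE p P : sheffer_group p ->
  generating_function P = sheffer_series p <->
  forall k (f : sym_tensor Phi k), P (monomial f) = \sum_(n < k.+1) mono n (sheffer_matrix p n k f).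
Proof.
move=> Gp.
have sE w k f v : pairing v (sheffer_series p w k f) =
    (k`!%:R)^-1 * (\sum_(n < k.+1) mono n (sheffer_matrix p n k f)) w.
  rewrite (sheffer_series_matrix w k Gp) -[LHS]/(_ * pairing v ((\sum_(n < k.+1) _) f)).
  congr (_ * _); rewrite toperator_sumE (lin_sum (@pairing_lin _ _ _ v)).
  by rewrite (lin_sum (@dual_eval_lin _ _ w)).
split=> [GP k f|PE].
  apply: dual_poly_ext => w; have := sE w k f w; rewrite -GP.
  by move=> /(mulfI (invr_neq0 (fact_neq0 k))).
apply/funext => w; apply: functional_extensionality_dep => k; apply/funext => f.
apply: pairing_inj => v; rewrite sE -PE.
by [].
Qed.

Lemma has_sheffer_exists p : sheffer_group p -> exists P, has_sheffer_series p P.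
Proof.
move=> Gp.
have [P [Pc PE]] := matrix_operator (fun n k _ => sheffer_matrix_continuous n k Gp).
exists P; split; last exact/generating_functionE.
split=> //; exists (sheffer_matrix p); split=> [i k _|k|k f w].
- exact: sheffer_matrix_continuous.
- exact: sheffer_matrix_diag.
- by rewrite PE (lin_sum (@dual_eval_lin _ _ w)).
Qed.

Lemma has_sheffer_unique p P Q : sheffer_group p ->
  has_sheffer_series p P -> has_sheffer_series p Q -> P = Q.
Proof.
move=> Gp [[[Pl _] _] /(generating_functionE _ Gp) PE] [[[Ql _] _] /(generating_functionE _ Gp) QE].
by apply: monomial_determines => // k f; rewrite PE QE.
Qed.

Lemma sheffer_group_mul p q : sheffer_group p -> sheffer_group q ->
  sheffer_group (sheffer_mul p q).
Proof.
move=> [FA FB] [FA' FB']; split; last exact: (F1_comp extP archK).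
by apply: (F0_mul extP archK) => //; exact: (F0_comp extP archK).
Qed.

(** Substitution of [q.2] commutes with products and exponentials, and also with the
    pairing with [w]. *)
Lemma sheffer_series_mul p q w : sheffer_group p -> sheffer_group q ->
  series_mul (series_comp (sheffer_series p w) q.2) q.1 = sheffer_series (sheffer_mul p q) w.
Proof.
move=> [FA FB] [FA' FB'].
have [Ac Bc] := (F0_continuous FA, F1_continuous FB).
have [[A'c B'c] B'0] := (F0_continuous FA', F1_continuous FB', F1_0 FB').
have pc := pairing_series_continuous w Bc.
have p0 := F1_pairing0 w FB.
have expc := series_exp_continuous extP archK pc p0.
rewrite /sheffer_series (series_comp_mul extP archK) //.
rewrite (series_comp_exp extP archK) // -(pairing_series_comp extP archK) //.
have BBc := pairing_series_continuous w (F1_continuous (F1_comp extP archK FB FB')).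
have BB0 := F1_pairing0 w (F1_comp extP archK FB FB').
rewrite -(series_mulA extP archK) //.
  exact: (series_exp_continuous extP archK).
exact: F0_continuous (F0_comp extP archK FA FB').
Qed.

(** [P] acts on the homogeneous parts of [Q (monomial f)] through the coefficients of
    its own generating function. These parts are the compositions of [q.2], multiplied
    by [q.1]; summing over their degrees substitutes [q.2] into the generating function
    of [P] and multiplies the result by [q.1]. *)
Lemma has_sheffer_mul p q P Q : sheffer_group p -> sheffer_group q ->
  has_sheffer_series p P -> has_sheffer_series q Q ->
  has_sheffer_series (sheffer_mul p q) (P \o Q).
Proof.
move=> Gp Gq [Pt GP] [Qt /(generating_functionE _ Gq) QE].
have [FA' FB'] := Gq; have [[A'c B'c] B'0] := (F0_continuous FA', F1_continuous FB', F1_0 FB').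
split; first exact: triangular_comp.
apply/funext => w; rewrite -sheffer_series_mul //.
set S := sheffer_series p w.
have Sc : continuous_series S by exact: sheffer_series_continuous.
have SBc := series_comp_continuous extP archK B'c B'0 Sc.
apply: functional_extensionality_dep => k.
have PQE : generating_function (P \o Q) w k = \sum_(n < k.+1)
    (n`!%:R / k`!%:R) *: (S n \o sheffer_matrix q n k : toperator Phi k 0).
  apply/funext => f; apply: pairing_inj => v.
  rewrite toperator_sumE (lin_sum (@pairing_lin _ _ _ v)) pairing_scalar.
  rewrite /= QE (lin_sum Pt.1.1) (lin_sum (@dual_eval_lin _ _ w)) mulr_sumr.
  apply: eq_bigr => n _; rewrite -[RHS]/(_ * pairing v (S n _)) /S -GP pairing_scalar.
  by rewrite [RHS]mulrA [X in _ = X * _]mulrAC divff ?fact_neq0 // mul1r.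
apply: toperator_ext => [||v x].
- rewrite PQE; apply: toperator_sum_continuous => n _; apply: toperatorZ_continuous.
  apply: toperator_comp_continuous => //; exact: sheffer_matrix_continuous.
- exact: (series_mul_continuous extP archK).
rewrite -[RHS]/(seval (series_mul (series_comp S q.2) q.1) v x k) (seval_mul extP archK) //.
rewrite PQE -[LHS]/(teval v x _) teval_sum.
have ME n : sheffer_matrix q n k (tpow x k) = (k`!%:R / n`!%:R) *:
    \sum_(l < k.+1) seval q.1 v x (k - l)%N *: ocomp q.2 l n (tpow x l).
  apply: pairing_inj => u; rewrite -/(teval u x _) teval_sheffer_matrix //.
  rewrite (linZ (@pairing_lin _ _ _ u)) (lin_sum (@pairing_lin _ _ _ u)).
  congr (_ * _); apply: eq_bigr => l _; rewrite (linZ (@pairing_lin _ _ _ u)) mulrC.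
  rewrite (seval_scalar _ u v) -[RHS]/(_ * teval u x (ocomp q.2 l n)).
  rewrite (teval_odot_compositions extP archK) //; congr (_ * _).
  apply: (coefX_trunc (N := l)) => // i il.
  by rewrite !coef_trunc il (leq_trans il) // -ltnS.
have lk (l : 'I_k.+1) : (l <= k)%N by rewrite -ltnS.
rewrite /conv; under [RHS]eq_bigr => l _ do
  rewrite (seval_comp extP archK B'c B'0 _ _ Sc (lk l)) mulr_suml.
rewrite exchange_big; apply: eq_bigr => n _; rewrite tevalZ /teval /= ME.
rewrite (linZ (Sc n).1) (lin_sum (Sc n).1) (linZ (@pairing_lin _ _ _ v)).
rewrite (lin_sum (@pairing_lin _ _ _ v)) -[X in _ * X]/(_ * _) mulrA.
have -> : n`!%:R / k`!%:R * (k`!%:R / n`!%:R) = 1 :> K.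
  by rewrite mulrA mulfVK ?fact_neq0 // divff ?fact_neq0.
rewrite mul1r; apply: eq_bigr => l _; rewrite (linZ (Sc n).1) (linZ (@pairing_lin _ _ _ v)).
by rewrite -[LHS]/(_ * _) mulrC.
Qed.

Lemma sheffer_group_one : sheffer_group (@sheffer_one K Phi).
Proof. by split; [exact: F0_one|exact: F1_id]. Qed.

Lemma has_sheffer_one : has_sheffer_series (@sheffer_one K Phi) idfun.
Proof.
split; first exact: triangular_id.
have G1 := sheffer_group_one; have [F1one F1id] := G1.
have idc := F1_continuous F1id.
apply/funext => w.
have pc := pairing_series_continuous w idc.
have p0 := F1_pairing0 w F1id.
have expc := series_exp_continuous extP archK pc p0.
rewrite /sheffer_series (series_mulr1 extP archK) //.
apply: functional_extensionality_dep => k.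
have gE : generating_function idfun w k =
    (k`!%:R)^-1 *: (fun f => scalar_tensor Phi (pairing w f) : sym_tensor Phi 0).
  by apply/funext => f; exact: sym_tensor_ext.
apply: toperator_ext => [||v x].
- rewrite gE; apply: toperatorZ_continuous.
  by apply: (pairing_toperator_continuous w); exact: toperator_id_continuous.
- exact: expc.
have powE n : teval v x (series_pow (pairing_series w idS) n k) =
    pairing w x ^+ n * (k == n)%:R.
  rewrite -[LHS]/(seval (series_pow (pairing_series w idS) n) v x k).
  rewrite (seval_pow extP archK n v x pc (leqnn k)) -coefX_linear.
  apply: (coefX_trunc (N := k)) => // j jk.
  by rewrite coef_trunc jk seval_pairing seval_id coefZ coefX mulrC.
rewrite (series_expE extP archK pc p0 (leqnn k)) -[RHS]/(teval v x _) teval_sum.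
rewrite (bigD1 ord_max) // tevalZ powE eqxx mulr1 [X in _ = _ + X]big1 => [|n nk].
  by rewrite gE addr0 -[LHS]/(_ * pairing w (tpow x k)) pairing_tpow.
rewrite tevalZ powE; case: eqP => [kn|_]; last by rewrite !mulr0.
by case/eqP: nk; exact: val_inj.
Qed.

(** The parts of degree 0 and 1 in [w] of [exp <w, B(xi)> A(xi)] are [A(xi)] and
    [<w, B(xi)> A(xi)], and [A] can be cancelled because its constant term is 1. *)
Lemma has_sheffer_inj p q P : sheffer_group p -> sheffer_group q ->
  has_sheffer_series p P -> has_sheffer_series q P -> p = q.
Proof.
move=> Gp Gq [_ /(generating_functionE _ Gp) PEp] [_ /(generating_functionE _ Gq) PEq].
have ME n k : (n <= k)%N -> sheffer_matrix p n k = sheffer_matrix q n k.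
  move=> nk; apply/funext => f.
  apply: (@monomial_sum_inj _ _ k.+1 (fun n => sheffer_matrix p n k f)
    (fun n => sheffer_matrix q n k f)) => //.
  by rewrite -PEp -PEq.
have kn0 (r : pair) w x k : sheffer_group r ->
    teval w x (sheffer_matrix r 0 k) = k`!%:R * seval r.1 w x k.
  move=> Gr; rewrite teval_sheffer_matrix // fact0 divr1; congr (_ * _).
  rewrite big_ord_recl /= subn0 expr0 coef1 eqxx mul1r big1 ?addr0 // => l _.
  by rewrite coef1 mul0r.
have kn1 (r : pair) w x k : sheffer_group r ->
    teval w x (sheffer_matrix r 1 k) = k`!%:R * conv (seval r.2 w x) (seval r.1 w x) k.
  move=> Gr; rewrite teval_sheffer_matrix // (_ : 1`! = 1%N) // divr1; congr (_ * _).
  apply: eq_bigr => l _; rewrite expr1 coef_trunc.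
  have -> // : (l <= k)%N by rewrite -ltnS.
have [[FA FB] [FA' FB']] := (Gp, Gq).
have Aeq w x : seval p.1 w x = seval q.1 w x.
  by apply/funext => k; apply: (mulfI (fact_neq0 k)); rewrite -!kn0 // ME.
have Beq w x : seval p.2 w x = seval q.2 w x.
  apply: (@conv_cancel _ (seval p.1 w x)); first exact: F0_seval0.
  apply/funext => -[|k].
    by rewrite /conv !big_ord1 /seval (F1_0 FB) (F1_0 FB') !mul0r.
  by apply: (mulfI (fact_neq0 k.+1)); rewrite -kn1 // ME // kn1 // Aeq.
case: p q Aeq Beq FA FB FA' FB' {Gp Gq PEp PEq ME} => [A B] [A' B'] /= Aeq Beq FA FB FA' FB'.
congr (_, _); apply: series_ext => //; try exact: F0_continuous; exact: F1_continuous.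
Qed.

Lemma sheffer_mapP p : sheffer_group p -> has_sheffer_series p (sheffer_map p).
Proof.
move=> Gp; rewrite /sheffer_map; case: xgetP => [P _ //|nP].
by have [P /nP] := has_sheffer_exists Gp.
Qed.

Lemma sheffer_map_eq p P : sheffer_group p -> has_sheffer_series p P -> sheffer_map p = P.
Proof. by move=> Gp; apply: has_sheffer_unique => //; exact: sheffer_mapP. Qed.

Lemma sheffer_map_inj p q : sheffer_group p -> sheffer_group q ->
  sheffer_map p = sheffer_map q -> p = q.
Proof.
move=> Gp Gq pq; apply: (has_sheffer_inj Gp Gq (sheffer_mapP Gp)).
rewrite pq; exact: sheffer_mapP.
Qed.

Lemma sheffer_map_mul p q : sheffer_group p -> sheffer_group q ->
  sheffer_map (sheffer_mul p q) = sheffer_map p \o sheffer_map q.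
Proof.
move=> Gp Gq; apply: sheffer_map_eq; first exact: sheffer_group_mul.
by apply: has_sheffer_mul => //; exact: sheffer_mapP.
Qed.

Lemma sheffer_map_one : sheffer_map (@sheffer_one K Phi) = idfun.
Proof. by apply: sheffer_map_eq; [exact: sheffer_group_one|exact: has_sheffer_one]. Qed.
End Sheffer.

(** * Groups and isomorphisms *)

Section GroupTransfer.
Variables (T : Type).
Local Notation compo := (fun P Q : T -> T => P \o Q).

(** A left inverse of [P] has itself a left inverse, which has to be [P]. *)
Lemma left_inverse_is_group (G : set (T -> T)) :
  G idfun -> (forall P Q, G P -> G Q -> G (P \o Q)) ->
  (forall P, G P -> exists2 Q, G Q & Q \o P = idfun) -> is_group compo idfun G.
Proof.
move=> G1 GM GV; split => // P GP.
have [Q GQ QP] := GV P GP; have [Q' GQ' QQ] := GV Q GQ.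
exists Q; split => //.
suff <- : Q' = P by [].
by rewrite -[Q']/(Q' \o idfun) -QP -[LHS]/((Q' \o Q) \o P) QQ.
Qed.

(** Associativity and the unit laws of [op] are pulled back along the injection
    [phi] from the composition of maps. *)
Lemma group_isomorphism_transfer (S : Type) (op : S -> S -> S) (e : S) (G : set S)
    (H : set (T -> T)) (phi : S -> T -> T) :
  G e -> (forall x y, G x -> G y -> G (op x y)) ->
  (forall x, G x -> exists2 y, G y & op y x = e) ->
  phi e = idfun -> (forall x y, G x -> G y -> phi (op x y) = phi x \o phi y) ->
  (forall x y, G x -> G y -> phi x = phi y -> x = y) -> H = phi @` G ->
  group_isomorphism op e compo idfun G H phi.
Proof.
move=> Ge GM GV phi1 phiM phi_inj ->.
split => //; last 1 first.
- split=> [x Gx|x y|_ [x Gx <-]]; [by exists x| |by exists x].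
  by move=> /set_mem Gx /set_mem Gy; exact: phi_inj.
- split=> // [x y z Gx Gy Gz|x Gx|x Gx].
  + have [Gxy Gyz] := (GM x y Gx Gy, GM y z Gy Gz).
    by apply: phi_inj; [exact: GM|exact: GM|rewrite !phiM].
  + by split; (apply: phi_inj => //; [exact: GM|rewrite phiM // phi1]).
  have [y Gy yx] := GV x Gx; have [z Gz zy] := GV y Gy.
  exists y; split => //.
  suff <- : z = x by [].
  apply: phi_inj => //; rewrite -[phi z]/(phi z \o idfun) -phi1 -yx phiM //.
  by rewrite -[LHS]/((phi z \o phi y) \o phi x) -phiM // zy phi1.
- apply: left_inverse_is_group; first by exists e.
    by move=> _ _ [x Gx <-] [y Gy <-]; exists (op x y); [exact: GM|exact: phiM].
  move=> _ [x Gx <-]; have [y Gy yx] := GV x Gx.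
  by exists (phi y); [exists y|rewrite -phiM // yx].
Qed.
End GroupTransfer.

Section ShefferGroups.
Variables (K : numFieldType) (Phi : LBspace K).
Hypothesis extP : extends_functionals Phi.
Hypothesis archK : forall e : K, 0 < e -> exists m, 1 <= m.+1%:R * e.
Local Notation poly := (dual_poly Phi).
Local Notation compo := (fun P Q : poly -> poly => P \o Q).
Local Notation oneS := (@one_series K Phi).
Local Notation idS := (@id_series K Phi).
Local Notation smap := (@sheffer_map K Phi).

Lemma triangular_is_group : is_group compo idfun (@triangular_operators K Phi).
Proof.
apply: left_inverse_is_group; first exact: triangular_id.
  exact: triangular_comp.
exact: triangular_left_inverse.
Qed.

Lemma sheffer_operatorsE : @sheffer_operators K Phi = smap @` @sheffer_group K Phi.
Proof.
apply/seteqP; split => [P [Pt [A [B [FA FB GP]]]]|_ [[A B] [FA FB] <-]].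
  by exists (A, B); [|exact: (sheffer_map_eq extP archK)].
have [Pt GP] := sheffer_mapP extP archK (p := (A, B)) (conj FA FB).
by split=> //; exists A, B.
Qed.

Lemma appell_group A : F0 A -> @sheffer_group K Phi (A, idS).
Proof. by move=> FA; split => //; exact: F1_id. Qed.

Lemma umbral_group B : F1 B -> @sheffer_group K Phi (oneS, B).
Proof. by move=> FB; split => //; exact: F0_one. Qed.

Lemma appell_operatorsE : @appell_operators K Phi = (fun A => smap (A, idS)) @` @F0 K Phi.
Proof.
apply/seteqP; split => [P [Pt [A [FA GP]]]|_ [A FA <-]].
  by exists A => //; apply: (sheffer_map_eq extP archK) => //; exact: appell_group.
have [Pt GP] := sheffer_mapP extP archK (appell_group FA).
by split=> //; exists A.
Qed.

Lemma umbral_operatorsE : @umbral_operators K Phi = (fun B => smap (oneS, B)) @` @F1 K Phi.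
Proof.
apply/seteqP; split => [P [Pt [B [FB GP]]]|_ [B FB <-]].
  by exists B => //; apply: (sheffer_map_eq extP archK) => //; exact: umbral_group.
have [Pt GP] := sheffer_mapP extP archK (umbral_group FB).
by split=> //; exists B.
Qed.

Lemma F0_solve (C : tseries Phi 0) B : F0 C -> F1 B ->
  exists2 A, F0 A & series_comp A B = C.
Proof.
move=> FC FB; have [A Ac AB] := series_comp_solve extP archK (F0_continuous FC) FB.
exists A => //; split => //; case: FC => _ <-; by rewrite -AB.
Qed.

Lemma F1_left_inverse (B : tseries Phi 1) : F1 B ->
  exists2 B', F1 B' & series_comp B' B = idS.
Proof.
move=> FB; have [C Cc CB] := series_comp_solve extP archK (F1_continuous (F1_id Phi)) FB.
exists C => //; split => //.
  by rewrite -[C 0%N]/(series_comp C B 0%N) CB.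
by rewrite -(series_comp_coef1 extP archK C FB) CB.
Qed.

Lemma sheffer_mul_appell A A' : F0 A -> F0 A' ->
  sheffer_mul (A, idS) (A', idS) = (series_mul A A', idS).
Proof.
move=> FA FA'; rewrite /sheffer_mul /= (series_comp_idr extP archK (F0_continuous FA)).
by rewrite (series_comp_idl extP archK (F1_id Phi)).
Qed.

Lemma sheffer_mul_umbral B B' : F1 B -> F1 B' ->
  sheffer_mul (oneS, B) (oneS, B') = (oneS, series_comp B B').
Proof.
move=> FB FB'; rewrite /sheffer_mul /=.
rewrite (series_comp_one extP archK (F1_continuous FB') (F1_0 FB')).
by rewrite (series_mulr1 extP archK) //; exact: F0_continuous (F0_one Phi).
Qed.

Lemma sheffer_mul_appell_umbral A B : F0 A -> F1 B ->
  sheffer_mul (A, idS) (oneS, B) = (series_comp A B, B).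
Proof.
move=> FA FB; rewrite /sheffer_mul /= (series_comp_idl extP archK FB).
by rewrite (series_mulr1 extP archK) //; exact: F0_continuous (F0_comp extP archK FA FB).
Qed.

Lemma sheffer_left_inverse p : sheffer_group p ->
  exists2 q, @sheffer_group K Phi q & sheffer_mul q p = @sheffer_one K Phi.
Proof.
case: p => A B [FA FB] /=.
have [C FC CA] := F0_inverse extP archK FA.
have [A' FA' A'B] := F0_solve FC FB.
have [B' FB' B'B] := F1_left_inverse FB.
exists (A', B') => //; by rewrite /sheffer_mul /= A'B CA B'B.
Qed.

Lemma sheffer_isomorphism : group_isomorphism (@sheffer_mul K Phi) (@sheffer_one K Phi)
  compo idfun (@sheffer_group K Phi) (@sheffer_operators K Phi) smap.
Proof.
apply: group_isomorphism_transfer.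
- exact: sheffer_group_one.
- exact: (sheffer_group_mul extP archK).
- exact: sheffer_left_inverse.
- exact: (sheffer_map_one extP archK).
- exact: (sheffer_map_mul extP archK).
- exact: (sheffer_map_inj extP archK).
- exact: sheffer_operatorsE.
Qed.

Lemma appell_isomorphism : group_isomorphism (@series_mul K Phi) oneS
  compo idfun (@F0 K Phi) (@appell_operators K Phi) (fun A => smap (A, idS)).
Proof.
apply: group_isomorphism_transfer.
- exact: F0_one.
- exact: (F0_mul extP archK).
- exact: (F0_inverse extP archK).
- exact: (sheffer_map_one extP archK).
- move=> A A' FA FA'; rewrite -sheffer_mul_appell // (sheffer_map_mul extP archK) //;
  exact: appell_group.
- move=> A A' FA FA' /(sheffer_map_inj extP archK (appell_group FA) (appell_group FA')).
  by case.
- exact: appell_operatorsE.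
Qed.

Lemma umbral_isomorphism : group_isomorphism (@series_comp K Phi 1) idS
  compo idfun (@F1 K Phi) (@umbral_operators K Phi) (fun B => smap (oneS, B)).
Proof.
apply: group_isomorphism_transfer.
- exact: F1_id.
- exact: (F1_comp extP archK).
- exact: F1_left_inverse.
- exact: (sheffer_map_one extP archK).
- move=> B B' FB FB'; rewrite -sheffer_mul_umbral // (sheffer_map_mul extP archK) //;
  exact: umbral_group.
- move=> B B' FB FB' /(sheffer_map_inj extP archK (umbral_group FB) (umbral_group FB')).
  by case.
- exact: umbral_operatorsE.
Qed.

Lemma appell_sub_sheffer : @appell_operators K Phi `<=` @sheffer_operators K Phi.
Proof. by move=> P [Pt [A [FA GP]]]; split=> //; exists A, idS; split => //; exact: F1_id. Qed.

Lemma umbral_sub_sheffer : @umbral_operators K Phi `<=` @sheffer_operators K Phi.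
Proof. by move=> P [Pt [B [FB GP]]]; split=> //; exists oneS, B; split => //; exact: F0_one. Qed.

Lemma appell_abelian : abelian_set compo (@appell_operators K Phi).
Proof.
have [_ _ _ phiM] := appell_isomorphism.
rewrite appell_operatorsE => _ _ [A FA <-] [A' FA' <-].
by rewrite -!phiM // (series_mulC extP archK) //; exact: F0_continuous.
Qed.

(** The second series of a product is the composition of the second series, and
    the Appell operators are the Sheffer operators whose second series is the
    identity. *)
Lemma appell_normal : normal_subgroup_of compo idfun
  (@sheffer_operators K Phi) (@appell_operators K Phi).
Proof.
have [_ gS _ phiM] := sheffer_isomorphism; have [_ gA _ _] := appell_isomorphism.
split; first by split=> //; exact: appell_sub_sheffer.
rewrite sheffer_operatorsE appell_operatorsE.
move=> _ _ _ [[A B] [FA FB] <-] [[A' B'] [FA' FB'] <-] gg [C FC <-].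
have GC := appell_group FC.
have BB : series_comp B B' = idS.
  have := sheffer_map_inj extP archK (p := sheffer_mul (A, B) (A', B')) (q := @sheffer_one K Phi).
  rewrite phiM // gg (sheffer_map_one extP archK) => E.
  have [_ //] := E (sheffer_group_mul extP archK (conj FA FB) (conj FA' FB'))
    (sheffer_group_one Phi) erefl.
have GAC := sheffer_group_mul extP archK (conj FA FB : sheffer_group (A, B)) GC.
have GACA := sheffer_group_mul extP archK GAC (conj FA' FB' : sheffer_group (A', B')).
have q2 : (sheffer_mul (sheffer_mul (A, B) (C, idS)) (A', B')).2 = idS.
  by rewrite /sheffer_mul /= (series_comp_idr extP archK (F1_continuous FB)) BB.
rewrite -!phiM //; case: (sheffer_mul _ _) q2 GACA => [D D'] /= -> [FD _].
by exists D.
Qed.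

Lemma appell_umbral_semidirect : semidirect_product compo idfun
  (@sheffer_operators K Phi) (@appell_operators K Phi) (@umbral_operators K Phi).
Proof.
have [_ gS _ phiM] := sheffer_isomorphism; have [_ gB _ _] := umbral_isomorphism.
split; [exact: appell_normal|by split=> //; exact: umbral_sub_sheffer| |].
  apply/seteqP; split => [P []|_ ->]; last first.
    by have [_ gA _ _] := appell_isomorphism; case: gA gB => idA _ _ _ _ [idB _ _ _ _].
  rewrite appell_operatorsE umbral_operatorsE => -[A FA <-] [B FB E].
  have [_ eA] := sheffer_map_inj extP archK (umbral_group FB) (appell_group FA) E.
  have [eA' _] := sheffer_map_inj extP archK (umbral_group FB) (appell_group FA) E.
  by rewrite -eA' /= (sheffer_map_one extP archK).
apply/seteqP; split => [P|_ [P AP [Q BQ <-]]]; last first.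
  by have [_ SM _ _ _] := gS; apply: SM; [exact: appell_sub_sheffer|exact: umbral_sub_sheffer].
rewrite sheffer_operatorsE => -[[A B] [FA FB] <-].
have [C FC CB] := F0_solve FA FB.
exists (smap (C, idS)); first by rewrite appell_operatorsE; exists C.
exists (smap (oneS, B)); first by rewrite umbral_operatorsE; exists B.
rewrite -phiM ?sheffer_mul_appell_umbral ?CB //; [exact: appell_group|exact: umbral_group].
Qed.

Lemma sheffer_group_theorem :
  let M := @triangular_operators K Phi in
  let S := @sheffer_operators K Phi in
  let A := @appell_operators K Phi in
  let B := @umbral_operators K Phi in
  [/\ subgroup_of compo idfun M S,
      normal_subgroup_of compo idfun S A /\ abelian_set compo A,
      subgroup_of compo idfun S B &
      semidirect_product compo idfun S A B] /\
  [/\ forall p, @sheffer_group _ Phi p -> exists! P, has_sheffer_series p P,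
      group_isomorphism (@sheffer_mul _ Phi) (@sheffer_one _ Phi)
        compo idfun (@sheffer_group _ Phi) S smap,
      group_isomorphism (@series_mul _ Phi) oneS
        compo idfun (@F0 _ Phi) A (fun a => smap (a, idS)) &
      group_isomorphism (@series_comp _ Phi 1) idS
        compo idfun (@F1 _ Phi) B (fun b => smap (oneS, b))].
Proof.
have [_ gS _ _] := sheffer_isomorphism; have [_ gB _ _] := umbral_isomorphism.
split; split.
- by split=> //; [exact: triangular_is_group|move=> P []].
- by split; [exact: appell_normal|exact: appell_abelian].
- by split=> //; exact: umbral_sub_sheffer.
- exact: appell_umbral_semidirect.
- move=> p Gp; have [P hP] := has_sheffer_exists extP archK Gp.
  by exists P; split=> // Q; exact: (has_sheffer_unique extP archK).
- exact: sheffer_isomorphism.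
- exact: appell_isomorphism.
- exact: umbral_isomorphism.
Qed.
End ShefferGroups.

Unset Implicit Arguments.
Local Open Scope complex_scope.

Theorem proposition5p5 (R : realType) (Phi : LBspace R[i]) :
  let id_op : dual_poly Phi -> dual_poly Phi := idfun in
  let comp_op (P Q : dual_poly Phi -> dual_poly Phi) := P \o Q in
  let M := @triangular_operators _ Phi in
  let S := @sheffer_operators _ Phi in
  let A := @appell_operators _ Phi in
  let B := @umbral_operators _ Phi in
  [/\ subgroup_of comp_op id_op M S,
      normal_subgroup_of comp_op id_op S A /\ abelian_set comp_op A,
      subgroup_of comp_op id_op S B &
      semidirect_product comp_op id_op S A B] /\
  [/\ forall p, @sheffer_group _ Phi p -> exists! P, has_sheffer_series p P,
      group_isomorphism (@sheffer_mul _ Phi) (@sheffer_one _ Phi)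
        comp_op id_op (@sheffer_group _ Phi) S (@sheffer_map _ Phi),
      group_isomorphism (@series_mul _ Phi) (@one_series _ Phi)
        comp_op id_op (@F0 _ Phi) A (fun a => sheffer_map (a, @id_series _ Phi)) &
      group_isomorphism (@series_comp _ Phi 1) (@id_series _ Phi)
        comp_op id_op (@F1 _ Phi) B (fun b => sheffer_map (@one_series _ Phi, b))].
Proof.
exact (@sheffer_group_theorem _ Phi (@LB_extends_functionals R Phi) (@complex_archimedean R)).
Qed.
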